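(* Assume the setting of the context and suppose: (H1) $\theta$ is invertible (with measurable inverse), ergodic and $\mathbb P$-preserving; (H2) there is $\delta>0$ with $\sum_{n\ge1}\alpha_{\mathbb P}(n)^{\delta/(2+\delta)}<\infty$; (H3) there exist a dynamically stationary state $\mathfrak s:\Omega\to\mathcal S_d$ and a deterministic sequence $(r_n)_{n\ge1}\subseteq[0,\infty)$ with $\sum_{n\ge1} r_n^{\delta/(2+\delta)}<\infty$ (same $\delta$ as in (H2)) such that for every random initial state $\vartheta$ and every $n\in\mathbb N$, $\mathbb E_{\mathbb P}\big[\|\Phi^{(n)}_\omega(\vartheta(\omega))-\mathfrak s(\theta^n\omega)\|_1\big]\le r_n$. Fix $m\in\mathbb N$, $\mathbf b\in\mathcal A^m$ and set $\mu_{\mathbf b}:=\mathbb E_{\overline{\mathbb Q}_{\mathfrak s}}[\delta N_1^{\mathbf b}]=\int_\Omega\mathbb Q_{\mathfrak s(\omega);\omega}(C_{\mathbf b})\,d\mathbb P(\omega)$. Then the series $$\Sigma_{\mathbf b}^2:=\mathbb E_{\overline{\mathbb Q}_{\mathfrak s}}\big[(\delta N_1^{\mathbf b}-\mu_{\mathbf b})^2\big]+2\sum_{k=1}^\infty\mathbb E_{\overline{\mathbb Q}_{\mathfrak s}}\big[(\delta N_1^{\mathbf b}-\mu_{\mathbf b})(\delta N_{1+k}^{\mathbf b}-\mu_{\mathbf b})\big]$$ converges absolutely and defines $\Sigma_{\mathbf b}^2\in[0,\infty)$, and under $\overline{\mathbb Q}_{\mathfrak s}$, $$\frac1{\sqrt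 n}\sum_{k=1}^n(\delta N_k^{\mathbf b}-\mu_{\mathbf b})\xrightarrow{\ d\ }\mathcal N(0,\Sigma_{\mathbf b}^2),\qquad n\to\infty.$$ If $\Sigma_{\mathbf b}^2=0$, the normalized sums converge to $0$ in $L^2(\overline{\mathbb Q}_{\mathfrak s})$, hence in probability.
   Context: Let $d\in\mathbb N$, $M_d$ the $d\times d$ complex matrices with trace norm $\|X\|_1=\operatorname{tr}|X|$, $\mathcal S_d$ the density matrices. Let $\mathcal A$ be finite, $(\mathcal A^{\mathbb N},\Sigma)$ the sequence space with product $\sigma$-algebra and coordinates $A_n(\bar a)=a_n$. $(\Omega,\mathcal F,\mathbb P)$ is a probability space, $\theta:\Omega\to\Omega$ measurable. A random instrument is a family of completely positive trace-non-increasing linear maps $\mathcal T_{a;\omega}:M_d\to M_d$ ($a\in\mathcal A$), measurable in $\omega$, with $\sum_a\mathcal T_{a;\omega}$ trace preserving $\mathbb P$-a.s.; write $\mathcal V_\omega=(\mathcal T_{a;\omega})_a$, $\Phi_{k;\omega}=\sum_a\mathcal T_{a;\theta^k\omega}$, $\Phi^{(n)}_\omega=\Phi_{n;\omega}\circ\cdots\circ\Phi_{1;\omega}$. Quenched law: $\mathbb Q_{\rho;\omega}$ is the probability on $\Sigma$ with $\mathbb Q_{\rho;\omega}(A_1=a_1,\dots,A_n=a_n)=\operatorname{tr}[(\mathcal T_{a_n;\theta^n\omega}\circ\cdots\circ\mathcal T_{a_1;\theta\omega})(\rho)]$. A random initial state is a measurable $\vartheta:\Omega\to\mathcal S_d$;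 its annealed law is the probability $\overline{\mathbb Q}_\vartheta(d\omega,d\bar a)=\mathbb P(d\omega)\mathbb Q_{\vartheta(\omega);\omega}(d\bar a)$ on $(\Omega\times\mathcal A^{\mathbb N},\mathcal F\otimes\Sigma)$. A random state $\mathfrak s$ is dynamically stationary if $\Phi^{(n)}_\omega(\mathfrak s(\omega))=\mathfrak s(\theta^n\omega)$ for all $n\in\mathbb N$, $\mathbb P$-a.s. For $\mathbf b=(b_1,\dots,b_m)$, $C_{\mathbf b}=\{\bar a: a_1=b_1,\dots,a_m=b_m\}$ and $\delta N_k^{\mathbf b}(\omega,\bar a)=\mathbf 1\{a_k=b_1,\dots,a_{k+m-1}=b_m\}$. Mixing: $\mathcal F_k=\sigma(\omega\mapsto\mathcal V_{\theta^j\omega}:j\le k)$, $\mathcal F^k=\sigma(\omega\mapsto\mathcal V_{\theta^j\omega}:j\ge k)$, $\alpha_{\mathbb P}(\mathcal B,\mathcal C)=\sup\{|\mathbb P(B\cap C)-\mathbb P(B)\mathbb P(C)|:B\in\mathcal B,C\in\mathcal C\}$, $\alpha_{\mathbb P}(n)=\sup_{k\in\mathbb N}\alpha_{\mathbb P}(\mathcal F_k,\mathcal F^{k+n})$. *)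

(* Defs.v *)
(* Complex numbers: R[i] from mathcomp-real-closed. *)
From mathcomp Require Import all_boot all_order all_algebra.
From mathcomp Require Import all_classical all_reals all_analysis.
From mathcomp.real_closed Require Import complex.

Set Implicit Arguments.
Unset Strict Implicit.
Unset Printing Implicit Defensive.

Import Order.TTheory GRing.Theory Num.Theory numFieldNormedType.Exports.
Local Open Scope classical_set_scope.
Local Open Scope ring_scope.

(* Linear algebra on M_d = 'M[R[i]]_d                                   *)

(* conjugate transpose *)
Definition adjmx (R : realType) m n (M : 'M[R[i]]_(m, n)) : 'M[R[i]]_(n, m) :=
  (map_mx (fun z => z^*) M)^T.

(* positive semidefinite: <v, X v> >= 0 for all v (order of the numClosedField
   R[i]: 0 <= z means z is real and nonnegative) *)
Definition psd (R : realType) n (X : 'M[R[i]]_n) : Prop :=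
  forall v : 'cV[R[i]]_n, 0 <= (adjmx v *m X *m v) 0 0.

(* density matrices S_d *)
Definition density (R : realType) n (X : 'M[R[i]]_n) : Prop :=
  psd X /\ \tr X = 1.

(* trace norm ||X||_1 = tr |X|, |X| the (unique) psd square root of X^* X *)
Definition tracenorm (R : realType) n (X : 'M[R[i]]_n) : R :=
  sup [set t : R | exists Y : 'M[R[i]]_n,
         [/\ psd Y, Y *m Y = adjmx X *m X & t = complex.Re (\tr Y)]].

(* A block matrix (X i j)_{i,j<k} in M_k(M_d) is psd *)
Definition blockpsd (R : realType) k d (X : 'I_k -> 'I_k -> 'M[R[i]]_d) : Prop :=
  forall v : 'I_k -> 'cV[R[i]]_d,
    0 <= \sum_(i < k) \sum_(j < k) (adjmx (v i) *m X i j *m v j) 0 0.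

Definition is_linear_map (R : realType) d (T : 'M[R[i]]_d -> 'M[R[i]]_d) : Prop :=
  forall (c : R[i]) (X Y : 'M[R[i]]_d), T (c *: X + Y) = c *: T X + T Y.

(* complete positivity: id_k (x) T is positive for every k *)
Definition completely_positive (R : realType) d (T : 'M[R[i]]_d -> 'M[R[i]]_d) : Prop :=
  forall k (X : 'I_k -> 'I_k -> 'M[R[i]]_d),
    blockpsd X -> blockpsd (fun i j => T (X i j)).

Definition trace_nonincreasing (R : realType) d (T : 'M[R[i]]_d -> 'M[R[i]]_d) : Prop :=
  forall X, psd X -> \tr (T X) <= \tr X.

Definition trace_preserving (R : realType) d (T : 'M[R[i]]_d -> 'M[R[i]]_d) : Prop :=
  forall X, \tr (T X) = \tr X.

(* Measurability of complex valued maps                                *)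

Definition cmeasurable (dO : measure_display) (O : measurableType dO) (R : realType)
  (f : O -> R[i]) : Prop :=
  measurable_fun setT (fun w => complex.Re (f w)) /\
  measurable_fun setT (fun w => complex.Im (f w)).

(* Random instruments                                                  *)

Definition random_instrument (dO : measure_display) (O : measurableType dO)
  (R : realType) (P : probability O R) (A : finType) (d : nat)
  (T : A -> O -> 'M[R[i]]_d -> 'M[R[i]]_d) : Prop :=
  [/\ forall a w, is_linear_map (T a w),
      forall a w, completely_positive (T a w),
      forall a w, trace_nonincreasing (T a w),
      forall a (X : 'M[R[i]]_d) i j, cmeasurable (fun w => T a w X i j)
    & {ae P, forall w, trace_preserving (fun X => \sum_(a : A) T a w X)}].

(* random state: measurable map into density matrices *)
Definition random_state (dO : measure_display) (O : measurableType dO)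
  (R : realType) (d : nat) (s : O -> 'M[R[i]]_d) : Prop :=
  (forall w, density (s w)) /\ (forall i j, cmeasurable (fun w => s w i j)).

(* Phi_{k;w} = sum_a T_{a; theta^k w} *)
Definition Phi (O : Type) (R : realType) (A : finType) (d : nat)
  (T : A -> O -> 'M[R[i]]_d -> 'M[R[i]]_d) (theta : O -> O) (k : nat) (w : O)
  (X : 'M[R[i]]_d) : 'M[R[i]]_d :=
  \sum_(a : A) T a (iter k theta w) X.

(* Phi^(n)_w = Phi_{n;w} o ... o Phi_{1;w} *)
Fixpoint Phin (O : Type) (R : realType) (A : finType) (d : nat)
  (T : A -> O -> 'M[R[i]]_d -> 'M[R[i]]_d) (theta : O -> O) (n : nat) (w : O)
  (X : 'M[R[i]]_d) : 'M[R[i]]_d :=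
  match n with
  | 0 => X
  | n'.+1 => Phi T theta n'.+1 w (Phin T theta n' w X)
  end.

(* dynamically stationary random state *)
Definition dyn_stationary (dO : measure_display) (O : measurableType dO)
  (R : realType) (P : probability O R) (A : finType) (d : nat)
  (T : A -> O -> 'M[R[i]]_d -> 'M[R[i]]_d) (theta : O -> O)
  (s : O -> 'M[R[i]]_d) : Prop :=
  forall n : nat, (0 < n)%N ->
    {ae P, forall w, Phin T theta n w (s w) = s (iter n theta w)}.

(* (T_{a_n; theta^n w} o ... o T_{a_1; theta^(k0) w})(rho) for the word
   w = [:: a_1; ...; a_n], the first letter being applied at time k0 *)
Fixpoint apply_word (O : Type) (R : realType) (A : finType) (d : nat)
  (T : A -> O -> 'M[R[i]]_d -> 'M[R[i]]_d) (theta : O -> O) (k0 : nat) (w : O)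
  (rho : 'M[R[i]]_d) (word : seq A) : 'M[R[i]]_d :=
  match word with
  | [::] => rho
  | a :: word' => apply_word T theta k0.+1 w (T a (iter k0 theta w) rho) word'
  end.

(* Q_{rho;w}(A_1 = a_1, ..., A_n = a_n) = tr[(T_{a_n;theta^n w} o ... o T_{a_1;theta w})(rho)]
   (this trace is real and nonnegative; we take its real part) *)
Definition quenched_cyl (O : Type) (R : realType) (A : finType) (d : nat)
  (T : A -> O -> 'M[R[i]]_d -> 'M[R[i]]_d) (theta : O -> O) (w : O)
  (rho : 'M[R[i]]_d) (word : seq A) : R :=
  complex.Re (\tr (apply_word T theta 1 w rho word)).

(* Expectation under the annealed law Qbar_vartheta of a function F of the
   first N coordinates (A_1, ..., A_N):
     E[F] = int_O sum_{a in A^N} Q_{vartheta(w);w}(A_1=a_1,..,A_N=a_N) F(a) dP(w) *)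
Definition annE (dO : measure_display) (O : measurableType dO)
  (R : realType) (P : probability O R) (A : finType) (d : nat)
  (T : A -> O -> 'M[R[i]]_d -> 'M[R[i]]_d) (theta : O -> O)
  (vt : O -> 'M[R[i]]_d) (N : nat) (F : seq A -> R) : R :=
  Rintegral P setT (fun w =>
    \sum_(word : N.-tuple A) quenched_cyl T theta w (vt w) word * F word).

(* delta N_k^b (a) = 1{a_k = b_1, ..., a_{k+m-1} = b_m}  (k >= 1) *)
Definition dN (A : finType) (R : realType) (m : nat) (b : m.-tuple A) (k : nat)
  (word : seq A) : R :=
  (take m (drop k.-1 word) == b :> seq A)%:R.

(* Ergodic theory and strong mixing                                    *)

Definition measure_preserving (dO : measure_display) (O : measurableType dO)
  (R : realType) (P : probability O R) (theta : O -> O) : Prop :=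
  forall B : set O, measurable B -> P (theta @^-1` B) = P B.

Definition ergodic (dO : measure_display) (O : measurableType dO)
  (R : realType) (P : probability O R) (theta : O -> O) : Prop :=
  forall B : set O, measurable B -> theta @^-1` B = B ->
    P B = 0%E \/ P B = 1%E.

(* theta^j for j in Z, thetainv the inverse of theta *)
Definition iterz (O : Type) (theta thetainv : O -> O) (j : int) (w : O) : O :=
  match j with
  | Posz n => iter n theta w
  | Negz n => iter n.+1 thetainv w
  end.

(* generators of sigma(w |-> V_{theta^j w} : j in J): preimages of Borel sets
   under the real and imaginary parts of the entries of T_{a; theta^j w}(X) *)
Definition instr_generators (dO : measure_display) (O : measurableType dO)
  (R : realType) (A : finType) (d : nat)
  (T : A -> O -> 'M[R[i]]_d -> 'M[R[i]]_d) (theta thetainv : O -> O)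
  (J : set int) : set (set O) :=
  [set E | exists j, J j /\ exists a (X : 'M[R[i]]_d) i l (B : set R),
      measurable B /\
      (E = [set w | B (complex.Re (T a (iterz theta thetainv j w) X i l))] \/
       E = [set w | B (complex.Im (T a (iterz theta thetainv j w) X i l))])].

(* F_k = sigma(V_{theta^j .} : j <= k) *)
Definition Fpast (dO : measure_display) (O : measurableType dO)
  (R : realType) (A : finType) (d : nat)
  (T : A -> O -> 'M[R[i]]_d -> 'M[R[i]]_d) (theta thetainv : O -> O)
  (k : int) : set (set O) :=
  <<s instr_generators T theta thetainv [set j | (j <= k)%R] >>.

(* F^k = sigma(V_{theta^j .} : j >= k) *)
Definition Ffuture (dO : measure_display) (O : measurableType dO)
  (R : realType) (A : finType) (d : nat)
  (T : A -> O -> 'M[R[i]]_d -> 'M[R[i]]_d) (theta thetainv : O -> O)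
  (k : int) : set (set O) :=
  <<s instr_generators T theta thetainv [set j | (k <= j)%R] >>.

(* alpha_P(B, C) *)
Definition alpha_coef (dO : measure_display) (O : measurableType dO)
  (R : realType) (P : probability O R) (B C : set (set O)) : \bar R :=
  ereal_sup [set `|(P (E `&` F) - P E * P F)%E|%E | E in B & F in C].

(* alpha_P(n) = sup_{k in N} alpha_P(F_k, F^{k+n}) *)
Definition alpha_mix (dO : measure_display) (O : measurableType dO)
  (R : realType) (P : probability O R) (A : finType) (d : nat)
  (T : A -> O -> 'M[R[i]]_d -> 'M[R[i]]_d) (theta thetainv : O -> O)
  (n : nat) : \bar R :=
  ereal_sup [set alpha_coef P (Fpast T theta thetainv k%:Z)
                              (Ffuture T theta thetainv (k + n)%:Z)
            | k in [set k : nat | (0 < k)%N]].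

(* Gaussian limit                                                      *)

(* E[g(Z)] for Z ~ N(0, s2); N(0,0) is the Dirac mass at 0 *)
Definition gauss_expect (R : realType) (s2 : R) (g : R -> R) : R :=
  if s2 == 0 then g 0
  else Rintegral (normal_prob 0 (Num.sqrt s2)) setT g.

(* Main.v *)
Require Import Defs.
From mathcomp Require Import all_boot all_order all_algebra.
From mathcomp Require Import all_classical all_reals all_analysis.
From mathcomp.real_closed Require Import complex.
From mathcomp Require Import measurable_realfun.
From mathcomp Require Import ring lra zify.
Import Order.TTheory GRing.Theory Num.Theory numFieldNormedType.Exports.
Set Implicit Arguments.
Unset Strict Implicit.
Unset Printing Implicit Defensive.
Local Open Scope classical_set_scope.
Local Open Scope ring_scope.

(** Under the annealed law the outcomes are a stationary sequence, and the law of
    the first N letters is a finite sum, so everything reduces to expectations of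
    functions of words. Covariances across a gap of 2n letters are of order
    alpha(n) + r n: by (H3) the system forgets its state along n letters, so that
    past and future become functions of disjoint stretches of the environment, and
    alpha-mixing decouples these. Since alpha(n) <= 1 and only min(1, r n) matters,
    the powers in (H2) and (H3), whose exponent lies in (0,1), dominate these rates,
    so the covariances are summable. The central limit theorem is then Bernstein's
    big and small blocks combined with Lindeberg's replacement of the blocks by
    Gaussians, tested on logistic functions; these determine convergence for all
    bounded continuous functions because the second moments stay bounded. *)

(** * Positive matrices and the trace norm *)

(** Two obstacles shape the mixing estimate. Nothing makes [s] measurable with respect to a finite
    stretch of instruments, and the outcomes already read tilt the state. (H3) answers both, applied
    to two different random initial states: a constant density matrix, which turns observables into
    functions of finitely many instruments, and the normalized state left behind by the letters
    read, transported to its own time by [thetainv]. Normalizing requires a weight bounded away from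
    zero, so a test function of the past is first raised by 2 into [[1, 3]]; the constant cancels at
    the end. In the limit theorem no independent Gaussians are constructed: they are integrated out
    beforehand into a smoothed test function, whose expansion in the standard deviation is matched
    with the expansion in a block. Logistic functions suit this because their derivatives are
    polynomials in themselves, while steep ones imitate a staircase. Constants are crude throughout,
    with dimension factors and without factorials, since only summability and limits matter. *)

Section Matrices.
Variables (R : realType).
Local Notation C := R[i].

Lemma conjCE (z : C) : z^* = conjc z. Proof. by []. Qed.

Lemma adjmxE n p (X : 'M[C]_(n, p)) i j : adjmx X i j = (X j i)^*.
Proof. by rewrite !mxE. Qed.

Lemma sesqE n (X : 'M[C]_n) (v : 'cV[C]_n) :
  (adjmx v *m X *m v) 0 0 = \sum_i \sum_j (v i 0)^* * X i j * v j 0.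
Proof.
rewrite mxE exchange_big /=; apply: eq_bigr => j _.
rewrite mxE mulr_suml; apply: eq_bigr => i _.
by rewrite adjmxE.
Qed.

Lemma psd0 n : psd (0 : 'M[C]_n).
Proof. by move=> v; rewrite mulmx0 mul0mx mxE. Qed.

Lemma psdD n (X Y : 'M[C]_n) : psd X -> psd Y -> psd (X + Y).
Proof. by move=> hX hY v; rewrite mulmxDr mulmxDl mxE addr_ge0. Qed.

Lemma psdZ n (a : C) (X : 'M[C]_n) : 0 <= a -> psd X -> psd (a *: X).
Proof. by move=> a0 hX v; rewrite -scalemxAr -scalemxAl mxE mulr_ge0. Qed.

Lemma psd_sum n (I : finType) (X : I -> 'M[C]_n) :
  (forall i, psd (X i)) -> psd (\sum_i X i).
Proof.
by move=> h; apply: (big_ind (@psd R n)) => [|X1 X2|i _]; [exact: psd0|exact: psdD|].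
Qed.

Lemma cReD (x y : C) : complex.Re (x + y) = complex.Re x + complex.Re y.
Proof. by case: x; case: y. Qed.
Lemma cImD (x y : C) : complex.Im (x + y) = complex.Im x + complex.Im y.
Proof. by case: x; case: y. Qed.
Lemma cReM (x y : C) :
  complex.Re (x * y) = complex.Re x * complex.Re y - complex.Im x * complex.Im y.
Proof. by case: x; case: y. Qed.
Lemma cImM (x y : C) :
  complex.Im (x * y) = complex.Re x * complex.Im y + complex.Im x * complex.Re y.
Proof. by case: x; case: y. Qed.
Lemma cRe_sum (I : Type) (r : seq I) (P : pred I) (F : I -> C) :
  complex.Re (\sum_(i <- r | P i) F i) = \sum_(i <- r | P i) complex.Re (F i).
Proof. by apply: (big_morph (@complex.Re R)) => //; exact: cReD. Qed.
Lemma cIm_sum (I : Type) (r : seq I) (P : pred I) (F : I -> C) :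
  complex.Im (\sum_(i <- r | P i) F i) = \sum_(i <- r | P i) complex.Im (F i).
Proof. by apply: (big_morph (@complex.Im R)) => //; exact: cImD. Qed.
Lemma cRe_conj (x : C) : complex.Re x^* = complex.Re x.
Proof. by rewrite conjCE; case: x. Qed.
Lemma cIm_conj (x : C) : complex.Im x^* = - complex.Im x.
Proof. by rewrite conjCE; case: x. Qed.

(** This is the form at the vector [e_j + z e_k]. Letting [z] run through the fourth roots of unity
    recovers off-diagonal entries by polarization. *)
Lemma psd_sesq_pair n (X : 'M[C]_n) (j k : 'I_n) (z : C) : j != k -> psd X ->
  0 <= X j j + z^* * X k j + z * X j k + z^* * z * X k k.
Proof.
move=> jk; have kj : k != j by rewrite eq_sym.
pose v : 'cV[C]_n := \col_i (if i == j then 1 else if i == k then z else 0).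
have vj : v j 0 = 1 by rewrite mxE eqxx.
have vk : v k 0 = z by rewrite mxE eqxx (negbTE kj).
have v0 i : (i != j) && (i != k) -> v i 0 = 0.
  by move=> /andP[/negbTE ij /negbTE ik]; rewrite mxE ij ik.
have hs l : \sum_i (v l 0)^* * X l i * v i 0 = (v l 0)^* * (X l j + z * X l k).
  rewrite (bigD1 j)//= (bigD1 k)//= big1; last first.
    by move=> i /v0 ->; rewrite mulr0.
  by rewrite vj vk; ring.
move=> /(_ v); rewrite sesqE (eq_bigr _ (fun l _ => hs l)).
rewrite (bigD1 j)//= (bigD1 k)//= big1; last first.
  by move=> i /v0 ->; rewrite conjC0 mul0r.
rewrite vj vk conjC1.
by congr (0 <= _); ring.
Qed.

Lemma psd_diag_ge0 n (X : 'M[C]_n) j : psd X -> 0 <= X j j.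
Proof.
pose v : 'cV[C]_n := \col_i (i == j)%:R.
have v1 : v j 0 = 1 by rewrite mxE eqxx.
have v0 i : i != j -> v i 0 = 0 by move=> ij; rewrite mxE (negbTE ij).
have hs l : \sum_i (v l 0)^* * X l i * v i 0 = (v l 0)^* * X l j.
  rewrite (bigD1 j)//= big1; last by move=> i /v0 ->; rewrite mulr0.
  by rewrite v1 mulr1 addr0.
move=> /(_ v); rewrite sesqE (eq_bigr _ (fun l _ => hs l)).
rewrite (bigD1 j)//= big1; last by move=> i /v0 ->; rewrite conjC0 mul0r.
by rewrite v1 conjC1 mul1r addr0.
Qed.

(** [psd] only asks the form to be nonnegative, so symmetry must be extracted: reality at [z = 1]
    kills the imaginary part of the sum of the two entries, reality at [z = i] the real part of
    their difference. *)
Lemma psd_hermitian n (X : 'M[C]_n) i j : psd X -> X j i = (X i j)^*.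
Proof.
move=> hX; have [->|ij] := eqVneq i j.
  by rewrite geC0_conj// psd_diag_ge0.
have := psd_sesq_pair 1 ij hX; have := psd_sesq_pair 'i%C ij hX.
have := psd_diag_ge0 i hX; have := psd_diag_ge0 j hX.
rewrite !conjCE !lecE.
case: (X i i) => a b; case: (X j j) => c d; case: (X i j) => e f; case: (X j i) => g h.
rewrite /=; move=> /andP[/eqP h1 h2] /andP[/eqP h3 h4] /andP[/eqP h5 h6] /andP[/eqP h7 h8].
apply/eqP; rewrite eq_complex /=; apply/andP; split; apply/eqP; lra.
Qed.

(** The values [1, -1, i, -i] of [z] bound twice each part of the entry by the sum of two diagonal
    entries, hence by the trace. *)
Lemma psd_offdiag_le n (X : 'M[C]_n) i j : psd X ->
  `|complex.Re (X i j)| <= complex.Re (\tr X) /\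
  `|complex.Im (X i j)| <= complex.Re (\tr X).
Proof.
move=> hX.
have htr : complex.Re (\tr X) = \sum_k complex.Re (X k k) by rewrite /mxtrace cRe_sum.
have hd k : 0 <= complex.Re (X k k).
  by have := psd_diag_ge0 k hX; rewrite lecE => /andP[].
have [->|ij] := eqVneq i j.
  have := psd_diag_ge0 j hX; rewrite lecE => /andP[/eqP -> _].
  rewrite normr0 htr; split; last by apply: sumr_ge0.
  by rewrite ger0_norm// (bigD1 j)//= lerDl sumr_ge0.
have hij : complex.Re (X i i) + complex.Re (X j j) <= complex.Re (\tr X).
  rewrite htr (bigD1 i)//= (bigD1 j) 1?eq_sym//=.
  by rewrite addrA lerDl sumr_ge0.
have := psd_sesq_pair 1 ij hX; have := psd_sesq_pair 'i%C ij hX.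
have := psd_sesq_pair (-1) ij hX; have := psd_sesq_pair (-'i%C) ij hX.
have hh := psd_hermitian i j hX.
have := hd i; have := hd j; move: hij.
rewrite hh !conjCE !lecE.
case: (X i i) => a b; case: (X j j) => c d; case: (X i j) => e f.
rewrite /= => h0 h1 h2 /andP[_ h6] /andP[_ h8] /andP[_ h9] /andP[_ h10].
by split; rewrite ler_norml; apply/andP; split; lra.
Qed.

Lemma adjmxM n p q (X : 'M[C]_(n, p)) (Y : 'M[C]_(p, q)) :
  adjmx (X *m Y) = adjmx Y *m adjmx X.
Proof. by rewrite /adjmx map_mxM trmx_mul. Qed.

Lemma adjmxK n p (X : 'M[C]_(n, p)) : adjmx (adjmx X) = X.
Proof. by apply/matrixP => i j; rewrite !adjmxE conjCK. Qed.

Lemma psd_gram n (X : 'M[C]_n) : psd (adjmx X *m X).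
Proof.
move=> v; rewrite mulmxA -adjmxM -mulmxA mxE sumr_ge0// => i _.
by rewrite adjmxE mulrC mul_conjC_ge0.
Qed.

Lemma psd_conj n (X P : 'M[C]_n) : psd X -> psd (adjmx P *m X *m P).
Proof. by move=> hX v; rewrite !mulmxA -adjmxM -mulmxA; exact: hX. Qed.

Lemma psd_diag_mx n (D : 'rV[C]_n) : (forall i, 0 <= D 0 i) -> psd (diag_mx D).
Proof.
move=> hD v; rewrite sesqE sumr_ge0// => i _.
rewrite (bigD1 i)//= big1 ?addr0; last first.
  by move=> j ij; rewrite mxE eq_sym (negbTE ij) mulr0 mul0r.
by rewrite mxE eqxx mulr1n mulrAC mulr_ge0// mulrC mul_conjC_ge0.
Qed.

(** Spectral theorem, with square roots taken on the diagonal. Existence makes the supremum in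
    [tracenorm] range over a nonempty set. *)
Lemma psd_sqrt n (X : 'M[C]_n) : psd X -> exists2 Y, psd Y & Y *m Y = X.
Proof.
move=> hX.
have /orthomx_spectralP XE : X \is normalmx.
  apply/normalmxP; suff -> : map_mx Num.conj X^T = X by [].
  by apply/matrixP => i j; rewrite !mxE (psd_hermitian i j hX) conjCK.
move: XE; set P := spectralmx X; set D := spectral_diag X => XE.
have Pu : P \is unitarymx := spectral_unitarymx X.
have PE : invmx P = adjmx P by rewrite invmx_unitary// /adjmx map_trmx.
have PP : P *m adjmx P = 1%:M by rewrite -PE mulmxV// spectral_unit.
rewrite PE in XE.
have D0 i : 0 <= D 0 i.
  suff -> : D 0 i = (adjmx (adjmx P) *m X *m adjmx P) i i.
    exact/psd_diag_ge0/psd_conj.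
  rewrite XE adjmxK !mulmxA PP mul1mx -mulmxA PP mulmx1.
  by rewrite mxE eqxx mulr1n.
exists (adjmx P *m diag_mx (map_mx sqrtC D) *m P).
  by apply/psd_conj/psd_diag_mx => i; rewrite mxE sqrtC_ge0.
rewrite -!mulmxA [P *m (adjmx P *m _)]mulmxA PP mul1mx.
rewrite [RHS]XE -!mulmxA; congr (_ *m _); rewrite !mulmxA; congr (_ *m _).
rewrite mulmx_diag; congr diag_mx.
by apply/rowP => i; rewrite !mxE -expr2 sqrtCK.
Qed.

Lemma Re_tr_gram n (X : 'M[C]_n) i j :
  complex.Re (X i j) ^+ 2 + complex.Im (X i j) ^+ 2
    <= complex.Re ((adjmx X *m X) j j).
Proof.
rewrite mxE cRe_sum (bigD1 i)//=.
have E k : complex.Re (adjmx X j k * X k j) =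
   complex.Re (X k j) ^+ 2 + complex.Im (X k j) ^+ 2.
  by rewrite adjmxE cReM cRe_conj cIm_conj; ring.
rewrite E lerDl sumr_ge0// => k _.
by rewrite E addr_ge0// sqr_ge0.
Qed.

(** The bound is uniform over all roots [Y]: a real [a] satisfies [a <= 1 + a ^+ 2], and the square
    of a diagonal entry of the hermitian [Y] is at most the diagonal entry of [Y *m Y]. So the
    supremum dominates every candidate. *)
Lemma tracenorm_set_bounded n (X : 'M[C]_n) :
  has_ubound [set t : R | exists Y : 'M[C]_n,
     [/\ psd Y, Y *m Y = adjmx X *m X & t = complex.Re (\tr Y)]].
Proof.
exists (\sum_i (1 + complex.Re ((adjmx X *m X) i i))) => t [Y [hY YE ->]].
rewrite /mxtrace cRe_sum; apply: ler_sum => i _.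
have := Re_tr_gram Y i i.
have -> : adjmx Y = Y.
  by apply/matrixP => k l; rewrite adjmxE (psd_hermitian k l hY) conjCK.
rewrite YE; set a := complex.Re _; set b := complex.Im _ => h.
have := sqr_ge0 (a - 1); have := sqr_ge0 b; have := sqr_ge0 a; nra.
Qed.

Lemma psd_tr_le_tracenorm n (X Y : 'M[C]_n) :
  psd Y -> Y *m Y = adjmx X *m X -> complex.Re (\tr Y) <= tracenorm X.
Proof.
by move=> hY YE; apply: (ub_le_sup (tracenorm_set_bounded X)); exists Y.
Qed.

Lemma tracenorm_ge0 n (X : 'M[C]_n) : 0 <= tracenorm X.
Proof.
have [Y hY YE] := psd_sqrt (psd_gram X).
apply: le_trans (psd_tr_le_tracenorm hY YE).
rewrite /mxtrace cRe_sum sumr_ge0// => i _.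
by have := psd_diag_ge0 i hY; rewrite lecE => /andP[].
Qed.

(* A crude dimension-dependent form of [max |X i j| <= tr |X|]. *)
Lemma entry_le_tracenorm n (X : 'M[C]_n) i j :
  `|complex.Re (X i j)| <= n.+1%:R * (2 * tracenorm X) /\
  `|complex.Im (X i j)| <= n.+1%:R * (2 * tracenorm X).
Proof.
have [Y hY YE] := psd_sqrt (psd_gram X).
have hT := psd_tr_le_tracenorm hY YE.
set t := tracenorm X in hT *.
have t0 : 0 <= t := tracenorm_ge0 X.
have hb : complex.Re ((adjmx X *m X) j j) <= n%:R * (2 * t ^+ 2).
  rewrite -YE mxE cRe_sum.
  rewrite -[n in n%:R]card_ord -sum1_card natr_sum mulr_suml; apply: ler_sum => k _.
  rewrite (psd_hermitian j k hY) cReM cRe_conj cIm_conj mul1r.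
  have [h1 h2] := psd_offdiag_le j k hY.
  have /ler_normlP[h3 h4] := le_trans h1 hT.
  have /ler_normlP[h5 h6] := le_trans h2 hT.
  move: h3 h4 h5 h6; set a := complex.Re _; set b := complex.Im _; nra.
have := Re_tr_gram X i j.
set a := complex.Re (X i j); set b := complex.Im (X i j) => h.
have hn : a ^+ 2 + b ^+ 2 <= (n.+1%:R * (2 * t)) ^+ 2.
  apply: (le_trans h); apply: (le_trans hb).
  have : (0 : R) <= n%:R by [].
  rewrite -natr1; nra.
have t2 : 0 <= n.+1%:R * (2 * t) by rewrite !mulr_ge0.
by split; rewrite -[leRHS]ger0_norm// -ler_sqr ?nnegrE// !real_normK ?num_real//;
  apply: le_trans hn; rewrite ?lerDl ?lerDr sqr_ge0.
Qed.

Lemma psd_scalar_mx n (c : R) : 0 <= c -> psd (c%:C%C%:M : 'M[C]_n).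
Proof.
by move=> c0; rewrite -diag_const_mx; apply: psd_diag_mx => i; rewrite mxE ler0c.
Qed.

Lemma Re_tr_scalar_mx n (c : R) : complex.Re (\tr (c%:C%C%:M : 'M[C]_n)) = c *+ n.
Proof.
rewrite mxtrace_scalar; elim: n => [|n IH]; first by rewrite !mulr0n.
by rewrite !mulrS cReD IH.
Qed.

(** Each pair of indices contributes at least [- e (|v_i|^2 + |v_j|^2)] to the form. Over all pairs
    this adds up to [- 2 n e |v|^2], exactly what the scalar matrix compensates. *)
Lemma psd_dominated n (D : 'M[C]_n) (e : R) :
  (forall i j, D j i = (D i j)^*) ->
  (forall i j, `|complex.Re (D i j)| <= e /\ `|complex.Im (D i j)| <= e) ->
  psd (D + (n%:R * (2 * e))%:C%C%:M).
Proof.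
move=> hD he v; rewrite mulmxDr mulmxDl mxE lecE.
have hsc : (adjmx v *m (n%:R * (2 * e))%:C%C%:M *m v) 0 0 =
    \sum_i (n%:R * (2 * e) * (complex.Re (v i 0) ^+ 2 + complex.Im (v i 0) ^+ 2))%:C%C.
  rewrite -mulmxA mul_scalar_mx mxE; apply: eq_bigr => i _.
  rewrite adjmxE mxE conjCE; case: (v i 0) => a b; apply/eqP.
  by rewrite eq_complex/=; apply/andP; split; apply/eqP; ring.
rewrite hsc sesqE; set S := \sum_i \sum_j _.
(* Exchanging the summation indices conjugates each term, so the imaginary part is its own
   negative. *)
have S0 : complex.Im S = 0.
  have SE : complex.Im S = \sum_i \sum_j complex.Im ((v i 0)^* * D i j * v j 0).
    by rewrite cIm_sum; apply: eq_bigr => i _; rewrite cIm_sum.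
  have : complex.Im S = - complex.Im S.
    rewrite {1}SE exchange_big/= SE -sumrN; apply: eq_bigr => i _.
    rewrite -sumrN; apply: eq_bigr => j _; rewrite (hD i j) !cImM !cReM !cRe_conj !cIm_conj.
    by ring.
  by move=> h; lra.
rewrite cImD S0 add0r cIm_sum big1//= eqxx/= cReD [X in _ + X]cRe_sum/=.
rewrite -mulr_sumr.
set q := \sum_i (complex.Re (v i 0) ^+ 2 + complex.Im (v i 0) ^+ 2).
have SE : complex.Re S = \sum_i \sum_j complex.Re ((v i 0)^* * D i j * v j 0).
  by rewrite cRe_sum; apply: eq_bigr => i _; rewrite cRe_sum.
have hT : \sum_i \sum_j (- e * ((complex.Re (v i 0) ^+ 2 + complex.Im (v i 0) ^+ 2) +
    (complex.Re (v j 0) ^+ 2 + complex.Im (v j 0) ^+ 2))) = - (n%:R * (2 * e) * q).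
  have E i : \sum_j (- e * ((complex.Re (v i 0) ^+ 2 + complex.Im (v i 0) ^+ 2) +
    (complex.Re (v j 0) ^+ 2 + complex.Im (v j 0) ^+ 2))) =
    - e * n%:R * (complex.Re (v i 0) ^+ 2 + complex.Im (v i 0) ^+ 2) - e * q.
    rewrite -mulr_sumr big_split/= sumr_const card_ord -mulr_natr -/q; ring.
  rewrite (eq_bigr _ (fun i _ => E i)) sumrB -mulr_sumr sumr_const card_ord.
  by rewrite -mulr_natr -/q; ring.
rewrite -lerBlDr sub0r -hT SE; apply: ler_sum => i _; apply: ler_sum => j _.
have [/ler_normlP[h1 h2] /ler_normlP[h3 h4]] := he i j.
move: h1 h2 h3 h4; rewrite !(cReM, cImM, cRe_conj, cIm_conj).
set p := complex.Re (D i j); set r := complex.Im (D i j).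
set a := complex.Re (v i 0); set b := complex.Im (v i 0).
set c := complex.Re (v j 0); set d := complex.Im (v j 0) => h1 h2 h3 h4.
have -> : (a * p - - b * r) * c - (a * r + - b * p) * d =
  p * (a * c + b * d) + r * (b * c - a * d) by ring.
have k (x z w : R) : - x <= e -> x <= e -> - w <= z -> z <= w -> - (e * w) <= x * z by nra.
have := k p (a * c + b * d) ((a ^+ 2 + b ^+ 2 + (c ^+ 2 + d ^+ 2)) / 2) h1 h2.
have := k r (b * c - a * d) ((a ^+ 2 + b ^+ 2 + (c ^+ 2 + d ^+ 2)) / 2) h3 h4.
have := sqr_ge0 (a - c); have := sqr_ge0 (a + c); have := sqr_ge0 (b + d).
have := sqr_ge0 (b - d); have := sqr_ge0 (b - c); have := sqr_ge0 (b + c).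
have := sqr_ge0 (a - d); have := sqr_ge0 (a + d).
move=> g1 g2 g3 g4 g5 g6 g7 g8 f1 f2.
have {}f1 : - (e * ((a ^+ 2 + b ^+ 2 + (c ^+ 2 + d ^+ 2)) / 2)) <= r * (b * c - a * d).
  by apply: f1; nra.
have {}f2 : - (e * ((a ^+ 2 + b ^+ 2 + (c ^+ 2 + d ^+ 2)) / 2)) <= p * (a * c + b * d).
  by apply: f2; nra.
by lra.
Qed.

(** Entries are at most [e = (n + 1) 2 t] with [t] the trace norm, and the shift is [c = 2 n e]. The
    trace of [D] costs [n e], the two occurrences of the shift cost [2 n c = 4 n^2 e]. *)
Definition tracenorm_factor (n : nat) : R :=
  (n%:R * (1 + 4 * n%:R)) * (n.+1%:R * 2).

Lemma tracenorm_factor_ge0 n : 0 <= tracenorm_factor n.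
Proof. by rewrite !mulr_ge0// addr_ge0// mulr_ge0. Qed.

(* [D = (D + c I) - c I] writes a hermitian matrix as a difference of two psd
   matrices of trace controlled by its trace norm. *)
Lemma additive_le_tracenorm n (lam : 'M[C]_n -> R) (D : 'M[C]_n) :
  (forall X Y, lam (X + Y) = lam X + lam Y) ->
  (forall X, psd X -> `|lam X| <= complex.Re (\tr X)) ->
  (forall i j, D j i = (D i j)^*) ->
  `|lam D| <= tracenorm_factor n * tracenorm D.
Proof.
move=> lamD lamb hD.
set e := n.+1%:R * (2 * tracenorm D).
have he i j : `|complex.Re (D i j)| <= e /\ `|complex.Im (D i j)| <= e.
  exact: entry_le_tracenorm.
have e0 : 0 <= e by rewrite !mulr_ge0// tracenorm_ge0.
have c0 : 0 <= n%:R * (2 * e) by rewrite mulr_ge0// mulr_ge0.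
have /lamb := psd_dominated hD he; have /lamb := @psd_scalar_mx n _ c0.
rewrite lamD mxtraceD cReD !Re_tr_scalar_mx.
have : complex.Re (\tr D) <= n%:R * e.
  rewrite /mxtrace cRe_sum -[n in n%:R]card_ord -sum1_card natr_sum mulr_suml.
  by apply: ler_sum => i _; rewrite mul1r; apply: le_trans (he i i).1; exact: ler_norm.
rewrite -(mulr_natr (n%:R * (2 * e)) n) /tracenorm_factor.
have -> : n%:R * (1 + 4 * n%:R) * (n.+1%:R * 2) * tracenorm D =
  n%:R * (1 + 4 * n%:R) * e by rewrite /e; ring.
move: (complex.Re _) => t ht /ler_normlP[h1 h2] /ler_normlP[h3 h4].
rewrite ler_norml; apply/andP; split; lra.
Qed.

End Matrices.

(** * Instruments iterated along words *)

Section Words.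
Variables (R : realType) (O : Type) (A : finType) (d : nat).
Variables (T : A -> O -> 'M[R[i]]_d -> 'M[R[i]]_d) (theta : O -> O).
Local Notation C := R[i].

Lemma sum_tupleS (V : nmodType) n (F : n.+1.-tuple A -> V) :
  \sum_(u : n.+1.-tuple A) F u = \sum_(a : A) \sum_(u : n.-tuple A) F [tuple of a :: u].
Proof.
rewrite pair_big/=.
rewrite (reindex (fun p : A * n.-tuple A => [tuple of p.1 :: p.2]))//=.
exists (fun t : n.+1.-tuple A => (thead t, [tuple of behead t])) => [[a u]|t] _ /=.
  by congr pair; apply: val_inj.
by case/tupleP: t => a u; apply: val_inj.
Qed.

(* The sum over words [u] of length [n] of [F u *: apply_word .. j w X u],
   computed letter by letter. *)
Fixpoint wsum (n : nat) (F : seq A -> R) (j : nat) (w : O) (X : 'M[C]_d) : 'M[C]_d :=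
  match n with
  | 0 => (F [::])%:C%C *: X
  | n'.+1 => \sum_(a : A) wsum n' (fun u => F (a :: u)) j.+1 w (T a (iter j theta w) X)
  end.

Definition wtr n F j w X : R := complex.Re (\tr (wsum n F j w X)).

Lemma mxtr_sum (I : Type) (r : seq I) (P : pred I) (X : I -> 'M[C]_d) :
  \tr (\sum_(i <- r | P i) X i) = \sum_(i <- r | P i) \tr (X i).
Proof. by apply: (big_morph mxtrace); [exact: mxtraceD|exact: mxtrace0]. Qed.

Lemma wsum_tuple n (F : seq A -> R) j w X :
  \sum_(u : n.-tuple A) (F u)%:C%C *: apply_word T theta j w X u = wsum n F j w X.
Proof.
elim: n F j X => [|n IH] F j X /=.
  rewrite (big_pred1 [tuple]) => [|u]; first by []. by rewrite [u]tuple0 /= eqxx.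
by rewrite sum_tupleS; apply: eq_bigr => a _; rewrite -IH.
Qed.

Lemma wtr_tuple n (F : seq A -> R) w X :
  \sum_(u : n.-tuple A) quenched_cyl T theta w X u * F u = wtr n F 1 w X.
Proof.
rewrite /wtr -wsum_tuple mxtr_sum cRe_sum; apply: eq_bigr => u _.
by rewrite mxtraceZ cReM /= mul0r subr0 mulrC.
Qed.

Lemma eq_wsum n F G j w X : (forall u, size u = n -> F u = G u) ->
  wsum n F j w X = wsum n G j w X.
Proof.
elim: n F G j X => [|n IH] F G j X FG /=; first by rewrite FG.
by apply: eq_bigr => a _; apply: IH => u su; rewrite FG//= su.
Qed.

Hypothesis Tlin : forall a w, is_linear_map (T a w).

Lemma TD a w X Y : T a w (X + Y) = T a w X + T a w Y.
Proof. by have := Tlin a w 1 X Y; rewrite !scale1r. Qed.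
Lemma T0 a w : T a w 0 = 0.
Proof. by have := TD a w 0 0; rewrite addr0 => /eqP; rewrite addrC -subr_eq subrr => /eqP. Qed.
Lemma TZ a w c X : T a w (c *: X) = c *: T a w X.
Proof. by have := Tlin a w c X 0; rewrite !addr0 T0 addr0. Qed.

Lemma wsumD n F j w X Y : wsum n F j w (X + Y) = wsum n F j w X + wsum n F j w Y.
Proof.
elim: n F j X Y => [|n IH] F j X Y /=; first by rewrite scalerDr.
by rewrite -big_split/=; apply: eq_bigr => a _; rewrite TD IH.
Qed.

Lemma wsumZ n F j w c X : wsum n F j w (c *: X) = c *: wsum n F j w X.
Proof.
elim: n F j X => [|n IH] F j X /=; first by rewrite !scalerA mulrC.
by rewrite scaler_sumr; apply: eq_bigr => a _; rewrite TZ IH.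
Qed.

Lemma wsum0 n F j w : wsum n F j w 0 = 0.
Proof. by rewrite -(scale0r 0) wsumZ !scale0r. Qed.

Lemma wsum_sum (I : Type) (r : seq I) (P : pred I) n F j w (X : I -> 'M[C]_d) :
  wsum n F j w (\sum_(i <- r | P i) X i) = \sum_(i <- r | P i) wsum n F j w (X i).
Proof.
by apply: (big_morph (wsum n F j w)); [exact: wsumD|exact: wsum0].
Qed.

Lemma wsum_fD n F G j w X :
  wsum n (fun u => F u + G u) j w X = wsum n F j w X + wsum n G j w X.
Proof.
elim: n F G j X => [|n IH] F G j X /=; first by rewrite rmorphD scalerDl.
by rewrite -big_split/=; apply: eq_bigr => a _; rewrite -IH.
Qed.

Lemma wsum_fZ n F j w c X :
  wsum n (fun u => c * F u) j w X = c%:C%C *: wsum n F j w X.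
Proof.
elim: n F j X => [|n IH] F j X /=; first by rewrite rmorphM scalerA.
by rewrite scaler_sumr; apply: eq_bigr => a _; rewrite -IH.
Qed.

(** The future sees the past only through the unnormalized state that the first [k] letters leave
    behind. This is the Markov property behind every splitting into past and future below. *)
Lemma wsum_cat k l F G j w X :
  wsum (k + l) (fun u => F (take k u) * G (drop k u)) j w X =
  wsum l G (j + k) w (wsum k F j w X).
Proof.
elim: k F j X => [|k IH] F j X.
  rewrite add0n addn0 /= wsumZ -wsum_fZ.
  by apply: eq_wsum => u _; rewrite take0 drop0.
rewrite addSn /= wsum_sum; apply: eq_bigr => a _.
by rewrite (IH (fun s => F (a :: s))) addSnnS.
Qed.

Lemma wsum_shift n F i j w X :
  wsum n F (i + j) w X = wsum n F i (iter j theta w) X.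
Proof.
elim: n F i X => [//|n IH] F i X /=.
by apply: eq_bigr => a _; rewrite -addSn IH iterD.
Qed.

Lemma wsum1 n j w X :
  wsum n.+1 (fun=> 1) j w X = Phi T theta (j + n) w (wsum n (fun=> 1) j w X).
Proof.
have -> : wsum n.+1 (fun=> 1) j w X = wsum (n + 1) (fun u => 1 * 1) j w X.
  by rewrite addn1; apply: eq_wsum => u _; rewrite mul1r.
rewrite (wsum_cat n 1 (fun=> 1) (fun=> 1)) /=.
by apply: eq_bigr => a _; rewrite scale1r.
Qed.

Lemma wsum_Phin n w X : wsum n (fun=> 1) 1 w X = Phin T theta n w X.
Proof.
by elim: n => [|n IH]; [rewrite /= scale1r|rewrite wsum1 IH add1n].
Qed.

Lemma wtrD n F j w X Y : wtr n F j w (X + Y) = wtr n F j w X + wtr n F j w Y.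
Proof. by rewrite /wtr wsumD mxtraceD cReD. Qed.

Lemma wtrZ n F j w (c : R) X : wtr n F j w (c%:C%C *: X) = c * wtr n F j w X.
Proof. by rewrite /wtr wsumZ mxtraceZ cReM /= mul0r subr0. Qed.

Lemma wtr_fD n F G j w X :
  wtr n (fun u => F u + G u) j w X = wtr n F j w X + wtr n G j w X.
Proof. by rewrite /wtr wsum_fD mxtraceD cReD. Qed.

Lemma wtr_fZ n F j w c X : wtr n (fun u => c * F u) j w X = c * wtr n F j w X.
Proof. by rewrite /wtr wsum_fZ mxtraceZ cReM /= mul0r subr0. Qed.

Lemma wtr_shift n F i j w X :
  wtr n F (i + j) w X = wtr n F i (iter j theta w) X.
Proof. by rewrite /wtr wsum_shift. Qed.

Lemma wtr_cat k l F G j w X :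
  wtr (k + l) (fun u => F (take k u) * G (drop k u)) j w X =
  wtr l G (j + k) w (wsum k F j w X).
Proof. by rewrite /wtr wsum_cat. Qed.

Lemma eq_wtr n F G j w X : (forall u, size u = n -> F u = G u) ->
  wtr n F j w X = wtr n G j w X.
Proof. by move=> FG; rewrite /wtr (eq_wsum _ _ _ FG). Qed.

Hypothesis Tcp : forall a w, completely_positive (T a w).

(** Positivity is complete positivity with a single block. *)
Lemma T_psd a w X : psd X -> psd (T a w X).
Proof.
move=> hX v; have := @Tcp a w 1%N (fun _ _ => X).
move=> /(_ _ (fun _ => v)); rewrite !big_ord1; apply => v'.
by rewrite !big_ord1.
Qed.

Lemma wsum_psd n F j w X : (forall u, size u = n -> 0 <= F u) -> psd X ->
  psd (wsum n F j w X).
Proof.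
elim: n F j X => [|n IH] F j X F0 hX /=.
  by apply: psdZ => //; rewrite ler0c F0.
apply: psd_sum => a; apply: IH; last exact: T_psd.
by move=> u su; rewrite F0//= su.
Qed.

Lemma Re_tr_psd n (X : 'M[C]_n) : psd X -> 0 <= complex.Re (\tr X).
Proof.
move=> hX; rewrite /mxtrace cRe_sum sumr_ge0// => i _.
by have := psd_diag_ge0 i hX; rewrite lecE => /andP[].
Qed.

Lemma wtr_ge0 n F j w X : (forall u, size u = n -> 0 <= F u) -> psd X ->
  0 <= wtr n F j w X.
Proof. by move=> F0 hX; apply/Re_tr_psd/wsum_psd. Qed.

(** Trace preservation is given almost surely at one time; invariance and a countable intersection
    give it along the whole orbit. On such orbits the quenched weights of words starting from a
    density matrix sum to one. *)
Definition good_orbit w :=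
  forall k, trace_preserving (fun X => \sum_(a : A) T a (iter k theta w) X).

Lemma good_orbit_iter k w : good_orbit w -> good_orbit (iter k theta w).
Proof. by move=> h l X; rewrite -iterD h. Qed.

Lemma wsum1_tr n j w X : good_orbit w -> \tr (wsum n (fun=> 1) j w X) = \tr X.
Proof.
move=> hw; elim: n j X => [|n IH] j X /=; first by rewrite scale1r.
by rewrite mxtr_sum (eq_bigr _ (fun a _ => IH _ _)) -mxtr_sum (hw j).
Qed.

Lemma wtr_cst n c j w X : good_orbit w -> wtr n (fun=> c) j w X = c * complex.Re (\tr X).
Proof.
move=> hw; rewrite -(wsum1_tr n j X hw) -/(wtr n (fun=> 1) j w X) -wtr_fZ /wtr.
by congr (complex.Re (\tr _)); apply: eq_wsum => u _; rewrite mulr1.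
Qed.

Lemma wtr_le n F G j w X : (forall u, size u = n -> F u <= G u) -> psd X ->
  wtr n F j w X <= wtr n G j w X.
Proof.
move=> FG hX; rewrite -subr_ge0.
have -> : wtr n G j w X - wtr n F j w X = wtr n (fun u => G u + (-1) * F u) j w X.
  by rewrite wtr_fD wtr_fZ mulN1r.
by apply: wtr_ge0 => // u su; rewrite mulN1r subr_ge0 FG.
Qed.

Lemma wtr_bound n F j w X : (forall u, size u = n -> `|F u| <= 1) ->
  good_orbit w -> psd X -> `|wtr n F j w X| <= complex.Re (\tr X).
Proof.
move=> F1 hw hX; rewrite ler_norml; apply/andP; split.
  rewrite -mulN1r -(wtr_cst n (-1) j X hw); apply: wtr_le => // u su.
  by have := F1 u su; rewrite ler_norml => /andP[].
rewrite -[leRHS]mul1r -(wtr_cst n 1 j X hw); apply: wtr_le => // u su.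
by have := F1 u su; rewrite ler_norml => /andP[].
Qed.

Lemma density_tr (X : 'M[C]_d) : density X -> complex.Re (\tr X) = 1.
Proof. by move=> [_ ->]. Qed.

Lemma wtr_diff_le n F j w X Y : (forall u, size u = n -> `|F u| <= 1) ->
  good_orbit w -> psd X -> psd Y ->
  `|wtr n F j w X - wtr n F j w Y| <= tracenorm_factor R d * tracenorm (X - Y).
Proof.
move=> F1 hw hX hY.
have -> : wtr n F j w X - wtr n F j w Y = wtr n F j w (X - Y).
  have := wtrD n F j w (X - Y) Y; rewrite subrK => ->; by rewrite addrK.
apply: additive_le_tracenorm => [X' Y'|X' hX'|k l]; first exact: wtrD.
  exact: wtr_bound.
by rewrite !mxE (psd_hermitian k l hX) (psd_hermitian k l hY) rmorphB.
Qed.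

Lemma Phin_psd n w X : psd X -> psd (Phin T theta n w X).
Proof. by move=> hX; rewrite -wsum_Phin; apply: wsum_psd. Qed.

End Words.

(** * Integrals of essentially bounded functions *)

Section BoundedExpectation.
Variables (dO : measure_display) (O : measurableType dO) (R : realType).
Variable P : probability O R.
Local Notation Ex f := (\int[P]_w (f w))%R.

Lemma prob_setT : (P : {measure set O -> \bar R}) setT = 1%E.
Proof. exact: probability_setT. Qed.

(** The bound is only almost sure because quenched expectations are controlled only where the
    instruments along the orbit preserve the trace. *)
Definition ess_bdd (f : O -> R) :=
  measurable_fun setT f /\ exists M, \forall w \ae P, `|f w| <= M.

Lemma ess_bdd_integrable f : ess_bdd f -> P.-integrable setT (EFin \o f).
Proof.
move=> [mf [M hM]]; apply/integrableP; split; first exact/measurable_EFinP.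
have M0 : 0 <= `|M| by [].
apply: (@le_lt_trans _ _ (\int[P]_x (`|M|%:E))%E); last first.
  by rewrite integral_cst// prob_setT mule1 ltry.
apply: ae_ge0_le_integral => //.
- by apply: measurableT_comp => //; exact/measurable_EFinP.
- by apply: filterS hM => w hw _ /=; rewrite lee_fin (le_trans hw)// ler_norm.
Qed.

Lemma ess_bdd_cst c : ess_bdd (fun=> c).
Proof. by split => //; exists `|c|; apply: aeW. Qed.

Lemma ess_bddD f g : ess_bdd f -> ess_bdd g -> ess_bdd (fun w => f w + g w).
Proof.
move=> [mf [M hM]] [mg [N hN]]; split; first exact: measurable_funD.
exists (M + N); apply: filterS2 hM hN => w h1 h2.
by rewrite (le_trans (ler_normD _ _))// lerD.
Qed.

Lemma ess_bddM f g : ess_bdd f -> ess_bdd g -> ess_bdd (fun w => f w * g w).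
Proof.
move=> [mf [M hM]] [mg [N hN]]; split; first exact: measurable_funM.
exists (M * N); apply: filterS2 hM hN => w h1 h2.
by rewrite normrM ler_pM.
Qed.

Lemma ess_bddZ c f : ess_bdd f -> ess_bdd (fun w => c * f w).
Proof. by apply: ess_bddM; exact: ess_bdd_cst. Qed.

Lemma ess_bddB f g : ess_bdd f -> ess_bdd g -> ess_bdd (fun w => f w - g w).
Proof.
move=> hf hg; have := ess_bddD hf (ess_bddZ (-1) hg).
by congr ess_bdd; apply/funext => w; rewrite mulN1r.
Qed.

Lemma ess_bdd_norm f : ess_bdd f -> ess_bdd (fun w => `|f w|).
Proof.
move=> [mf [M hM]]; split; first exact: measurableT_comp.
by exists M; apply: filterS hM => w; rewrite normr_id.
Qed.

Lemma ess_bdd_sum (I : Type) (r : seq I) (f : I -> O -> R) :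
  (forall i, ess_bdd (f i)) -> ess_bdd (fun w => \sum_(i <- r) f i w).
Proof.
move=> hf; elim: r => [|i r IH].
  by under eq_fun do rewrite big_nil; exact: ess_bdd_cst.
by under eq_fun do rewrite big_cons; exact: ess_bddD.
Qed.

Lemma ExpD f g : ess_bdd f -> ess_bdd g -> Ex (fun w => f w + g w) = Ex f + Ex g.
Proof. by move=> hf hg; rewrite RintegralD//; exact: ess_bdd_integrable. Qed.

Lemma ExpB f g : ess_bdd f -> ess_bdd g -> Ex (fun w => f w - g w) = Ex f - Ex g.
Proof. by move=> hf hg; rewrite RintegralB//; exact: ess_bdd_integrable. Qed.

Lemma ExpZ c f : ess_bdd f -> Ex (fun w => c * f w) = c * Ex f.
Proof. by move=> hf; rewrite RintegralZl//; exact: ess_bdd_integrable. Qed.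

Lemma Exp_cst c : Ex (fun=> c) = c.
Proof. by rewrite Rintegral_cst// prob_setT/= mulr1. Qed.

Lemma Exp_sum (I : Type) (r : seq I) (f : I -> O -> R) :
  (forall i, ess_bdd (f i)) ->
  Ex (fun w => \sum_(i <- r) f i w) = \sum_(i <- r) Ex (f i).
Proof.
move=> hf; elim: r => [|i r IH].
  by rewrite big_nil; under eq_Rintegral do rewrite big_nil; rewrite Exp_cst.
rewrite big_cons; under eq_Rintegral do rewrite big_cons.
by rewrite ExpD// ?IH//; exact: ess_bdd_sum.
Qed.

Lemma eq_Exp_ae f g : ess_bdd f -> ess_bdd g ->
  (\forall w \ae P, f w = g w) -> Ex f = Ex g.
Proof.
move=> [mf _] [mg _] fg; congr fine; apply: ae_eq_integral => //.
- exact/measurable_EFinP.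
- exact/measurable_EFinP.
- by apply: filterS fg => w -> _.
Qed.

Lemma le_Exp_ae f g : ess_bdd f -> ess_bdd g ->
  (\forall w \ae P, f w <= g w) -> Ex f <= Ex g.
Proof.
move=> hf hg fg; rewrite -subr_ge0 -ExpB//.
have hb := ess_bddB hg hf.
have -> : Ex (fun w => g w - f w) = Ex (fun w => `|g w - f w|).
  apply: eq_Exp_ae => //; first exact: ess_bdd_norm.
  by apply: filterS fg => w h; rewrite ger0_norm// subr_ge0.
by apply: Rintegral_ge0.
Qed.

Lemma ler_norm_Exp f : ess_bdd f -> `|Ex f| <= Ex (fun w => `|f w|).
Proof. by move=> hf; apply: le_normr_Rintegral => //; exact: ess_bdd_integrable. Qed.

Lemma Exp_bound f c : ess_bdd f -> (\forall w \ae P, `|f w| <= c) -> `|Ex f| <= c.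
Proof.
move=> hf hc; apply: (le_trans (ler_norm_Exp hf)); rewrite -[leRHS](Exp_cst c).
by apply: le_Exp_ae => //; [exact: ess_bdd_norm|exact: ess_bdd_cst].
Qed.

Lemma Exp_dist_le f g h c : ess_bdd f -> ess_bdd g -> ess_bdd h ->
  (\forall w \ae P, `|f w - g w| <= h w) -> Ex h <= c -> `|Ex f - Ex g| <= c.
Proof.
move=> hf hg hh fgh; apply: le_trans; rewrite -ExpB//.
have hb := ess_bddB hf hg.
apply: (le_trans (ler_norm_Exp hb)); apply: le_Exp_ae => //.
exact: ess_bdd_norm.
Qed.

(* The dominating function [f] need not be measurable. *)
Lemma Exp_le_integral (g f : O -> R) (c : R) : ess_bdd g ->
  (forall w, 0 <= f w) -> (\forall w \ae P, g w <= f w) ->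
  (\int[P]_w (f w)%:E <= c%:E)%E -> Ex g <= c.
Proof.
move=> hg f0 [N [mN PN0 sN]] fc.
have mNC : measurable (~` N) by exact: measurableC.
(* The positive part of [g], cut off on the exceptional null set, lies below [f] everywhere and not
   just almost everywhere. *)
pose h w := Num.max (g w) 0 * \1_(~` N) w.
have hh : ess_bdd h.
  have [mg [M hM]] := hg; split.
    apply: measurable_funM; last exact: measurable_indic.
    by apply: measurable_maxr.
  exists `|M|; apply: filterS hM => w hw; rewrite /h normrM.
  rewrite -[leRHS]mulr1 ler_pM//; last first.
    by rewrite indicE; case: (_ \in _); rewrite ?normr1 ?normr0.
  rewrite /Num.max; case: ifP => _; first by rewrite normr0.
  by rewrite (le_trans hw)// ler_norm.
have le_gh : Ex g <= Ex h.
  apply: le_Exp_ae => //; exists N; split => // w /= hw.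
  apply: contrapT => Nw; apply: hw; rewrite /h indicE mem_set// mulr1.
  by rewrite le_max lexx.
apply: (le_trans le_gh).
have h0 w : 0 <= h w.
  by rewrite /h mulr_ge0// ?le_max ?lexx ?orbT// indicE.
have hf w : h w <= f w.
  rewrite /h indicE; have [wN|wN] := boolP (w \in ~` N); last by rewrite mulr0.
  rewrite mulr1 ge_max f0 andbT; apply: contrapT => ngf.
  by have := set_mem wN; apply; apply: sN.
rewrite -lee_fin; apply: le_trans fc.
rewrite fineK; last exact/integrable_fin_num/ess_bdd_integrable.
(* The integral of a nonnegative function is a supremum over simple functions below it, so the
   pointwise order alone gives monotonicity. *)
rewrite !ge0_integralE//; [|by move=> x _; rewrite lee_fin|by move=> x _; rewrite lee_fin].
apply: le_ereal_sup => _ [k hk <-]; exists k => // x.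
apply: (le_trans (hk x)); rewrite !patch_setT lee_fin; exact: hf.
Qed.

Variable theta : O -> O.
Hypotheses (mth : measurable_fun setT theta) (pth : measure_preserving P theta).

Lemma measurable_iter k : measurable_fun setT (iter k theta).
Proof.
elim: k => [|k IH]; first exact: measurable_id.
exact: (measurableT_comp mth IH).
Qed.

Lemma preserving_iter k (B : set O) : measurable B -> P (iter k theta @^-1` B) = P B.
Proof.
elim: k B => [//|k IH] B mB.
have mtB : measurable (theta @^-1` B) by have := mth measurableT mB; rewrite setTI.
by rewrite -[RHS](pth mB) -[RHS]IH.
Qed.

Lemma ae_iter k (Q : O -> Prop) :
  (\forall w \ae P, Q w) -> \forall w \ae P, Q (iter k theta w).
Proof.
move=> [N [mN PN sN]]; exists (iter k theta @^-1` N); split.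
- by have := measurable_iter k measurableT mN; rewrite setTI.
- by rewrite preserving_iter.
- by move=> w hw; apply: sN.
Qed.

Lemma ess_bdd_iter k f : ess_bdd f -> ess_bdd (fun w => f (iter k theta w)).
Proof.
move=> [mf [M hM]]; split; first exact: (measurableT_comp mf (measurable_iter k)).
by exists M; exact: (ae_iter k hM).
Qed.

Lemma Exp_iter k f : ess_bdd f -> Ex (fun w => f (iter k theta w)) = Ex f.
Proof.
move=> hf; have [mf _] := hf; congr fine.
have := @integral_pushforward _ _ _ _ R (iter k theta) (measurable_iter k) P setT (EFin \o f).
rewrite preimage_setT => <- //; first last.
- exact/ess_bdd_integrable/ess_bdd_iter.
- exact/measurable_EFinP.
apply: eq_measure_integral => [|mi B mB _]; [exact: measurable_iter|exact: preserving_iter].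
Qed.

End BoundedExpectation.

(** * Covariance under strong mixing *)

Section LayerCake.
Variables (dO : measure_display) (O : measurableType dO) (R : realType).
Variable P : probability O R.
Local Notation Ex f := (\int[P]_w (f w))%R.

(** The sum counts the naturals below [y], so it is the ceiling of [y]. *)
Lemma sum_lt_nat_approx N (y : R) : 0 <= y -> y <= N%:R ->
  y <= \sum_(i < N) (i%:R < y)%R%:R <= y + 1.
Proof.
elim: N => [|N IH] y0 yN.
  by rewrite big_ord0; lra.
rewrite big_ord_recr/=; have [Ny|yN'] := ltP N%:R y.
  rewrite (eq_bigr (fun=> 1)) => [|i _].
    by rewrite sumr_const card_ord natr1 -natr1 in yN *; lra.
  suff -> : (i%:R < y) by [].
  by apply: le_lt_trans Ny; rewrite ler_nat ltnW.
by rewrite addr0; exact: IH.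
Qed.

Lemma step_approx N (x : R) : 0 <= x <= 1 ->
  `|x - N.+1%:R^-1 * \sum_(i < N.+1) (i%:R / N.+1%:R < x)%R%:R| <= N.+1%:R^-1.
Proof.
move=> /andP[x0 x1]; have N0 : 0 < N.+1%:R :> R by [].
have E : \sum_(i < N.+1) (i%:R / N.+1%:R < x)%R%:R =
   \sum_(i < N.+1) (i%:R < N.+1%:R * x)%R%:R :> R.
  by apply: eq_bigr => i _; rewrite ltr_pdivrMr// [x * _]mulrC.
rewrite E; have /andP[] : N.+1%:R * x <= \sum_(i < N.+1) (i%:R < N.+1%:R * x)%R%:R <= N.+1%:R * x + 1.
  apply: sum_lt_nat_approx; first by rewrite mulr_ge0.
  by rewrite ger_pMr.
set S := \sum_(i < _) _ => h1 h2.
rewrite distrC ger0_norm.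
  rewrite lerBlDr -ler_pdivlMl ?invr_gt0// invrK mulrDr mulfV ?gt_eqF//; lra.
by rewrite subr_ge0 -ler_pdivrMl ?invr_gt0// invrK.
Qed.

Lemma cov_dist_le (u h : O -> R) c : ess_bdd P u -> ess_bdd P h ->
  (\forall w \ae P, `|u w| <= c) -> (\forall w \ae P, `|h w| <= 1) ->
  `|Ex (fun w => u w * h w) - Ex u * Ex h| <= 2 * c.
Proof.
move=> hu hh uc h1.
have a1 : `|Ex (fun w => u w * h w)| <= c.
  apply: Exp_bound; first exact: ess_bddM.
  by apply: filterS2 uc h1 => w a b; rewrite normrM -[c]mulr1 ler_pM.
have a2 : `|Ex u * Ex h| <= c.
  by rewrite normrM -[c]mulr1 ler_pM//; apply: Exp_bound.
by rewrite (le_trans (ler_normB _ _))// mulrDl mul1r lerD.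
Qed.

(** The average of the indicators of equally spaced superlevel sets approximates [f] uniformly.
    Covariance is linear in [f], so an average of quantities bounded by [a] stays bounded by [a]. *)
Lemma layer_cake_cov (f h : O -> R) a : measurable_fun setT f ->
  (forall w, 0 <= f w <= 1) -> ess_bdd P h -> (\forall w \ae P, `|h w| <= 1) ->
  (forall t, `|Ex (fun w => (t < f w)%R%:R * h w) -
               Ex (fun w => (t < f w)%R%:R) * Ex h| <= a) ->
  `|Ex (fun w => f w * h w) - Ex f * Ex h| <= a.
Proof.
move=> mf f01 hh h1 ha.
have bi t : ess_bdd P (fun w => (t < f w)%R%:R).
  split.
    have -> : (fun w => (t < f w)%R%:R) = \1_(f @^-1` `]t, +oo[) :> (O -> R).
      apply/funext => w; rewrite indicE; congr (_%:R); congr nat_of_bool.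
      by apply/idP/idP; rewrite inE/= in_itv/= andbT.
    apply: measurable_indic; rewrite -[_ @^-1` _]setTI.
    by apply: mf => //; exact: measurable_itv.
  by exists 1; apply: aeW => w; case: (_ < _); rewrite ?normr1 ?normr0.
have bf : ess_bdd P f.
  by split => //; exists 1; apply: aeW => w; have /andP[? ?] := f01 w; rewrite ger0_norm.
apply/ler_addgt0Pr => e e0.
(* An approximation error [1 / (N + 1)] moves the covariance by at most twice that, by
   [cov_dist_le]. *)
pose N := Num.trunc (2 / e).
have Ne : 2 * N.+1%:R^-1 <= e.
  rewrite ler_pdivrMr// mulrC -ler_pdivrMr//; apply/ltW.
  exact: truncnS_gt.
pose fN w := N.+1%:R^-1 * \sum_(i < N.+1) (i%:R / N.+1%:R < f w)%R%:R : R.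
have bfN : ess_bdd P fN by apply: ess_bddZ; apply: ess_bdd_sum.
have bd : ess_bdd P (fun w => f w - fN w) by exact: ess_bddB.
have d1 : `|Ex (fun w => (f w - fN w) * h w) - Ex (fun w => f w - fN w) * Ex h| <= e.
  apply: le_trans Ne; apply: cov_dist_le => //.
  by apply: aeW => w; exact: step_approx.
have d2 : `|Ex (fun w => fN w * h w) - Ex fN * Ex h| <= a.
  have -> : Ex (fun w => fN w * h w) - Ex fN * Ex h = N.+1%:R^-1 *
     \sum_(i < N.+1) (Ex (fun w => (i%:R / N.+1%:R < f w)%R%:R * h w) -
               Ex (fun w => (i%:R / N.+1%:R < f w)%R%:R) * Ex h).
    rewrite sumrB mulrBr; congr (_ - _).
      rewrite -Exp_sum; last by move=> i; exact: ess_bddM.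
      rewrite -ExpZ; last by apply: ess_bdd_sum => i; exact: ess_bddM.
      by apply: eq_Rintegral => w _; rewrite /fN -mulrA mulr_suml.
    rewrite /fN ExpZ; last by apply: ess_bdd_sum.
    by rewrite Exp_sum// -mulrA mulr_suml.
  rewrite normrM ger0_norm ?invr_ge0// mulrC ler_pdivrMr// mulr_natr.
  apply: (le_trans (ler_norm_sum _ _ _)).
  rewrite -[N.+1 in leRHS]card_ord -sumr_const; exact: ler_sum.
have -> : Ex (fun w => f w * h w) - Ex f * Ex h =
   (Ex (fun w => fN w * h w) - Ex fN * Ex h) +
   (Ex (fun w => (f w - fN w) * h w) - Ex (fun w => f w - fN w) * Ex h).
  have -> : Ex (fun w => (f w - fN w) * h w) = Ex (fun w => f w * h w) - Ex (fun w => fN w * h w).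
    rewrite -ExpB; [|exact: ess_bddM|exact: ess_bddM].
    by apply: eq_Rintegral => w _; rewrite mulrBl.
  by rewrite ExpB//; ring.
by rewrite (le_trans (ler_normD _ _))// lerD.
Qed.

(** The layer cake is applied in one variable after the other, which leaves covariances of
    indicators of superlevel sets. The range [[0, 1]] is what keeps the constant at [a]. *)
Lemma alpha_mixing_cov (f g : O -> R) a :
  measurable_fun setT f -> measurable_fun setT g ->
  (forall w, 0 <= f w <= 1) -> (forall w, 0 <= g w <= 1) ->
  (forall s t, (`|P ((f @^-1` `]s, +oo[) `&` (g @^-1` `]t, +oo[)) -
       P (f @^-1` `]s, +oo[) * P (g @^-1` `]t, +oo[)| <= a%:E)%E) ->
  `|Ex (fun w => f w * g w) - Ex f * Ex g| <= a.
Proof.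
move=> mf mg f01 g01 ha.
have meas (u : O -> R) t : measurable_fun setT u -> measurable (u @^-1` `]t, +oo[).
  by move=> mu; rewrite -[_ @^-1` _]setTI; apply: mu => //; exact: measurable_itv.
have indE (u : O -> R) t : (fun w => (t < u w)%R%:R) = \1_(u @^-1` `]t, +oo[) :> (O -> R).
  apply/funext => w; rewrite indicE; congr (_%:R); congr nat_of_bool.
  by apply/idP/idP; rewrite inE/= in_itv/= andbT.
have exI (E : set O) : measurable E -> Ex (\1_E) = fine (P E).
  by move=> mE; rewrite /Rintegral integral_indic// setIT.
have b01 (u : O -> R) : measurable_fun setT u -> (forall w, 0 <= u w <= 1) -> ess_bdd P u.
  by move=> mu u01; split => //; exists 1; apply: aeW => w; have /andP[? ?] := u01 w; rewrite ger0_norm.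
have bi (u : O -> R) (t : R) : measurable_fun setT u -> ess_bdd P (fun w => (t < u w)%R%:R).
  move=> mu; apply: b01; first by rewrite indE; apply: measurable_indic; exact: meas.
  by move=> w; case: (_ < _); rewrite /= ?lexx ?ler01.
apply: layer_cake_cov => //; first exact: b01.
  by apply: aeW => w; have /andP[? ?] := g01 w; rewrite ger0_norm.
move=> s.
have -> : Ex (fun w => (s < f w)%R%:R * g w) - Ex (fun w => (s < f w)%R%:R) * Ex g =
  Ex (fun w => g w * (s < f w)%R%:R) - Ex g * Ex (fun w => (s < f w)%R%:R).
  by rewrite [X in _ - X]mulrC; congr (_ - _); apply: eq_Rintegral => w _; rewrite mulrC.
apply: layer_cake_cov => //; first exact: bi.
  by apply: aeW => w; case: (_ < _); rewrite ?normr1 ?normr0.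
move=> t.
have -> : (fun w => (t < g w)%R%:R * (s < f w)%R%:R) =
   \1_((f @^-1` `]s, +oo[) `&` (g @^-1` `]t, +oo[)) :> (O -> R).
  by rewrite setIC indicI -!indE.
rewrite !indE !exI; [|by apply: meas|by apply: meas|by apply: measurableI; apply: meas].
rewrite -lee_fin; apply: le_trans (ha s t).
have fp (E : set O) : measurable E -> (fine (P E))%:E = P E.
  by move=> mE; rewrite fineK// fin_num_measure.
rewrite -abse_EFin EFinB EFinM !fp; [|exact: meas|exact: meas|by apply: measurableI; apply: meas].
by rewrite (muleC (P (g @^-1` _))).
Qed.

End LayerCake.

(** * Mixing of the annealed law *)

Section ComplexMeasurability.
Variables (dO : measure_display) (O : measurableType dO) (R : realType).
Local Notation C := R[i].

Lemma cmeas_cst (z : C) : cmeasurable (fun _ : O => z).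
Proof. by split; exact: measurable_cst. Qed.

Lemma cmeasD (f g : O -> C) :
  cmeasurable f -> cmeasurable g -> cmeasurable (fun w => f w + g w).
Proof.
move=> [f1 f2] [g1 g2]; split.
  by under eq_fun do rewrite cReD; exact: measurable_funD.
by under eq_fun do rewrite cImD; exact: measurable_funD.
Qed.

Lemma cmeasM (f g : O -> C) :
  cmeasurable f -> cmeasurable g -> cmeasurable (fun w => f w * g w).
Proof.
move=> [f1 f2] [g1 g2]; split.
  under eq_fun do rewrite cReM.
  by apply: measurable_funB; exact: measurable_funM.
under eq_fun do rewrite cImM.
by apply: measurable_funD; exact: measurable_funM.
Qed.

Lemma cmeas_sum (I : Type) (r : seq I) (f : I -> O -> C) :
  (forall i, cmeasurable (f i)) -> cmeasurable (fun w => \sum_(i <- r) f i w).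
Proof.
move=> hf; elim: r => [|i r IH].
  by under eq_fun do rewrite big_nil; exact: cmeas_cst.
by under eq_fun do rewrite big_cons; exact: cmeasD.
Qed.

Lemma cmeas_real (f : O -> R) : measurable_fun setT f -> cmeasurable (fun w => (f w)%:C%C).
Proof. by move=> mf; split => //=; exact: measurable_cst. Qed.

Variable d : nat.

Definition mxmeas (X : O -> 'M[C]_d) := forall i j, cmeasurable (fun w => X w i j).

(** Instruments are measurable for a fixed argument only; a random argument is expanded in matrix
    units, with measurable coefficients. *)
Lemma linear_mxmeas (L : O -> 'M[C]_d -> 'M[C]_d) (X : O -> 'M[C]_d) :
  (forall w, is_linear_map (L w)) ->
  (forall Y, mxmeas (fun w => L w Y)) -> mxmeas X -> mxmeas (fun w => L w (X w)).
Proof.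
move=> Ll Lm Xm i j.
have LE w : L w (X w) = \sum_k \sum_l X w k l *: L w (delta_mx k l).
  have L0 : L w 0 = 0.
    have := Ll w 1 0 0; rewrite !scale1r addr0 => /eqP.
    by rewrite addrC -subr_eq subrr => /eqP.
  have LD Y Z : L w (Y + Z) = L w Y + L w Z by have := Ll w 1 Y Z; rewrite !scale1r.
  have LZ c Y : L w (c *: Y) = c *: L w Y by have := Ll w c Y 0; rewrite L0 !addr0.
  have Ls (I : Type) (r : seq I) (Y : I -> 'M[C]_d) :
     L w (\sum_(i <- r) Y i) = \sum_(i <- r) L w (Y i) by apply: (big_morph (L w)).
  rewrite [in LHS](matrix_sum_delta (X w)) Ls; apply: eq_bigr => k _.
  by rewrite Ls; apply: eq_bigr => l _; rewrite LZ.
under eq_fun => w.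
  rewrite LE summxE; under eq_bigr => k _.
    rewrite summxE; under eq_bigr => l _ do rewrite mxE.
  over.
over.
apply: cmeas_sum => k; apply: cmeas_sum => l; apply: cmeasM; first exact: Xm.
exact: Lm.
Qed.

Variables (A : finType) (T : A -> O -> 'M[C]_d -> 'M[C]_d) (theta : O -> O).
Hypothesis Tlin : forall a w, is_linear_map (T a w).

(** Measurability is asked only at the times actually visited, so the lemma also applies to a
    sigma-algebra generated by the instruments in a time window. *)
Lemma wsum_mxmeas n F j (X : O -> 'M[C]_d) :
  (forall a k Y, (j <= k < j + n)%N -> mxmeas (fun w => T a (iter k theta w) Y)) ->
  mxmeas X -> mxmeas (fun w => wsum T theta n F j w (X w)).
Proof.
elim: n F j X => [|n IH] F j X hT hX /=.
  move=> i l; under eq_fun do rewrite mxE.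
  by apply: cmeasM => //; exact: cmeas_cst.
move=> i l; under eq_fun do rewrite summxE; apply: cmeas_sum => a.
apply: IH => [b k Y /andP[h1 h2]|].
  by apply: hT; rewrite (ltnW h1) /=; rewrite addSnnS in h2.
apply: (@linear_mxmeas (fun w => T a (iter j theta w))) => //.
by move=> Y; apply: hT; rewrite leqnn /= addnS ltnS leq_addr.
Qed.

Lemma wtr_meas n F j (X : O -> 'M[C]_d) :
  (forall a k Y, (j <= k < j + n)%N -> mxmeas (fun w => T a (iter k theta w) Y)) ->
  mxmeas X -> measurable_fun setT (fun w => wtr T theta n F j w (X w)).
Proof.
move=> hT hX; rewrite /wtr /mxtrace.
have h : cmeasurable (fun w => \sum_i wsum T theta n F j w (X w) i i).
  by apply: cmeas_sum => i; apply: wsum_mxmeas.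
by case: h.
Qed.

Lemma mxmeas_comp (X : O -> 'M[C]_d) (f : O -> O) :
  measurable_fun setT f -> mxmeas X -> mxmeas (fun w => X (f w)).
Proof.
move=> mf hX i j; have [h1 h2] := hX i j; split.
  exact: (measurableT_comp h1 mf).
exact: (measurableT_comp h2 mf).
Qed.

End ComplexMeasurability.

(** * Stationarity of the outcomes, forgetting of the state, decoupling of past and future *)

Section Mixing.
Variables (R : realType) (dO : measure_display) (O : measurableType dO).
Variables (P : probability O R) (A : finType) (d : nat).
Variables (T : A -> O -> 'M[R[i]]_d -> 'M[R[i]]_d) (theta thetainv : O -> O).
Variables (s : O -> 'M[R[i]]_d) (r : nat -> R).
Hypothesis hT : random_instrument P T.
Hypotheses (mth : measurable_fun setT theta) (mthi : measurable_fun setT thetainv).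
Hypotheses (thK : cancel theta thetainv) (pth : measure_preserving P theta).
Hypotheses (hs : random_state s) (ds : dyn_stationary P T theta s).
Hypothesis hr : forall vt : O -> 'M[R[i]]_d, random_state vt ->
  forall n : nat, (0 < n)%N ->
    (\int[P]_w (tracenorm (Phin T theta n w (vt w) - s (iter n theta w)))%:E
          <= (r n)%:E)%E.

Local Notation Ex f := (\int[P]_w (f w))%R.
Local Notation wtr := (wtr T theta).
Local Notation wsum := (wsum T theta).

Let Tlin : forall a w, is_linear_map (T a w). Proof. by case: hT. Qed.
Let Tcp : forall a w, completely_positive (T a w). Proof. by case: hT. Qed.

Lemma T_mxmeas a k Y : mxmeas (fun w => T a (iter k theta w) Y).
Proof.
apply: (@mxmeas_comp _ _ _ _ (fun w => T a w Y)); first exact: measurable_iter.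
by case: hT => _ _ _ h _ i j; exact: h.
Qed.

Lemma ae_good_orbit : \forall w \ae P, good_orbit T theta w.
Proof.
have [_ _ _ _ h] := hT.
by apply: ae_foralln => k; apply: (ae_iter mth pth k h).
Qed.

Lemma s_psd w : psd (s w). Proof. by case: hs => /(_ w)[]. Qed.
Lemma s_tr w : complex.Re (\tr (s w)) = 1.
Proof. by apply: density_tr; case: hs. Qed.
Lemma s_meas : mxmeas s. Proof. by case: hs. Qed.

Lemma wtr_bound_ae n (F : seq A -> R) (c : R) j (X : O -> 'M[R[i]]_d) :
  0 < c -> (forall u, size u = n -> `|F u| <= c) ->
  (forall w, psd (X w)) -> (\forall w \ae P, complex.Re (\tr (X w)) = 1) ->
  \forall w \ae P, `|wtr n F j w (X w)| <= c.
Proof.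
move=> c0 Fc hX hX1.
apply: filterS2 ae_good_orbit hX1 => w hw h1.
have -> : wtr n F j w (X w) = c * wtr n (fun u => c^-1 * F u) j w (X w).
  rewrite -wtr_fZ; apply: eq_wtr => u su.
  by rewrite mulVKf// gt_eqF.
rewrite normrM gtr0_norm // -[leRHS]mulr1; apply: ler_wpM2l; first exact: ltW.
rewrite -[leRHS]h1; apply: wtr_bound => // u su.
by rewrite normrM gtr0_norm ?invr_gt0// mulrC ler_pdivrMr// mul1r Fc.
Qed.

Lemma words_bounded n (F : seq A -> R) : exists2 c : R, 0 < c & forall u, size u = n -> `|F u| <= c.
Proof.
exists (1 + \sum_(u : n.-tuple A) `|F u|) => [|u su]; first by rewrite ltr_pwDl// sumr_ge0.
have -> : u = in_tuple u by [].
have : size u == n by rewrite su.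
move=> h; have -> : F (in_tuple u) = F (Tuple h) by [].
by rewrite (bigD1 (Tuple h))//= addrCA lerDl addr_ge0// sumr_ge0.
Qed.

Lemma wtr_ess_bdd n (F : seq A -> R) j (X : O -> 'M[R[i]]_d) :
  mxmeas X -> (forall w, psd (X w)) -> (\forall w \ae P, complex.Re (\tr (X w)) = 1) ->
  ess_bdd P (fun w => wtr n F j w (X w)).
Proof.
move=> mX hX hX1; split; first by apply: wtr_meas => // a k Y _; exact: T_mxmeas.
by have [c c0 hc] := words_bounded n F; exists c; exact: wtr_bound_ae.
Qed.

Lemma Phin_mxmeas n (X : O -> 'M[R[i]]_d) : mxmeas X ->
  mxmeas (fun w => Phin T theta n w (X w)).
Proof.
move=> mX.
have -> : (fun w => Phin T theta n w (X w)) = (fun w => wsum n (fun=> 1) 1 w (X w)).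
  by apply/funext => w; rewrite wsum_Phin.
by apply: wsum_mxmeas => // a k Y _; exact: T_mxmeas.
Qed.

Lemma Phin_tr n (X : O -> 'M[R[i]]_d) :
  (\forall w \ae P, complex.Re (\tr (X w)) = 1) ->
  \forall w \ae P, complex.Re (\tr (Phin T theta n w (X w))) = 1.
Proof.
by apply: filterS2 ae_good_orbit => w hw h; rewrite -wsum_Phin// wsum1_tr.
Qed.

Lemma annE_wtr N F : annE P T theta s N F = Ex (fun w => wtr N F 1 w (s w)).
Proof. by apply: eq_Rintegral => w _; rewrite -wtr_tuple. Qed.

Let s_tr_ae : \forall w \ae P, complex.Re (\tr (s w)) = 1.
Proof. by apply: aeW => w; exact: s_tr. Qed.

Lemma wtr_s_ess_bdd n F j : ess_bdd P (fun w => wtr n F j w (s w)).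
Proof. by apply: wtr_ess_bdd => //; [exact: s_meas|exact: s_psd]. Qed.

(** Later letters sum out to one by trace preservation: the laws of words of different lengths are
    consistent. *)
Lemma annE_take k l (F : seq A -> R) :
  annE P T theta s (k + l) (fun u => F (take k u)) = annE P T theta s k F.
Proof.
rewrite !annE_wtr; apply: eq_Exp_ae; [exact: wtr_s_ess_bdd|exact: wtr_s_ess_bdd|].
apply: filterS ae_good_orbit => w hw.
rewrite (@eq_wtr _ _ _ _ _ _ _ _ (fun u => F (take k u) * 1)) => [|u _]; last by rewrite mulr1.
by rewrite (@wtr_cat _ _ _ _ _ theta Tlin k l F (fun=> 1)) wtr_cst// mul1r.
Qed.

Lemma wtr_stationary k l (G : seq A -> R) :
  \forall w \ae P, wtr l G (1 + k) w (Phin T theta k w (s w)) =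
     wtr l G 1 (iter k theta w) (s (iter k theta w)).
Proof.
(* [dyn_stationary] speaks of positive times only; time 0 is trivial. *)
case: k => [|k]; first by apply: aeW.
by have := @ds k.+1 isT; apply: filterS => w h; rewrite wtr_shift h.
Qed.

(** Stationarity of the outcomes: summing out the first [k] letters carries [s] to [s] at the
    shifted environment, and [theta] preserves the law. *)
Lemma annE_drop k l (G : seq A -> R) :
  annE P T theta s (k + l) (fun u => G (drop k u)) = annE P T theta s l G.
Proof.
rewrite !annE_wtr -[RHS](Exp_iter mth pth k); last exact: wtr_s_ess_bdd.
apply: eq_Exp_ae; [exact: wtr_s_ess_bdd| |].
  exact: (ess_bdd_iter mth pth k (wtr_s_ess_bdd l G 1)).
apply: filterS (wtr_stationary k l G) => w <-.
rewrite (@eq_wtr _ _ _ _ _ _ _ _ (fun u => 1 * G (drop k u))) => [|u _]; last by rewrite mul1r.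
by rewrite (@wtr_cat _ _ _ _ _ theta Tlin k l (fun=> 1) G) wsum_Phin.
Qed.

Lemma annE_fD N F G : annE P T theta s N (fun u => F u + G u) =
  annE P T theta s N F + annE P T theta s N G.
Proof.
rewrite !annE_wtr -ExpD; [|exact: wtr_s_ess_bdd|exact: wtr_s_ess_bdd].
by apply: eq_Rintegral => w _; rewrite wtr_fD.
Qed.

Lemma annE_fZ N c F : annE P T theta s N (fun u => c * F u) = c * annE P T theta s N F.
Proof.
rewrite !annE_wtr -ExpZ; last exact: wtr_s_ess_bdd.
by apply: eq_Rintegral => w _; rewrite wtr_fZ.
Qed.

Lemma eq_annE N F G : (forall u, size u = N -> F u = G u) ->
  annE P T theta s N F = annE P T theta s N G.
Proof.
by move=> FG; apply: eq_Rintegral => w _; apply: eq_bigr => u _; rewrite FG// size_tuple.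
Qed.

Lemma annE_ge0 N F : (forall u, size u = N -> 0 <= F u) -> 0 <= annE P T theta s N F.
Proof.
by move=> F0; rewrite annE_wtr; apply: Rintegral_ge0 => w _; apply: wtr_ge0 => //; exact: s_psd.
Qed.

Lemma annE_cst N c : annE P T theta s N (fun=> c) = c.
Proof.
rewrite annE_wtr -[RHS](Exp_cst P); apply: eq_Exp_ae.
- exact: wtr_s_ess_bdd.
- exact: ess_bdd_cst.
- by apply: filterS ae_good_orbit => w hw; rewrite wtr_cst// s_tr mulr1.
Qed.

(** The added 1 makes the constant positive, so that it can be divided by. *)
Let K := tracenorm_factor R d + 1.
Let K0 : 0 < K. Proof. by rewrite ltr_wpDl// tracenorm_factor_ge0. Qed.

(** An expectation of a bounded function of words is Lipschitz in the state for the trace norm, so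
    (H3) passes from states to observables. The difference [D] is measurable, which is not
    established for the trace norm; this is where [Exp_le_integral] enters. *)
Lemma forgetting_observable (vt : O -> 'M[R[i]]_d) n l (G : seq A -> R) :
  random_state vt -> (0 < n)%N -> (forall u, size u = l -> `|G u| <= 1) ->
  let D := fun w => wtr l G 1 (iter n theta w) (Phin T theta n w (vt w)) -
     wtr l G 1 (iter n theta w) (s (iter n theta w)) in
  ess_bdd P D /\ Ex (fun w => `|D w|) <= K * r n.
Proof.
move=> hv n0 G1 D.
have vp w : psd (vt w) by case: hv => /(_ w)[].
have vm : mxmeas vt by case: hv.
have v1 : \forall w \ae P, complex.Re (\tr (vt w)) = 1.
  by apply: aeW => w; apply: density_tr; case: hv.
have bD : ess_bdd P D.
  apply: ess_bddB; last exact: (ess_bdd_iter mth pth n (wtr_s_ess_bdd l G 1)).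
  have -> : (fun w => wtr l G 1 (iter n theta w) (Phin T theta n w (vt w))) =
    (fun w => wtr l G (1 + n) w (Phin T theta n w (vt w))).
    by apply/funext => w; rewrite wtr_shift.
  apply: wtr_ess_bdd; [exact: Phin_mxmeas| |exact: Phin_tr].
  by move=> w; exact: Phin_psd.
split=> //.
have bD' := ess_bdd_norm bD.
rewrite -ler_pdivrMl// -ExpZ//.
apply: (Exp_le_integral _ _ _ (hr hv n0)); first exact: ess_bddZ.
  by move=> w; exact: tracenorm_ge0.
apply: filterS ae_good_orbit => w hw; rewrite ler_pdivrMl//.
apply: (@le_trans _ _ (tracenorm_factor R d * tracenorm (Phin T theta n w (vt w) - s (iter n theta w)))).
  apply: wtr_diff_le => //; [exact: good_orbit_iter|exact: Phin_psd|exact: s_psd].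
by rewrite ler_wpM2r ?tracenorm_ge0// lerDl.
Qed.

Lemma iter_thK k : cancel (iter k theta) (iter k thetainv).
Proof.
elim: k => [//|k IH] w; rewrite iterSr.
by rewrite [iter k.+1 theta w]iterS thK IH.
Qed.

Lemma psd_tr_real n (X : 'M[R[i]]_n) : psd X -> (complex.Re (\tr X))%:C%C = \tr X.
Proof.
move=> hX; apply: RRe_real; apply: ger0_real; rewrite /mxtrace sumr_ge0// => i _.
exact: psd_diag_ge0.
Qed.

Section PastFuture.
Variables (k l n : nat) (F G : seq A -> R).
Hypotheses (F13 : forall u, size u = k -> 1 <= F u <= 3).
Hypothesis G1 : forall u, size u = l -> `|G u| <= 1.
Hypothesis n0 : (0 < n)%N.

Let M w := wsum k F 1 w (s w).
Let tM w := wtr k F 1 w (s w).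
Let g w := wtr l G 1 w (s w).

Let M_psd w : psd (M w).
Proof.
apply: wsum_psd => //; last exact: s_psd.
by move=> u /F13 /andP[h _]; apply: le_trans h.
Qed.

(** The lower bound makes the tilted state normalizable almost surely; the upper bound is the price
    of undoing the normalization. *)
Let tM_bd : \forall w \ae P, 1 <= tM w <= 3.
Proof.
apply: filterS ae_good_orbit => w hw.
have E c : wtr k (fun=> c) 1 w (s w) = c by rewrite wtr_cst// s_tr mulr1.
apply/andP; split.
  rewrite -[leLHS](E 1); apply: wtr_le => //; last exact: s_psd.
  by move=> u /F13/andP[].
rewrite -[leRHS](E 3); apply: wtr_le => //; last exact: s_psd.
by move=> u /F13/andP[].
Qed.

Let btM : ess_bdd P tM. Proof. exact: wtr_s_ess_bdd. Qed.
Let bg : ess_bdd P g. Proof. exact: wtr_s_ess_bdd. Qed.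

(* The state of the system after the letters selected by [F], normalized, seen
   as a random initial state at time [k]. *)
Let vt w' := let X := M (iter k thetainv w') in
  if 0 < complex.Re (\tr X) then ((complex.Re (\tr X))^-1)%:C%C *: X else s w'.

Let mM : mxmeas M.
Proof.
by apply: wsum_mxmeas => //; [move=> a j Y _; exact: T_mxmeas|exact: s_meas].
Qed.

Let vt_state : random_state vt.
Proof.
split=> [w|i j].
  rewrite /vt; case: ifPn => [h|_]; last by case: hs.
  split; first by apply: psdZ => //; rewrite ler0c invr_ge0 ltW.
  rewrite mxtraceZ -[X in _ * X]psd_tr_real// -rmorphM mulVf ?gt_eqF//.
have mi : measurable_fun setT (iter k thetainv) by apply: measurable_iter.
have mMi : mxmeas (fun w => M (iter k thetainv w)) by apply: mxmeas_comp.
have mt : measurable_fun setT (fun w => complex.Re (\tr (M (iter k thetainv w)))).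
  have h : cmeasurable (fun w => \tr (M (iter k thetainv w))).
    by apply: cmeas_sum => e; exact: mMi.
  by case: h.
have mc : measurable_fun setT (fun w => 0 < complex.Re (\tr (M (iter k thetainv w)))).
  by apply: measurable_fun_ltr => //; exact: measurable_cst.
(* The inverse is rewritten as a power with exponent -1, for which measurability is at hand; the two
   agree on the branch where the trace is positive. *)
have mV : cmeasurable (fun w => ((complex.Re (\tr (M (iter k thetainv w)))) `^ (-1))%:C%C).
  apply: cmeas_real.
  have h := measurableT_comp (measurable_powR (-1)) mt; exact: h.
have m1 := cmeasM mV (mMi i j).
have m2 : cmeasurable (fun w => s w i j) by exact: s_meas.
have E w : vt w i j = if 0 < complex.Re (\tr (M (iter k thetainv w))) then
   ((complex.Re (\tr (M (iter k thetainv w)))) `^ (-1))%:C%C * M (iter k thetainv w) i j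
   else s w i j.
  by rewrite /vt; case: ifPn => // h; rewrite mxE powR_inv1// ltW.
split; under eq_fun do rewrite E.
  under eq_fun do rewrite (fun_if (@complex.Re R)).
  by apply: measurable_fun_ifT => //; [case: m1|case: m2].
under eq_fun do rewrite (fun_if (@complex.Im R)).
by apply: measurable_fun_ifT => //; [case: m1|case: m2].
Qed.

(** After [n] further letters the state reached from [vt] is close in mean to [s], so the future
    factor may restart from [s]. The factor 3 bounds the weight [tM]. *)
Lemma annE_gap_dist :
  `|annE P T theta s (k + (n + l)) (fun u => F (take k u) * G (drop n (drop k u)))
    - Ex (fun w => tM w * g (iter (n + k) theta w))| <= 3 * (K * r n).
Proof.
rewrite annE_wtr.
have [bD hD] := forgetting_observable vt_state n0 G1.
have bgk : ess_bdd P (fun w => tM w * g (iter (n + k) theta w)).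
  by apply: ess_bddM => //; exact: (ess_bdd_iter mth pth (n + k) bg).
apply: (@Exp_dist_le _ _ _ _ _ _ (fun w => 3 *
   `|wtr l G 1 (iter n theta (iter k theta w)) (Phin T theta n (iter k theta w) (vt (iter k theta w))) -
     wtr l G 1 (iter n theta (iter k theta w)) (s (iter n theta (iter k theta w)))|)) => //.
- exact: wtr_s_ess_bdd.
- by apply: ess_bddZ; exact: (ess_bdd_iter mth pth k (ess_bdd_norm bD)).
- apply: filterS2 ae_good_orbit tM_bd => w hw /andP[t1 t3].
  rewrite (@wtr_cat _ _ _ _ _ theta Tlin k (n + l) F (fun u => G (drop n u))).
  rewrite wtr_shift.
  rewrite (@eq_wtr _ _ _ _ _ _ _ _ (fun u => 1 * G (drop n u))) => [|u _]; last by rewrite mul1r.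
  rewrite (@wtr_cat _ _ _ _ _ theta Tlin n l (fun=> 1) G) wsum_Phin// wtr_shift.
  (* At the environment [theta^k w] the backward iterates in [vt] return to [w], and a positive
     weight selects the normalized branch. *)
  have ME : wsum k F 1 w (s w) = (tM w)%:C%C *: vt (iter k theta w).
    rewrite /vt iter_thK -/(M w).
    have tE : complex.Re (\tr (M w)) = tM w by [].
    have t0 : 0 < tM w by apply: lt_le_trans t1.
    by rewrite tE t0 scalerA -rmorphM mulfV ?gt_eqF// scale1r.
  rewrite ME -!wsum_Phin// wsumZ// wtrZ// wsum_Phin//.
  rewrite iterD /g -mulrBr normrM ler_wpM2r//.
  by rewrite ger0_norm// (le_trans _ t1).
- rewrite ExpZ; last exact: (ess_bdd_iter mth pth k (ess_bdd_norm bD)).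
  by rewrite (Exp_iter mth pth k (ess_bdd_norm bD)) ler_wpM2l.
Qed.

End PastFuture.

Section Alpha.

Lemma generated_mxmeas (J : set int) a j Y : J (Posz j) ->
  @mxmeas _ (g_sigma_algebraType (instr_generators T theta thetainv J)) R d
    (fun w => T a (iter j theta w) Y).
Proof.
move=> Jj i l; split=> _ B mB; rewrite setTI; apply: sub_sigma_algebra;
  exists (Posz j); split => //; exists a, Y, i, l, B; split => //; [by left|by right].
Qed.

Lemma measurable_iterz j : measurable_fun setT (iterz theta thetainv j).
Proof. by case: j => n; apply: measurable_iter. Qed.

Lemma generated_measurable (J : set int) E :
  <<s instr_generators T theta thetainv J >> E -> measurable E.
Proof.
apply: smallest_sub; first exact: sigma_algebra_measurable.
move=> _ [j [_ [a [X [i [l [B [mB [->|->]]]]]]]]].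
  have [h _] : cmeasurable (fun w => T a w X i l) by case: hT.
  by have := measurableT_comp h (measurable_iterz j) measurableT mB; rewrite setTI.
have [_ h] : cmeasurable (fun w => T a w X i l) by case: hT.
by have := measurableT_comp h (measurable_iterz j) measurableT mB; rewrite setTI.
Qed.

(** The coefficient is an extended real; it lies between 0 and 1, so taking [fine] loses nothing. *)
Lemma alpha_mix_ge n k E F : (0 < k)%N ->
  Fpast T theta thetainv k%:Z E -> Ffuture T theta thetainv (k + n)%:Z F ->
  (`|P (E `&` F) - P E * P F| <= (fine (alpha_mix P T theta thetainv n))%:E)%E.
Proof.
move=> k0 hE hF.
have h1 : (`|P (E `&` F) - P E * P F| <= alpha_mix P T theta thetainv n)%E.
  apply: (@le_trans _ _ (alpha_coef P (Fpast T theta thetainv k%:Z)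
                              (Ffuture T theta thetainv (k + n)%:Z))).
    by apply: ereal_sup_ubound; exists E => //; exists F.
  by apply: ereal_sup_ubound; exists k.
have h2 : (alpha_mix P T theta thetainv n <= 1)%E.
  apply: ge_ereal_sup => _ [k' _ <-]; apply: ge_ereal_sup => _ [E' hE' [F' hF' <-]].
  have mE := generated_measurable hE'; have mF := generated_measurable hF'.
  have fp (B : set O) : measurable B -> exists2 x : R, 0 <= x <= 1 & P B = x%:E.
    move=> mB; exists (fine (P B)); last by rewrite fineK// fin_num_measure.
    have pf : (fine (P B))%:E = P B by rewrite fineK// fin_num_measure.
    by rewrite -!lee_fin pf measure_ge0 probability_le1.
  have [x /andP[x0 x1] ->] := fp _ (measurableI _ _ mE mF).
  have [y /andP[y0 y1] ->] := fp _ mE; have [z /andP[z0 z1] ->] := fp _ mF.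
  rewrite -EFinM -EFinB abse_EFin lee_fin ler_norml; apply/andP; split; nra.
rewrite fineK//; rewrite ge0_fin_numE; first exact: le_lt_trans h2 (ltry _).
exact: le_trans h1.
Qed.

End Alpha.

Lemma unit_clip (x : R) : 0 <= Num.max 0 (Num.min 1 x) <= 1.
Proof. by rewrite le_max lexx /= ge_max ler01 ge_min lexx. Qed.

(** The bounds on [u] and [v] hold almost surely only, so [(f + 1) / 2] is clipped to [[0, 1]]
    everywhere; clipping respects the generated sigma-algebras, whereas a change on a null set need
    not. Undoing the two affine maps costs the factor 4. *)
Lemma mixing_cov n k (u v : O -> R) : (0 < k)%N ->
  @measurable_fun _ _ (g_sigma_algebraType (instr_generators T theta thetainv
     [set j | (j <= k%:Z)%R])) _ setT u ->
  @measurable_fun _ _ (g_sigma_algebraType (instr_generators T theta thetainv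
     [set j | ((k + n)%:Z <= j)%R])) _ setT v ->
  (\forall w \ae P, `|u w| <= 1) -> (\forall w \ae P, `|v w| <= 1) ->
  `|Ex (fun w => u w * v w) - Ex u * Ex v| <= 4 * fine (alpha_mix P T theta thetainv n).
Proof.
move=> k0 mu mv u1 v1.
pose c (f : O -> R) w := Num.max 0 (Num.min 1 (2^-1 * (f w + 1))).
(* Stated for every measurable space, to serve the generated sigma-algebras as well as the ambient
   one. *)
have mc dX (X : measurableType dX) (f : X -> R) : measurable_fun setT f ->
    measurable_fun setT (fun w => Num.max 0 (Num.min 1 (2^-1 * (f w + 1)))).
  move=> mf; apply: measurable_maxr => //; apply: measurable_minr => //.
  by apply: measurable_funM => //; exact: measurable_funD.
have mcu := mc _ _ _ mu; have mcv := mc _ _ _ mv.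
have mO (J : set int) (f : O -> R) : @measurable_fun _ _ (g_sigma_algebraType
   (instr_generators T theta thetainv J)) _ setT f -> measurable_fun setT f.
  move=> mf _ B mB; rewrite setTI; apply: (@generated_measurable J).
  by have := mf measurableT B mB; rewrite setTI.
have Ou := mO _ _ mu; have Ov := mO _ _ mv.
have Ocu : measurable_fun setT (c u) by exact: mc.
have Ocv : measurable_fun setT (c v) by exact: mc.
have bc (f : O -> R) : measurable_fun setT f -> ess_bdd P (c f).
  move=> mf; split; first exact: mc.
  by exists 1; apply: aeW => w; have /andP[? ?] := unit_clip (2^-1 * (f w + 1)); rewrite ger0_norm.
have cE (f : O -> R) : (\forall w \ae P, `|f w| <= 1) -> \forall w \ae P, f w = 2 * c f w - 1.
  apply: filterS => w /ler_normlP[h1 h2].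
  rewrite /c (min_idPr _); last by lra.
  by rewrite (max_idPr _); lra.
have bu : ess_bdd P u by split => //; exists 1.
have bv : ess_bdd P v by split => //; exists 1.
have bcu := bc _ Ou; have bcv := bc _ Ov.
have Eu (f : O -> R) : measurable_fun setT f -> (\forall w \ae P, `|f w| <= 1) -> Ex f = 2 * Ex (c f) - 1.
  move=> mf f1; have bcf := bc _ mf.
  rewrite -ExpZ// -[X in _ - X](Exp_cst P 1) -ExpB; [|exact: ess_bddZ|exact: ess_bdd_cst].
  apply: eq_Exp_ae; [by split => //; exists 1| |exact: cE].
  by apply: ess_bddB; [exact: ess_bddZ|exact: ess_bdd_cst].
have Euv : Ex (fun w => u w * v w) =
   4 * Ex (fun w => c u w * c v w) - 2 * Ex (c u) - 2 * Ex (c v) + 1.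
  rewrite -!ExpZ//; last exact: ess_bddM.
  have b1 : ess_bdd P (fun w => 4 * (c u w * c v w)) by apply: ess_bddZ; exact: ess_bddM.
  have b2 : ess_bdd P (fun w => 2 * c u w) by exact: ess_bddZ.
  have b3 : ess_bdd P (fun w => 2 * c v w) by exact: ess_bddZ.
  rewrite -ExpB// -ExpB//; last exact: ess_bddB.
  rewrite -[X in _ + X](Exp_cst P 1) -ExpD; [|by apply: ess_bddB => //; exact: ess_bddB|exact: ess_bdd_cst].
  apply: eq_Exp_ae; first exact: ess_bddM.
    by apply: ess_bddD; [apply: ess_bddB => //; exact: ess_bddB|exact: ess_bdd_cst].
  by apply: filterS2 (cE _ u1) (cE _ v1) => w -> ->; ring.
have -> : Ex (fun w => u w * v w) - Ex u * Ex v =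
   4 * (Ex (fun w => c u w * c v w) - Ex (c u) * Ex (c v)).
  by rewrite Euv (Eu _ Ou u1) (Eu _ Ov v1); ring.
rewrite normrM ger0_norm// ler_wpM2l//.
apply: alpha_mixing_cov => //; [by move=> w; exact: unit_clip|by move=> w; exact: unit_clip|].
move=> x y; apply: (@alpha_mix_ge n k) => //.
  have := mcu measurableT `]x, +oo[%classic (measurable_itv _).
  by rewrite setTI.
have := mcv measurableT `]y, +oo[%classic (measurable_itv _).
by rewrite setTI.
Qed.

(** With everything bounded by 1, errors of size [e] in mean move the mean of the product and the
    product of the means by [2 * e] each. *)
Lemma cov_perturb (a a1 b b1 : O -> R) e :
  ess_bdd P a -> ess_bdd P a1 -> ess_bdd P b -> ess_bdd P b1 ->
  (\forall w \ae P, `|a w| <= 1) -> (\forall w \ae P, `|a1 w| <= 1) ->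
  (\forall w \ae P, `|b w| <= 1) -> (\forall w \ae P, `|b1 w| <= 1) ->
  Ex (fun w => `|a1 w - a w|) <= e -> Ex (fun w => `|b1 w - b w|) <= e ->
  `|Ex (fun w => a w * b w) - Ex a * Ex b| <=
  `|Ex (fun w => a1 w * b1 w) - Ex a1 * Ex b1| + 4 * e.
Proof.
move=> ba ba1 bb bb1 ha ha1 hb hb1 ea eb.
have ea' := ess_bdd_norm (ess_bddB ba1 ba).
have eb' := ess_bdd_norm (ess_bddB bb1 bb).
have h1 : `|Ex (fun w => a1 w * b1 w) - Ex (fun w => a w * b w)| <= 2 * e.
  apply: (@Exp_dist_le _ _ _ _ _ _ (fun w => `|a1 w - a w| + `|b1 w - b w|)).
  - exact: ess_bddM.
  - exact: ess_bddM.
  - exact: ess_bddD.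
  - apply: filterS2 ha hb1 => w h1 h2.
    have -> : a1 w * b1 w - a w * b w = (a1 w - a w) * b1 w + a w * (b1 w - b w) by ring.
    rewrite (le_trans (ler_normD _ _))// !normrM lerD//.
      by rewrite ler_piMr.
    by rewrite ler_piMl.
  - by rewrite ExpD// mulrDl mul1r lerD.
have h2 : `|Ex a1 - Ex a| <= e.
  apply: (@Exp_dist_le _ _ _ _ _ _ (fun w => `|a1 w - a w|)) => //.
  exact: aeW.
have h3 : `|Ex b1 - Ex b| <= e.
  apply: (@Exp_dist_le _ _ _ _ _ _ (fun w => `|b1 w - b w|)) => //.
  exact: aeW.
have h4 : `|Ex a| <= 1 by apply: Exp_bound.
have h5 : `|Ex b1| <= 1 by apply: Exp_bound.
have h6 : `|Ex a1 * Ex b1 - Ex a * Ex b| <= 2 * e.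
  have -> : Ex a1 * Ex b1 - Ex a * Ex b = (Ex a1 - Ex a) * Ex b1 + Ex a * (Ex b1 - Ex b) by ring.
  rewrite (le_trans (ler_normD _ _))// !normrM mulrDl mul1r lerD//.
    by rewrite -[e]mulr1 ler_pM.
  by rewrite -[e]mul1r ler_pM.
have -> : Ex (fun w => a w * b w) - Ex a * Ex b =
  (Ex (fun w => a1 w * b1 w) - Ex a1 * Ex b1) +
  (- (Ex (fun w => a1 w * b1 w) - Ex (fun w => a w * b w)) + (Ex a1 * Ex b1 - Ex a * Ex b)) by ring.
rewrite (le_trans (ler_normD _ _))// lerD2l (le_trans (ler_normD _ _))// normrN.
by lra.
Qed.

(** Stationarity moves everything [n] steps later. The copies of [s] at the start of the past and of
    the future word can then be replaced by a constant density matrix run through the preceding [n]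
    channels, after which both factors are functions of instruments alone. *)
Lemma past_future_cov k l n (F G : seq A -> R) : (0 < k)%N -> (0 < n)%N ->
  (forall u, size u = k -> `|F u| <= 1) -> (forall u, size u = l -> `|G u| <= 1) ->
  `|Ex (fun w => wtr k F 1 w (s w) *
       wtr l G 1 (iter (n + (k + n)) theta w) (s (iter (n + (k + n)) theta w)))
    - annE P T theta s k F * annE P T theta s l G| <=
  4 * fine (alpha_mix P T theta thetainv n) + 4 * (K * r n).
Proof.
move=> k0 n0 F1 G1.
pose rho := s point.
have rs : random_state (fun _ : O => rho).
  by split=> [w|i j]; [case: hs => h _; exact: h|exact: cmeas_cst].
have rp (w : O) : psd ((fun=> rho) w) by exact: s_psd.
have rt : \forall w \ae P, complex.Re (\tr ((fun=> rho) w)) = 1 by apply: aeW => w; exact: s_tr.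
have rm : mxmeas (fun _ : O => rho) by case: rs.
(* The past factor will use instruments at times 1 to [n + k]. The relaxation for the future factor
   starts at time [q], so it uses times after [q] only: the mixing gap is [n]. *)
pose q := (n + k + n)%N.
have [bDF hDF] := forgetting_observable rs n0 F1.
have [bDG hDG] := forgetting_observable rs n0 G1.
pose fF w := wtr k F 1 w (s w); pose fG w := wtr l G 1 w (s w).
have bF : ess_bdd P fF by exact: wtr_s_ess_bdd.
have bG : ess_bdd P fG by exact: wtr_s_ess_bdd.
pose a w := fF (iter n theta w).
pose b w := fG (iter n theta (iter q theta w)).
pose a1 w := wtr k F (1 + n) w (Phin T theta n w rho).
pose b0 w := wtr l G (1 + n) w (Phin T theta n w rho).
pose b1 w := b0 (iter q theta w).
have ba : ess_bdd P a := ess_bdd_iter mth pth n bF.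
have bb : ess_bdd P b := ess_bdd_iter mth pth q (ess_bdd_iter mth pth n bG).
have bP w : psd (Phin T theta n w rho) by apply: Phin_psd => //; exact: s_psd.
have Pt := Phin_tr n rt.
have Pm := Phin_mxmeas n rm.
have ba1 : ess_bdd P a1 by apply: wtr_ess_bdd.
have bb0 : ess_bdd P b0 by apply: wtr_ess_bdd.
have bb1 : ess_bdd P b1 := ess_bdd_iter mth pth q bb0.
have sF : \forall w \ae P, `|fF w| <= 1 by apply: wtr_bound_ae => //; exact: s_psd.
have sG : \forall w \ae P, `|fG w| <= 1 by apply: wtr_bound_ae => //; exact: s_psd.
have la := ae_iter mth pth n sF.
have lb := ae_iter mth pth q (ae_iter mth pth n sG).
have la1 : \forall w \ae P, `|a1 w| <= 1 by apply: wtr_bound_ae.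
have lb0 : \forall w \ae P, `|b0 w| <= 1 by apply: wtr_bound_ae.
have lb1 := ae_iter mth pth q lb0.
have -> : Ex (fun w => wtr k F 1 w (s w) *
       wtr l G 1 (iter (n + (k + n)) theta w) (s (iter (n + (k + n)) theta w))) =
   Ex (fun w => a w * b w).
  have bb' : ess_bdd P (fun w => fF w * fG (iter (n + (k + n)) theta w)).
    by apply: ess_bddM => //; exact: (ess_bdd_iter mth pth _ bG).
  rewrite -(Exp_iter mth pth n bb'); apply: eq_Rintegral => w _.
  by rewrite /a /b -!iterD; congr (_ * fG (iter _ _ _)); rewrite /q; lia.
have -> : annE P T theta s k F = Ex a by rewrite annE_wtr (Exp_iter mth pth n bF).
have -> : annE P T theta s l G = Ex b.
  by rewrite annE_wtr (Exp_iter mth pth q (ess_bdd_iter mth pth n bG)) (Exp_iter mth pth n bG).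
have := @cov_perturb a a1 b b1 (K * r n) ba ba1 bb bb1 la la1 lb lb1.
move=> /(_ _ _)/le_trans; apply.
- apply: le_trans hDF; rewrite le_eqVlt; apply/orP; left; apply/eqP.
  by apply: eq_Rintegral => w _; rewrite /a1 wtr_shift.
- rewrite -(Exp_iter mth pth q (ess_bdd_norm bDG)) in hDG.
  apply: le_trans hDG; rewrite le_eqVlt; apply/orP; left; apply/eqP.
  by apply: eq_Rintegral => w _; rewrite /b1 /b0 wtr_shift.
rewrite lerD2r; apply: (@mixing_cov n (n + k)) => //; first by rewrite addn_gt0 k0 orbT.
  have -> : a1 = fun w => wtr k F (1 + n) w (wsum n (fun=> 1) 1 w rho).
    by apply/funext => w; rewrite wsum_Phin.
  apply: (@wtr_meas _ (g_sigma_algebraType (instr_generators T theta thetainv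
     [set j | (j <= (n + k)%:Z)%R])) R d A T theta Tlin k F (1 + n)%N
     (fun w => wsum n (fun=> 1) 1 w rho)).
    by move=> c j Y jj; apply: generated_mxmeas => /=; lia.
  apply: (@wsum_mxmeas _ (g_sigma_algebraType (instr_generators T theta thetainv
     [set j | (j <= (n + k)%:Z)%R])) R d A T theta Tlin n (fun=> 1) 1%N (fun=> rho)).
    by move=> c j Y jj; apply: generated_mxmeas => /=; lia.
  by move=> i j; exact: cmeas_cst.
have -> : b1 = fun w => wtr l G (1 + n + q) w (wsum n (fun=> 1) (1 + q) w rho).
  by apply/funext => w; rewrite wtr_shift wsum_shift wsum_Phin.
apply: (@wtr_meas _ (g_sigma_algebraType (instr_generators T theta thetainv
     [set j | ((n + k + n)%:Z <= j)%R])) R d A T theta Tlin l G (1 + n + q)%N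
     (fun w => wsum n (fun=> 1) (1 + q) w rho)).
  by move=> c j Y jj; apply: generated_mxmeas => /=; lia.
apply: (@wsum_mxmeas _ (g_sigma_algebraType (instr_generators T theta thetainv
     [set j | ((n + k + n)%:Z <= j)%R])) R d A T theta Tlin n (fun=> 1) (1 + q)%N (fun=> rho)).
  by move=> c j Y jj; apply: generated_mxmeas => /=; lia.
by move=> i j; exact: cmeas_cst.
Qed.

(* In the gap of [2 n] letters the first half decouples the instruments and the
   second forgets the outcomes read by [F]. *)
Lemma annE_mixing k l n (F G : seq A -> R) : (0 < k)%N -> (0 < n)%N ->
  (forall u, size u = k -> `|F u| <= 1) -> (forall u, size u = l -> `|G u| <= 1) ->
  `|annE P T theta s (k + n + n + l) (fun u => F (take k u) * G (drop (k + n + n) u))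
    - annE P T theta s k F * annE P T theta s l G| <=
  4 * fine (alpha_mix P T theta thetainv n) + 7 * (tracenorm_factor R d + 1) * r n.
Proof.
move=> k0 n0 F1 G1.
(* The shift by 2 puts the weight into [[1, 3]]; its contribution [2 * annE P T theta s l G] appears
   on both sides and cancels. The final 7 is 3 from [annE_gap_dist] plus 4 from
   [past_future_cov]. *)
pose F' u := F (take k u) + 2.
have F13 u : size u = (k + n)%N -> 1 <= F' u <= 3.
  move=> su; have /F1/ler_normlP[h1 h2] : size (take k u) = k.
    by rewrite size_takel// su leq_addr.
  by apply/andP; split; rewrite /F'; lra.
have h := annE_gap_dist F13 G1 n0.
have h2 := past_future_cov k0 n0 F1 G1.
pose g w := wtr l G 1 (iter (n + (k + n)) theta w) (s (iter (n + (k + n)) theta w)).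
have bg : ess_bdd P g := ess_bdd_iter mth pth _ (wtr_s_ess_bdd l G 1).
have E1 : annE P T theta s (k + n + (n + l)) (fun u => F' (take (k + n) u) * G (drop n (drop (k + n) u))) =
   annE P T theta s (k + n + n + l) (fun u => F (take k u) * G (drop (k + n + n) u)) +
   2 * annE P T theta s l G.
  rewrite -(annE_drop (k + n + n) l G) -annE_fZ -annE_fD addnA; apply: eq_annE => u _.
  by rewrite /F' take_takel ?leq_addr// drop_drop [(n + (k + n))%N]addnC mulrDl.
have E2 : Ex (fun w => wtr (k + n) F' 1 w (s w) * g w) =
   Ex (fun w => wtr k F 1 w (s w) * g w) + 2 * annE P T theta s l G.
  have -> : annE P T theta s l G = Ex g.
    by rewrite annE_wtr (Exp_iter mth pth _ (wtr_s_ess_bdd l G 1)).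
  have b1 : ess_bdd P (fun w => wtr k F 1 w (s w) * g w).
    by apply: ess_bddM => //; exact: wtr_s_ess_bdd.
  rewrite -ExpZ// -ExpD//; last exact: ess_bddZ.
  apply: eq_Exp_ae.
  - by apply: ess_bddM => //; exact: wtr_s_ess_bdd.
  - by apply: ess_bddD => //; exact: ess_bddZ.
  apply: filterS ae_good_orbit => w hw; rewrite -mulrDl; congr (_ * _).
  rewrite /F' wtr_fD wtr_cst// s_tr mulr1; congr (_ + _).
  rewrite (@eq_wtr _ _ _ _ _ _ _ _ (fun u => F (take k u) * 1)) => [|u _]; last by rewrite mulr1.
  by rewrite (@wtr_cat _ _ _ _ _ theta Tlin k n F (fun=> 1)) wtr_cst// mul1r.
rewrite E1 E2 in h.
move: h h2; rewrite -/K => /ler_normlP[h1 h2] /ler_normlP[h3 h4].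
by rewrite ler_norml; apply/andP; split; lra.
Qed.

End Mixing.

(** * The standard normal law *)

Section Gaussian.
Variable R : realType.
Local Notation leb := (@lebesgue_measure R).
Local Notation phi := (normal_pdf (0 : R) 1).

Definition gint (f : R -> R) := leb.-integrable setT (EFin \o (fun x => f x * phi x)).
(* Expectation of [f] under the standard normal law. *)
Definition gexp (f : R -> R) : R := \int[leb]_x (f x * phi x).

Lemma phi_ge0 (x : R) : 0 <= phi x. Proof. exact: normal_pdf_ge0. Qed.

Lemma phiE (x : R) : phi x = normal_peak 1 * expR (- x ^+ 2 / 2).
Proof. by rewrite normal_pdfE ?oner_neq0// /normal_fun subr0 expr1n. Qed.

Lemma measurable_phi : measurable_fun setT phi.
Proof. exact: measurable_normal_pdf. Qed.

Lemma gint_le (f g : R -> R) : measurable_fun setT f ->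
  (forall x, `|f x| <= `|g x|) -> gint g -> gint f.
Proof.
move=> mf fg; apply: le_integrable => //.
  by apply/measurable_EFinP; apply: measurable_funM => //; exact: measurable_phi.
by move=> x _ /=; rewrite lee_fin !normrM ler_wpM2r.
Qed.

Lemma gint_cst c : gint (fun=> c).
Proof.
rewrite /gint; have -> : EFin \o (fun x => c * phi x) = (fun x => c%:E * (phi x)%:E)%E.
  by apply/funext => x.
apply: integrableZl => //; exact: integrable_normal_pdf.
Qed.

Lemma gint_bdd (f : R -> R) M : measurable_fun setT f -> (forall x, `|f x| <= M) -> gint f.
Proof.
move=> mf fM; apply: (gint_le mf _ (gint_cst M)) => x.
by rewrite (le_trans (fM x))// ler_norm.
Qed.

(** From [x^2 / 4 <= expR (x^2 / 4)] the integrand is dominated by a multiple of the normal density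
    of variance 2. *)
Lemma gint_sqr : gint (fun x => x ^+ 2).
Proof.
pose s : R := Num.sqrt 2.
have s0 : s != 0 by rewrite gt_eqF// sqrtr_gt0.
have p0 : 0 < normal_peak s by exact: normal_peak_gt0.
have h : leb.-integrable setT (EFin \o (fun x => (4 * normal_peak 1 / normal_peak s) * normal_pdf 0 s x)).
  have -> : EFin \o (fun x => (4 * normal_peak 1 / normal_peak s) * normal_pdf 0 s x) =
     (fun x => (4 * normal_peak 1 / normal_peak s)%:E * (normal_pdf 0 s x)%:E)%E.
    by apply/funext => x.
  apply: integrableZl => //; exact: integrable_normal_pdf.
apply: le_integrable h => //.
  apply/measurable_EFinP; apply: measurable_funM; last exact: measurable_phi.
  exact: measurable_funX.
move=> x _ /=; rewrite lee_fin ger0_norm; last by rewrite mulr_ge0// ?sqr_ge0// normal_pdf_ge0.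
rewrite ger0_norm; last by rewrite !mulr_ge0// ?invr_ge0 ?normal_peak_ge0// normal_pdf_ge0.
rewrite phiE normal_pdfE//= /normal_fun subr0 sqr_sqrtr//.
have -> : 4 * normal_peak 1 / normal_peak s * (normal_peak s * expR (- x ^+ 2 / (2 *+ 2))) =
  normal_peak 1 * (4 * expR (- x ^+ 2 / 4)).
  have -> : 2 *+ 2 = 4 :> R by rewrite -mulr_natr; ring.
  by field; rewrite gt_eqF.
rewrite mulrCA ler_wpM2l ?normal_peak_ge0//.
have -> : - x ^+ 2 / 2 = - x ^+ 2 / 4 + - x ^+ 2 / 4 by field.
rewrite expRD mulrA ler_wpM2r ?expR_ge0//.
have := @expR_ge1Dx R (x ^+ 2 / 4).
have -> : - x ^+ 2 / 4 = - (x ^+ 2 / 4) by rewrite mulNr.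
rewrite expRN; have e0 : 0 < expR (x ^+ 2 / 4) by exact: expR_gt0.
by rewrite ler_pdivrMr// => h1; lra.
Qed.

Lemma gintD f g : gint f -> gint g -> gint (fun x => f x + g x).
Proof.
move=> hf hg; rewrite /gint.
have -> : EFin \o (fun x => (f x + g x) * phi x) =
  ((EFin \o (fun x => f x * phi x)%R) \+ (EFin \o (fun x => g x * phi x)%R))%E.
  by apply/funext => x /=; rewrite mulrDl.
exact: integrableD.
Qed.

Lemma gintZ c f : gint f -> gint (fun x => c * f x).
Proof.
move=> hf; rewrite /gint.
have -> : EFin \o (fun x => (c * f x) * phi x) =
  (fun x => c%:E * (EFin \o (fun x => f x * phi x)%R) x)%E.
  by apply/funext => x /=; rewrite -mulrA EFinM.
exact: integrableZl.
Qed.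

Lemma gintB f g : gint f -> gint g -> gint (fun x => f x - g x).
Proof.
move=> hf hg; have := gintD hf (gintZ (-1) hg).
by congr gint; apply/funext => x; rewrite mulN1r.
Qed.

Lemma gint_norm f : gint f -> gint (fun x => `|f x|).
Proof.
move=> hf; rewrite /gint.
have -> : EFin \o (fun x => `|f x| * phi x) = (fun x => `|(EFin \o (fun x => f x * phi x)%R) x|%E).
  by apply/funext => x /=; rewrite normrM (ger0_norm (phi_ge0 x)).
exact: integrable_norm.
Qed.

Lemma gint_norm_id : gint (fun x => `|x|).
Proof.
have h : gint (fun x => 1 + x ^+ 2) by apply: gintD; [exact: gint_cst|exact: gint_sqr].
apply: gint_le h; first exact: measurableT_comp.
move=> x; rewrite normr_id [leRHS]ger0_norm ?addr_ge0 ?sqr_ge0//.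
rewrite ler_norml; have := sqr_ge0 (x - 1); have := sqr_ge0 (x + 1).
by move=> h1 h2; apply/andP; split; nra.
Qed.

Lemma gexpD f g : gint f -> gint g -> gexp (fun x => f x + g x) = gexp f + gexp g.
Proof.
by move=> hf hg; rewrite /gexp -RintegralD//; apply: eq_Rintegral => x _; rewrite mulrDl.
Qed.

Lemma gexpB f g : gint f -> gint g -> gexp (fun x => f x - g x) = gexp f - gexp g.
Proof.
by move=> hf hg; rewrite /gexp -RintegralB//; apply: eq_Rintegral => x _; rewrite mulrBl.
Qed.

Lemma gexpZ c f : gint f -> gexp (fun x => c * f x) = c * gexp f.
Proof.
by move=> hf; rewrite /gexp -RintegralZl//; apply: eq_Rintegral => x _; rewrite mulrA.
Qed.

Lemma gexp_cst c : gexp (fun=> c) = c.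
Proof.
rewrite /gexp RintegralZl//; last exact: integrable_normal_pdf.
by rewrite /Rintegral integral_normal_pdf mulr1.
Qed.

Lemma gexp_ge0 f : (forall x, 0 <= f x) -> 0 <= gexp f.
Proof. by move=> h; apply: Rintegral_ge0 => x _; rewrite mulr_ge0// phi_ge0. Qed.

Lemma le_gexp f g : gint f -> gint g -> (forall x, f x <= g x) -> gexp f <= gexp g.
Proof.
by move=> hf hg h; rewrite -subr_ge0 -gexpB//; apply: gexp_ge0 => x; rewrite subr_ge0.
Qed.

Lemma ler_norm_gexp f : gint f -> `|gexp f| <= gexp (fun x => `|f x|).
Proof.
move=> hf; rewrite ler_norml; apply/andP; split.
  rewrite -mulN1r -gexpZ ?gint_norm//; apply: le_gexp => //.
    by apply: gintZ; exact: gint_norm.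
  by move=> x; rewrite mulN1r lerNl -normrN ler_norm.
by apply: le_gexp => //; [exact: gint_norm|move=> x; exact: ler_norm].
Qed.

Lemma gexp_dist_le f g h : gint f -> gint g -> gint h ->
  (forall x, `|f x - g x| <= h x) -> `|gexp f - gexp g| <= gexp h.
Proof.
move=> hf hg hh fg; rewrite -gexpB//.
have hd := gintB hf hg; apply: (le_trans (ler_norm_gexp hd)).
by apply: le_gexp => //; exact: gint_norm.
Qed.

Lemma gexp_bound (f : R -> R) M : measurable_fun setT f -> (forall x, `|f x| <= M) -> `|gexp f| <= M.
Proof.
move=> mf fM; have hf := gint_bdd mf fM; apply: (le_trans (ler_norm_gexp hf)).
by rewrite -[leRHS](gexp_cst M); apply: le_gexp => //; [exact: gint_norm|exact: gint_cst].
Qed.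

Lemma cvgr0_mull c (u : nat -> R) : u @ \oo --> (0 : R) -> (fun n => c * u n) @ \oo --> (0 : R).
Proof. by move=> hu; have := cvgM (cvg_cst c) hu; rewrite mulr0; apply. Qed.

Lemma is_derive_phi (x : R) : is_derive x 1 (phi : R -> R) (- x * phi x).
Proof.
have -> : (phi : R -> R) = (fun x => normal_peak 1 * expR (- x ^+ 2 / 2)).
  by apply/funext => y; rewrite phiE.
apply: is_derive_eq.
by rewrite /GRing.scale /=; field.
Qed.

Lemma phi_cvg0 : phi n%:R @[n --> \oo] --> (0 : R).
Proof.
(* For [n >= 1], [n + 2 <= 2 + n^2 <= 2 expR (n^2 / 2)], which bounds the exponential by
   [2 / (n + 2)]. *)
have h : (fun n => normal_peak 1 * 2 * harmonic n.+1 : R) @ \oo --> (0 : R).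
  apply: cvgr0_mull; rewrite (_ : (fun n => _) = [sequence harmonic (n + 1)%N]_n).
    by rewrite cvg_shiftn; exact: cvg_harmonic.
  by apply/funext => n /=; rewrite addn1.
apply: (@squeeze_cvgr _ _ _ _ (cst 0) (fun n => normal_peak 1 * 2 * harmonic n.+1)) h; last exact: cvg_cst.
near=> n; rewrite phi_ge0 /= phiE -mulrA ler_wpM2l ?normal_peak_ge0//.
have n1 : (1 : R) <= n%:R by rewrite ler1n; near: n; exists 1%N.
have e0 : 0 < expR ((n%:R : R) ^+ 2 / 2) by exact: expR_gt0.
rewrite mulNr expRN -div1r ler_pdivrMr// /harmonic /= mulrAC ler_pdivlMr ?mul1r; last by [].
have := @expR_ge1Dx R ((n%:R) ^+ 2 / 2).
have -> : n.+2%:R = n%:R + 1 + 1 :> R by rewrite !natr1.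
by move: (expR _) => t h1; nra.
Unshelve. all: by end_near.
Qed.

(* Integrate [(h phi)' = (h' - x h) phi] over [-n, n] and let [n] go to infinity. *)
Lemma gaussian_ibp (h h' : R -> R) (L : R) :
  (forall x : R, is_derive x 1 h (h' x)) -> continuous h' ->
  (forall x, `|h x| <= L) -> (forall x, `|h' x| <= L) ->
  gexp (fun x => x * h x) = gexp h'.
Proof.
move=> dh ch' hL h'L.
have ch : continuous h.
  by move=> x; apply/differentiable_continuous/derivable1_diffP; case: (dh x).
have mh : measurable_fun setT h by exact: continuous_measurable_fun.
have mh' : measurable_fun setT h' by exact: continuous_measurable_fun.
have gxh : gint (fun x => x * h x).
  apply: (@gint_le _ (fun x => L * `|x|)); last by apply: gintZ; exact: gint_norm_id.
    by apply: measurable_funM.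
  move=> x; rewrite !normrM normr_id mulrC ler_wpM2r//.
  by rewrite (le_trans (hL x))// ler_norm.
have gh' : gint h' by exact: gint_bdd h'L.
apply/eqP; rewrite -subr_eq0 -gexpB//; apply/eqP.
pose u x := (x * h x - h' x) * phi x.
have gu : leb.-integrable setT (EFin \o u) by exact: (gintB gxh gh').
have cphi : continuous phi by apply: continuous_normal_pdf; exact: oner_neq0.
have cu : continuous u.
  move=> x; apply: cvgM; last exact: cphi.
  apply: cvgB; last exact: ch'.
  by apply: cvgM; [exact: cvg_id|exact: ch].
pose H x := - (h x * phi x).
have dH (x : R) : is_derive x 1 H (u x).
  have := is_derive_phi x; have := dh x => d1 d2.
  rewrite /H /u; apply: is_derive_eq; rewrite /GRing.scale /=; ring.
have cH : continuous H.
  by move=> x; apply/differentiable_continuous/derivable1_diffP; case: (dH x).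
have E n : (\int[leb]_(x in `[(- n.+1%:R : R)%R, (n.+1%:R)%R]) (u x)%:E = (H n.+1%:R)%:E - (H (- n.+1%:R)%R)%:E)%E.
  apply: continuous_FTC2.
  - by rewrite gtrN.
  - exact: continuous_subspaceT.
  - split.
    + by move=> x _; case: (dH x).
    + by apply: cvg_at_right_filter; exact: cH.
    + by apply: cvg_at_left_filter; exact: cH.
  - by move=> x _; rewrite derive1E; case: (dH x).
have Hb n : `|(H n.+1%:R) - (H (- n.+1%:R))| <= 2 * `|L| * phi n.+1%:R.
  have pN : phi (- n.+1%:R) = phi n.+1%:R by rewrite !phiE sqrrN.
  rewrite (le_trans (ler_normB _ _))// /H !normrN !normrM pN.
  rewrite (ger0_norm (phi_ge0 _)) -mulrDl ler_wpM2r ?phi_ge0//.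
  rewrite mulrDl mul1r lerD//; by rewrite (le_trans (hL _))// ler_norm.
have c0 : ((H n.+1%:R) - (H (- n.+1%:R))) @[n --> \oo] --> (0 : R).
  apply/norm_cvg0P; apply: (@squeeze_cvgr _ _ _ _ (cst 0) (fun n => 2 * `|L| * phi n.+1%:R)).
  - by apply: nearW => n; rewrite normr_ge0 Hb.
  - exact: cvg_cst.
  - apply: cvgr0_mull; have := phi_cvg0; rewrite -(cvg_shiftn 1); apply: cvg_trans.
    by rewrite (_ : (fun n => _) = (fun n => phi (n + 1)%:R))//; apply/funext => n; rewrite addn1.
have c1 : (\int[leb]_x ((u \_ `[(- n.+1%:R : R)%R, (n.+1%:R)%R]) x)%:E)%E @[n --> \oo] --> (\int[leb]_x (u x)%:E)%E.
  apply: (@dominated_cvg _ _ _ leb setT measurableT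
    (fun n x => ((u \_ `[(- n.+1%:R : R)%R, (n.+1%:R)%R]) x)%:E) (EFin \o u) (fun x => `|(EFin \o u) x|%E)).
  - move=> n; apply/measurable_EFinP.
    apply: (measurable_restrictT u (measurable_itv `[(- n.+1%:R : R)%R, (n.+1%:R)%R])).1.
    exact: (measurable_funTS (continuous_measurable_fun cu)).
  - move=> x _; apply: cvg_near_cst; near=> n.
    rewrite /= patchE mem_set//= in_itv/= -ler_norml.
    apply: (@le_trans _ _ n%:R); last by rewrite ler_nat.
    near: n; exists (Num.trunc `|x|).+1 => // k /= hk.
    by apply/ltW/(lt_le_trans (truncnS_gt _)); rewrite ler_nat.
  - by [].
  - exact: integrable_norm.
  - by move=> n x _; rewrite /= patchE; case: ifP => _ //; rewrite normr0 lee_fin.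
have c2 : (\int[leb]_x ((u \_ `[(- n.+1%:R : R)%R, (n.+1%:R)%R]) x)%:E)%E @[n --> \oo] --> 0%E.
  rewrite (_ : (fun n => _) = (fun n => ((H n.+1%:R) - (H (- n.+1%:R)))%:E)).
    by apply: cvg_EFin => //; apply: nearW.
  by apply/funext => n; rewrite EFinB -E [RHS]integral_mkcond restrict_EFin.
rewrite /gexp /Rintegral; rewrite (_ : \int[leb]_x _ = 0%E)%E//.
exact: cvg_unique c1 c2.
Unshelve. all: by end_near.
Qed.

Lemma gexp_ibp_affine (f1 f2 : R -> R) (L x t : R) :
  (forall x : R, is_derive x 1 f1 (f2 x)) -> continuous f2 ->
  (forall x, `|f1 x| <= L) -> (forall x, `|f2 x| <= L) ->
  gexp (fun y => y * f1 (x + t * y)) = t * gexp (fun y => f2 (x + t * y)).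
Proof.
move=> d1 c2 b1 b2.
have ca : continuous (fun y : R => x + t * y).
  move=> y; apply: cvgD; first exact: cvg_cst.
  by apply: cvgM; [exact: cvg_cst|exact: cvg_id].
have L0 : 0 <= L by apply: le_trans (b1 0).
rewrite -gexpZ; last first.
  apply: (@gint_bdd _ L) => //.
  by apply: continuous_measurable_fun => y; apply: continuous_comp; [exact: ca|exact: c2].
(* One constant has to bound both the function and its derivative, and the chain rule brings in the
   factor [t]. *)
apply: (@gaussian_ibp _ _ (L + `|t| * L)).
- move=> y; have d := d1 (x + t * y).
  have da : is_derive y 1 (fun y : R => x + t * y) t.
    by apply: is_derive_eq; rewrite /GRing.scale /=; ring.
  have dd : is_derive y 1 (f1 \o (fun y => x + t * y)) (f2 (x + t * y) * t).
    exact: is_derive1_comp.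
  by rewrite mulrC.
- move=> y; apply: cvgM; first exact: cvg_cst.
  exact: (continuous_comp (ca y) (c2 _)).
- by move=> y; rewrite (le_trans (b1 _))// lerDl mulr_ge0.
- by move=> y; rewrite normrM (@le_trans _ _ (`|t| * L))// ?ler_wpM2l// lerDr.
Qed.

(** The density has the same integrals over measurable sets as the Radon-Nikodym derivative of the
    normal law, hence agrees with it almost everywhere. *)
Lemma integral_normal_prob_density (m s : R) (g : R -> R) (M : R) :
  measurable_fun setT g -> (forall x, `|g x| <= M) ->
  (\int[normal_prob m s]_x g x = \int[leb]_x (g x * normal_pdf m s x))%R.
Proof.
move=> mg gM.
pose nu := (normal_prob m s : probability _ R).
have ig : nu.-integrable setT (EFin \o g).
  by apply: ess_bdd_integrable; split => //; exists M; apply: aeW.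
have numu : nu `<< leb by exact: normal_prob_dominates.
congr fine.
rewrite -(Radon_Nikodym_change_of_variables numu measurableT ig).
have mp : measurable_fun setT (fun x => (normal_pdf m s x)%:E).
  by apply/measurable_EFinP; exact: measurable_normal_pdf.
apply: ae_eq_integral => //.
- by apply: emeasurable_funM => //; exact/measurable_EFinP.
- apply/measurable_EFinP; apply: measurable_funM => //; exact: measurable_normal_pdf.
have : ae_eq leb setT (Radon_Nikodym (charge_of_finite_measure nu) leb) (fun x => (normal_pdf m s x)%:E).
  apply: integral_ae_eq => //.
    exact: Radon_Nikodym_integrable.
  by move=> E _ mE; rewrite -Radon_Nikodym_integral.
by apply: filterS => x h xT; rewrite /= h// EFinM.
Qed.

(** The scaling [sqrt s2 * x] makes the Dirac case and the Gaussian case one formula, continuous in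
    the variance. *)
Lemma gauss_expect_gexp (s2 : R) (g : R -> R) : 0 <= s2 -> continuous g ->
  (exists M, forall x, `|g x| <= M) ->
  gauss_expect s2 g = gexp (fun x => g (Num.sqrt s2 * x)).
Proof.
move=> s20 cg [M gM]; rewrite /gauss_expect; case: eqVneq => [->|s2n].
  rewrite sqrtr0 (_ : (fun x => _) = (fun=> g 0)) ?gexp_cst//.
  by apply/funext => x; rewrite mul0r.
have mg : measurable_fun setT g by exact: continuous_measurable_fun.
set s := Num.sqrt s2; have s0 : 0 < s by rewrite sqrtr_gt0 lt_neqAle eq_sym s2n.
have sn : s != 0 by rewrite gt_eqF.
rewrite (integral_normal_prob_density _ _ mg gM).
have dF (x : R) : is_derive x 1 (fun x : R => s * x) s.
  by apply: is_derive_eq; rewrite /GRing.scale /=; ring.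
have F'E : derive1 (fun x : R => s * x) = cst s.
  by apply/funext => x; rewrite derive1E; case: (dF x).
(* Substitution is used for nonnegative integrands; the bounded [g] is reached as the difference of
   [g + M] and [M]. *)
have key (G : R -> R) : continuous G -> (forall x, 0 <= G x) ->
    (\int[leb]_x (G x * normal_pdf 0 s x) = gexp (fun x => G (s * x)))%R.
  move=> cG G0; congr fine.
  rewrite (@increasing_ge0_integration_by_substitutionT R (fun x => s * x)
     (fun x => G x * normal_pdf 0 s x)).
  - apply: eq_integral => x _; rewrite F'E !fctE /=; congr EFin.
    rewrite /= !normal_pdfE ?oner_neq0// /normal_fun !subr0.
    have pE : normal_peak s * s = normal_peak 1.
      rewrite /normal_peak -!mulrnAr expr1n mul1r sqrtrM ?sqr_ge0// sqrtr_sqr gtr0_norm//.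
      by rewrite invfM mulrAC mulVf// mul1r.
    have eE : - (s * x) ^+ 2 / (s ^+ 2 *+ 2) = - x ^+ 2 / (1 ^+ 2 *+ 2).
      by rewrite -mulr_natr; field.
    rewrite eE -[in RHS]pE. 
    by ring.
  - by move=> x y xy; rewrite ltr_pM2l.
  - by rewrite F'E => x; exact: cvg_cst.
  - by rewrite F'E; exact: is_cvg_cst.
  - by rewrite F'E; exact: is_cvg_cst.
  - by move=> x; case: (dF x).
  - by apply/gt0_cvgMrNy => //; exact: cvg_id.
  - by apply/gt0_cvgMry => //; exact: cvg_id.
  - by move=> x; apply: cvgM; [exact: cG|exact: continuous_normal_pdf].
  - by move=> x; rewrite mulr_ge0// normal_pdf_ge0.
have cgM : continuous (fun x => g x + M) by move=> x; apply: cvgD; [exact: cg|exact: cvg_cst].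
have gM0 x : 0 <= g x + M by have /ler_normlP[] := gM x; lra.
have cst0 : continuous (fun _ : R => M) by move=> x; exact: cvg_cst.
have M0 (x : R) : 0 <= M by apply: le_trans (gM 0).
have := key _ cgM gM0; have := key _ cst0 M0.
have i1 : leb.-integrable setT (EFin \o (fun x => g x * normal_pdf 0 s x)).
  have h : leb.-integrable setT (EFin \o (fun x => M * normal_pdf 0 s x)).
    rewrite (_ : EFin \o _ = (fun x => M%:E * (normal_pdf 0 s x)%:E)%E)//.
    by apply: integrableZl => //; exact: integrable_normal_pdf.
  apply: le_integrable h => //.
    by apply/measurable_EFinP; apply: measurable_funM => //; exact: measurable_normal_pdf.
  move=> x _ /=; rewrite lee_fin !normrM ler_wpM2r//.
  by rewrite (le_trans (gM x))// ler_norm.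
have i2 : leb.-integrable setT (EFin \o (fun x => M * normal_pdf 0 s x)).
  rewrite (_ : EFin \o _ = (fun x => M%:E * (normal_pdf 0 s x)%:E)%E)//.
  by apply: integrableZl => //; exact: integrable_normal_pdf.
rewrite gexp_cst => h1.
have -> : (\int[leb]_x ((g x + M) * normal_pdf 0 s x))%R =
  (\int[leb]_x (g x * normal_pdf 0 s x))%R + (\int[leb]_x (M * normal_pdf 0 s x))%R.
  by rewrite -RintegralD//; apply: eq_Rintegral => x _; rewrite mulrDl.
rewrite h1 gexpD ?gexp_cst; last exact: gint_cst.
  by move=> /addIr.
apply: (@gint_bdd _ M) => //.
by apply: (measurableT_comp mg); exact: measurable_funM.
Qed.

End Gaussian.

(** * Smooth test functions *)

Section SmoothFunctions.
Variable R : realType.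

(** The last clause stands in for a bounded third derivative: it yields the continuity of [f2] and
    the cubic Taylor remainder. *)
Record smooth3 (f f1 f2 : R -> R) (L : R) : Prop := Smooth3 {
  smooth3_d1 : forall x : R, is_derive x 1 f (f1 x);
  smooth3_d2 : forall x : R, is_derive x 1 f1 (f2 x);
  smooth3_b0 : forall x, `|f x| <= L;
  smooth3_b1 : forall x, `|f1 x| <= L;
  smooth3_b2 : forall x, `|f2 x| <= L;
  smooth3_lip : forall x y, `|f2 (x + y) - f2 x| <= L * `|y| }.

Lemma is_derive_continuous (F F' : R -> R) :
  (forall y : R, is_derive y 1 F (F' y)) -> continuous F.
Proof.
by move=> dF x; apply/differentiable_continuous/derivable1_diffP; case: (dF x).
Qed.

(** By the mean value theorem [F y] is [y] times a value of [F'] between 0 and [y]. Iterating this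
    gives Taylor estimates without factorials. *)
Lemma mvt_growth (F F' : R -> R) (C : R) k :
  (forall y : R, is_derive y 1 F (F' y)) -> F 0 = 0 ->
  (forall y, `|F' y| <= C * `|y| ^+ k) -> forall y, `|F y| <= C * `|y| ^+ k.+1.
Proof.
move=> dF F0 hF' y.
have C0 (c : R) : 0 <= C * `|c| ^+ k by apply: le_trans (hF' c).
have Cp : 0 <= C by have := C0 1; rewrite normr1 expr1n mulr1.
have cF := is_derive_continuous dF.
have key (c : R) : `|c| <= `|y| -> `|F' c * y| <= C * `|y| ^+ k.+1.
  move=> cy; rewrite normrM exprSr mulrA ler_wpM2r// (le_trans (hF' c))//.
  by rewrite ler_wpM2l// lerXn2r ?nnegrE.
have [y0|y0] := leP 0 y.
  have [c] := MVT_segment y0 (fun x _ => dF x) (continuous_subspaceT cF).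
  rewrite in_itv/= => /andP[c0 cy]; rewrite F0 !subr0 => ->.
  by apply: key; rewrite !ger0_norm.
have [c] := MVT_segment (ltW y0) (fun x _ => dF x) (continuous_subspaceT cF).
rewrite in_itv/= => /andP[c0 cy]; rewrite F0 !sub0r mulrN => /eqP.
rewrite eqr_opp => /eqP ->.
by apply: key; rewrite !ler0_norm ?lerN2// ltW.
Qed.

Section Taylor.
Variables (f f1 f2 : R -> R) (L : R).
Hypothesis hf : smooth3 f f1 f2 L.

Let d1 := smooth3_d1 hf.
Let d2 := smooth3_d2 hf.

Lemma smooth3_L0 : 0 <= L. Proof. exact: le_trans (smooth3_b0 hf 0). Qed.

Lemma smooth3_c2 : continuous f2.
Proof.
have L1 : 0 < L + 1 by rewrite ltr_wpDl// smooth3_L0.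
move=> x; apply/cvgrPdist_le => e e0; near=> y.
have := smooth3_lip hf x (y - x); rewrite subrKC distrC => /le_trans; apply.
apply: (@le_trans _ _ ((L + 1) * `|y - x|)); first by rewrite ler_wpM2r// lerDl.
rewrite -ler_pdivlMl// distrC; near: y.
apply/nbhs_ballP; exists ((L + 1)^-1 * e); first by apply: mulr_gt0; rewrite ?invr_gt0.
by move=> z /ltW.
Unshelve. all: by end_near.
Qed.

Let shift (g g' : R -> R) (x y : R) : (forall x : R, is_derive x 1 g (g' x)) ->
  is_derive y 1 (fun y : R => g (x + y)) (g' (x + y)).
Proof.
move=> dg; have da : is_derive y 1 (fun y : R => x + y) 1.
  have : is_derive y 1 (cst x + id) (0 + 1) by exact: is_deriveD.
  by rewrite add0r.
have : is_derive y 1 (g \o (fun y => x + y)) (g' (x + y) * 1) by exact: is_derive1_comp.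
by rewrite mulr1.
Qed.

Lemma lipschitz0 x y : `|f (x + y) - f x| <= L * `|y|.
Proof.
have := @mvt_growth (fun y => f (x + y) - f x) (fun y => f1 (x + y)) L 0 _ _ _ y.
rewrite expr1; apply.
- by move=> z; have h := shift x z d1; apply: is_derive_eq; rewrite subr0.
- by rewrite addr0 subrr.
- by move=> z; rewrite expr0 mulr1; exact: smooth3_b1 hf _.
Qed.

Lemma lipschitz1 x y : `|f1 (x + y) - f1 x| <= L * `|y|.
Proof.
have := @mvt_growth (fun y => f1 (x + y) - f1 x) (fun y => f2 (x + y)) L 0 _ _ _ y.
rewrite expr1; apply.
- by move=> z; have h := shift x z d2; apply: is_derive_eq; rewrite subr0.
- by rewrite addr0 subrr.
- by move=> z; rewrite expr0 mulr1; exact: smooth3_b2 hf _.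
Qed.

Lemma taylor_f_1 x y : `|f (x + y) - f x - y * f1 x| <= L * `|y| ^+ 2.
Proof.
apply: (@mvt_growth (fun y => f (x + y) - f x - y * f1 x) (fun y => f1 (x + y) - f1 x) L 1).
- by move=> z; have h := shift x z d1; apply: is_derive_eq; rewrite /GRing.scale /=; ring.
- by rewrite addr0; ring.
- by move=> z; rewrite expr1; exact: lipschitz1.
Qed.

Lemma taylor_f1_1 x y : `|f1 (x + y) - f1 x - y * f2 x| <= L * `|y| ^+ 2.
Proof.
apply: (@mvt_growth (fun y => f1 (x + y) - f1 x - y * f2 x) (fun y => f2 (x + y) - f2 x) L 1).
- by move=> z; have h := shift x z d2; apply: is_derive_eq; rewrite /GRing.scale /=; ring.
- by rewrite addr0; ring.
- by move=> z; rewrite expr1; exact: smooth3_lip hf _ _.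
Qed.

Lemma taylor_f_2 x y :
  `|f (x + y) - f x - y * f1 x - 2^-1 * y ^+ 2 * f2 x| <= L * `|y| ^+ 3.
Proof.
apply: (@mvt_growth (fun y => f (x + y) - f x - y * f1 x - 2^-1 * y ^+ 2 * f2 x)
   (fun y => f1 (x + y) - f1 x - y * f2 x) L 2).
- by move=> z; have h := shift x z d1; apply: is_derive_eq; rewrite /GRing.scale /=; field.
- by rewrite addr0; ring.
- by move=> z; exact: taylor_f1_1.
Qed.

End Taylor.

(** It solves [s' = s (1 - s)], so all derivatives are bounded polynomials in it, and it tends to
    its limits 0 and 1 at least as fast as [1 / |x|]. *)
Definition logistic (x : R) : R := (1 + expR (- x))^-1.

Lemma logistic_den_gt0 (x : R) : 0 < 1 + expR (- x). Proof. by rewrite addr_gt0// expR_gt0. Qed.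

Lemma logistic_gt0 x : 0 < logistic x.
Proof. by rewrite invr_gt0 logistic_den_gt0. Qed.

Lemma logistic_lt1 x : logistic x < 1.
Proof. by rewrite invf_lt1 ?logistic_den_gt0// ltrDl expR_gt0. Qed.

Lemma logistic_homo x y : x <= y -> logistic x <= logistic y.
Proof.
by move=> xy; rewrite lef_pV2 ?posrE ?logistic_den_gt0// lerD2l ler_expR lerN2.
Qed.

Lemma logistic_left x : x < 0 -> logistic x <= (- x)^-1.
Proof.
move=> x0; rewrite lef_pV2 ?posrE ?logistic_den_gt0// ?oppr_gt0//.
by have := @expR_ge1Dx R (- x); lra.
Qed.

Lemma logistic_right x : 0 < x -> 1 - logistic x <= x^-1.
Proof.
move=> x0; have -> : 1 - logistic x = expR (- x) * logistic x.
  rewrite /logistic; field; rewrite gt_eqF//; exact: logistic_den_gt0.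
apply: (@le_trans _ _ (expR (- x))).
  by rewrite ler_piMr ?expR_ge0// ltW// logistic_lt1.
rewrite expRN lef_pV2 ?posrE ?expR_gt0//.
by have := @expR_ge1Dx R x; lra.
Qed.

Lemma is_derive_logistic (x : R) :
  is_derive x 1 logistic (logistic x * (1 - logistic x)).
Proof.
have h : is_derive x 1 (fun x => 1 + expR (- x) : R) (- expR (- x)).
  apply: is_derive_eq; rewrite /GRing.scale /=; ring.
have n0 : 1 + expR (- x) != 0 by rewrite gt_eqF// logistic_den_gt0.
have d := @is_deriveV R (fun y => 1 + expR (- y)) x _ _ n0 h.
have -> : logistic x * (1 - logistic x) = - (1 + expR (- x)) ^- 2 *: (- expR (- x)).
  by rewrite /logistic /GRing.scale /=; field.
exact: d.
Qed.

(** With [q = s (1 - s)] the derivatives are [a q], [a^2 q (1 - 2 s)] and [a^3 q (1 - 6 q)]; as [q]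
    lies in [[0, 1/4]], the polynomial factors are bounded by 1. *)
Lemma smooth3_logistic (a c : R) : exists f1 f2 L,
  smooth3 (fun x => logistic (a * (x - c))) f1 f2 L.
Proof.
pose s x := logistic (a * (x - c)).
have s01 x : 0 < s x < 1 by rewrite logistic_gt0 logistic_lt1.
have ds (x : R) : is_derive x 1 s (a * (s x * (1 - s x))).
  have da : is_derive x 1 (fun x : R => a * (x - c)) a.
    by apply: is_derive_eq; rewrite /GRing.scale /=; ring.
  have dl := is_derive_logistic (a * (x - c)).
  have : is_derive x 1 (logistic \o (fun x => a * (x - c)))
    (logistic (a * (x - c)) * (1 - logistic (a * (x - c))) * a) by exact: is_derive1_comp.
  by rewrite mulrC.
pose f1 x := a * (s x * (1 - s x)).
pose f2 x := a ^+ 2 * (s x * (1 - s x) * (1 - 2 * s x)).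
pose f3 x := a ^+ 3 * (s x * (1 - s x) * (1 - 6 * (s x * (1 - s x)))).
pose L := 1 + `|a| + `|a| ^+ 2 + `|a| ^+ 3.
have a0 : 0 <= `|a| by [].
have a2 : 0 <= `|a| ^+ 2 by rewrite exprn_ge0.
have a3 : 0 <= `|a| ^+ 3 by rewrite exprn_ge0.
have d1 (x : R) : is_derive x 1 f1 (f2 x).
  have := ds x => dsx; apply: is_derive_eq; rewrite /GRing.scale /= /f2; ring.
have d2 (x : R) : is_derive x 1 f2 (f3 x).
  have := ds x => dsx; apply: is_derive_eq; rewrite /GRing.scale /= /f3; ring.
have b k (p : R) : `|p| <= 1 -> `|a ^+ k * p| <= `|a| ^+ k.
  by move=> p1; rewrite normrM normrX ler_piMr// exprn_ge0.
exists f1, f2, L; split => //.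
- by move=> x; have /andP[h1 h2] := s01 x; rewrite ger0_norm ?(ltW h1)// /L; move: (ltW h2); rewrite /s; lra.
- move=> x; have /andP[h1 h2] := s01 x.
  apply: (@le_trans _ _ (`|a| ^+ 1)); last by rewrite expr1 /L; lra.
  apply: (b 1%N); rewrite ler_norml; apply/andP; split; nra.
- move=> x; have /andP[h1 h2] := s01 x.
  apply: (@le_trans _ _ (`|a| ^+ 2)); last by rewrite /L; lra.
  have q0 : 0 <= s x * (1 - s x) <= 1 by apply/andP; split; nra.
  apply: b; move: q0; set q := s x * (1 - s x) => /andP[q0 q1].
  by rewrite normrM mulr_ile1// ler_norml; apply/andP; split; lra.
- move=> x y; have := @mvt_growth (fun y => f2 (x + y) - f2 x) (fun y => f3 (x + y)) L 0 _ _ _ y.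
  rewrite expr1; apply.
  + move=> z; have da : is_derive z 1 (fun y : R => x + y) 1.
      have : is_derive z 1 (cst x + id) (0 + 1) by exact: is_deriveD.
      by rewrite add0r.
    have h : is_derive z 1 (f2 \o (fun y => x + y)) (f3 (x + z) * 1).
      by apply: is_derive1_comp.
    rewrite mulr1 in h.
    have : is_derive z 1 ((f2 \o (fun y => x + y)) - cst (f2 x)) (f3 (x + z) - 0) by exact: is_deriveB.
    by rewrite subr0.
  + by rewrite addr0 subrr.
  + move=> z; rewrite expr0 mulr1; have /andP[h1 h2] := s01 (x + z).
    apply: (@le_trans _ _ (`|a| ^+ 3)); last by rewrite /L; lra.
    rewrite /f3; apply: b.
    have q0 : 0 <= s (x + z) * (1 - s (x + z)) <= 4^-1.
      by apply/andP; split; [nra|have := sqr_ge0 (s (x + z) - 2^-1); nra].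
    move: q0; set q := s (x + z) * (1 - s (x + z)) => /andP[q0 q1].
    by rewrite ler_norml; apply/andP; split; nra.
Qed.

End SmoothFunctions.

(** * From logistic to bounded continuous test functions *)

Section Portmanteau.
Variable R : realType.

Definition bcont (f : R -> R) := continuous f /\ exists M, forall x, `|f x| <= M.

(* Expectations under laws whose second moment is at most [V]; the last clause
   also expresses tightness. *)
Record law (E : (R -> R) -> R) (V : R) : Prop := Law {
  lawD : forall f g, bcont f -> bcont g -> E (fun x => f x + g x) = E f + E g;
  lawZ : forall c f, bcont f -> E (fun x => c * f x) = c * E f;
  law_cst : forall c, E (fun=> c) = c;
  law_dist : forall f g e c, bcont f -> bcont g -> 0 <= e -> 0 <= c ->
    (forall x, `|f x - g x| <= e + c * x ^+ 2) -> `|E f - E g| <= e + c * V }.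

Lemma bcont_cst c : bcont (fun=> c).
Proof. by split; [move=> x; exact: cvg_cst|exists `|c|]. Qed.

Lemma bcontD f g : bcont f -> bcont g -> bcont (fun x => f x + g x).
Proof.
move=> [cf [M hM]] [cg [N hN]]; split; first by move=> x; apply: cvgD; [exact: cf|exact: cg].
by exists (M + N) => x; rewrite (le_trans (ler_normD _ _))// lerD.
Qed.

Lemma bcontZ c f : bcont f -> bcont (fun x => c * f x).
Proof.
move=> [cf [M hM]]; split; first by move=> x; apply: cvgM; [exact: cvg_cst|exact: cf].
by exists (`|c| * M) => x; rewrite normrM ler_wpM2l.
Qed.

Lemma bcont_sum (I : Type) (r : seq I) (f : I -> R -> R) :
  (forall i, bcont (f i)) -> bcont (fun x => \sum_(i <- r) f i x).
Proof.
move=> hf; elim: r => [|i r IH].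
  by under eq_fun do rewrite big_nil; exact: bcont_cst.
by under eq_fun do rewrite big_cons; exact: bcontD.
Qed.

Lemma bcont_logistic a c : bcont (fun x => logistic (a * (x - c))).
Proof.
have [f1 [f2 [L h]]] := smooth3_logistic a c; split; last first.
  by exists L; exact: smooth3_b0 h.
exact: is_derive_continuous (smooth3_d1 h).
Qed.

Lemma law_sum E V (I : Type) (r : seq I) (f : I -> R -> R) : law E V ->
  (forall i, bcont (f i)) ->
  E (fun x => \sum_(i <- r) f i x) = \sum_(i <- r) E (f i).
Proof.
move=> hE hf; elim: r => [|i r IH].
  by under eq_fun do rewrite big_nil; rewrite big_nil (law_cst hE).
under eq_fun do rewrite big_cons.
by rewrite big_cons (lawD hE)// ?IH//; exact: bcont_sum.
Qed.

(** Heine-Cantor through the near-covering form of compactness; only [x] is confined to the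
    segment. *)
Lemma unif_continuous_segment (g : R -> R) (K w : R) : continuous g -> 0 < w ->
  exists2 e, 0 < e & forall x y, -K <= x <= K -> `|x - y| <= e -> `|g x - g y| <= w.
Proof.
move=> cg w0; have w2 : 0 < w / 2 by rewrite divr_gt0.
have /compact_near_coveringP/near_covering_withinP h := @segment_compact R (-K) K.
have := h _ (0 : R)^'+ (fun e x => forall y, `|x - y| <= e -> `|g x - g y| <= w).
move=> /(_ _ _)[].
- move=> x _; have /cvgrPdist_le/(_ _ w2)/nbhs_ballP[d /= d0 hd] := cg x.
  exists ([set z | `|x - z| < d / 2], [set e | e < d / 2]) => /=.
    split; first by apply/nbhs_ballP; exists (d / 2) => //=; rewrite divr_gt0.
    by apply: nbhs_right_lt; rewrite divr_gt0.
  move=> [z e] /= [zd ed] _ y ze.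
  have h1 : `|g x - g z| <= w / 2.
    by apply: hd; rewrite /ball/= (lt_le_trans zd)// ler_pdivrMr//; lra.
  have h2 : `|g x - g y| <= w / 2.
    apply: hd; rewrite /ball/=.
    have -> : x - y = (x - z) + (z - y) by ring.
    by rewrite (le_lt_trans (ler_normD _ _))//; lra.
  have -> : g z - g y = - (g x - g z) + (g x - g y) by ring.
  by rewrite (le_trans (ler_normD _ _))// normrN; lra.
move=> d /= d0 hd; exists (d / 2); first by rewrite divr_gt0.
move=> x y xK xy; apply: (hd (d / 2)) => //=.
- rewrite sub0r normrN ger0_norm; last by rewrite ltW// divr_gt0.
  by rewrite ltr_pdivrMr//; lra.
- by rewrite divr_gt0.
Qed.

(* Abel summation: [a 0 + sum (a i.+1 - a i) h i] is a convex combination of the [a i]. *)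
Lemma abel_bound n (a h : nat -> R) (M : R) : (forall i, `|a i| <= M) ->
  (forall i, 0 <= h i <= 1) -> (forall i, h i.+1 <= h i) ->
  `|a 0%N + \sum_(i < n) (a i.+1 - a i) * h i| <= M.
Proof.
move=> aM h01 hd.
pose H i := if i is j.+1 then h j else 1.
have H01 i : 0 <= H i <= 1 by case: i => [|i]; rewrite ?ler01 ?lexx// h01.
have Hd i : H i.+1 <= H i by case: i => [|i] /=; [have /andP[] := h01 0%N|].
have key : `|a 0%N + \sum_(i < n) (a i.+1 - a i) * h i - a n * H n| <= M * (1 - H n).
  elim: n => [|n IH]; first by rewrite big_ord0 addr0 /= mulr1 !subrr mulr0 normr0.
  rewrite big_ord_recr/=.
  have -> : a 0%N + (\sum_(i < n) (a i.+1 - a i) * h i + (a n.+1 - a n) * h n) - a n.+1 * h n =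
    (a 0%N + \sum_(i < n) (a i.+1 - a i) * h i - a n * H n) + a n * (H n - h n) by ring.
  rewrite (le_trans (ler_normD _ _))//.
  have -> : M * (1 - h n) = M * (1 - H n) + M * (H n - h n) by ring.
  rewrite lerD// normrM (ger0_norm (_ : 0 <= H n - h n)) ?subr_ge0 ?(Hd n)//.
  by rewrite ler_wpM2r// subr_ge0 (Hd n).
set S := a 0%N + _ in key *.
have -> : S = (S - a n * H n) + a n * H n by ring.
rewrite (le_trans (ler_normD _ _))//.
have -> : M = M * (1 - H n) + M * H n by ring.
have /andP[Hn0 _] := H01 n.
by rewrite lerD// normrM (ger0_norm Hn0) ler_wpM2r.
Qed.

(** A staircase through the values of [g] on a grid, each jump smoothed by a steep logistic. Abel
    summation keeps the result bounded by [M] on the whole line, so the region outside the segment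
    can later be left to the second moment. *)
Lemma logistic_approx (g : R -> R) (M K e : R) : continuous g ->
  (forall x, `|g x| <= M) -> 0 < K -> 0 < e ->
  exists n (a : R) (c x : nat -> R),
   let f := fun y => g (- K) + \sum_(i < n) c i * logistic (a * (y - x i)) in
   (forall y, `|f y| <= M) /\ (forall y, - K <= y <= K -> `|g y - f y| <= e).
Proof.
move=> cg gM K0 e0; have w0 : 0 < e / 4 by rewrite divr_gt0.
have [d d0 hd] := unif_continuous_segment K cg w0.
set w := e / 4 in w0 hd.
pose N := (Num.trunc (2 * K / d)).+1.
have N0 : (0 : R) < N%:R by rewrite ltr0n.
pose h := 2 * K / N%:R.
have h0 : 0 < h by rewrite divr_gt0// mulr_gt0.
have hd' : h <= d.
  rewrite /h ler_pdivrMr// [d * _]mulrC -ler_pdivrMr//; apply/ltW; exact: truncnS_gt.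
have hN : N%:R * h = 2 * K by rewrite /h mulrC divfK// gt_eqF.
pose x i : R := - K + i%:R * h.
(* With this steepness a logistic at distance at least [h] from its centre is within [1 / N] of its
   limit. *)
pose a := N%:R / h.
have a0 : 0 < a by rewrite divr_gt0.
pose c i := g (x i.+1) - g (x i).
have xS i : x i.+1 = x i + h by rewrite /x -natr1; ring.
exists N, a, c, x; split=> [y|y /andP[y1 y2]].
  have -> : g (- K) = g (x 0%N) by rewrite /x mul0r addr0.
  apply: (@abel_bound N (fun i => g (x i)) (fun i => logistic (a * (y - x i)))) => //.
    by move=> i; rewrite (ltW (logistic_gt0 _)) (ltW (logistic_lt1 _)).
  by move=> i; apply: logistic_homo; rewrite ler_wpM2l ?(ltW a0)// xS; lra.
pose j := Num.trunc ((y + K) / h).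
have q0 : 0 <= (y + K) / h by rewrite divr_ge0 ?(ltW h0)//; lra.
have /andP[j1 j2] : x j <= y < x j + h.
  have /andP[t1 t2] := truncn_itv q0.
  rewrite ler_pdivlMr// in t1; rewrite ltr_pdivrMr// -natr1 in t2.
  by rewrite /x /j; apply/andP; split; lra.
have jN : (j <= N)%N.
  rewrite -(ler_nat R) -(ler_pM2r h0) hN; move: j1; rewrite /x; lra.
have xK i : (i <= N)%N -> - K <= x i <= K.
  move=> iN; have : (i%:R : R) * h <= N%:R * h by rewrite ler_wpM2r ?(ltW h0)// ler_nat.
  have : 0 <= (i%:R : R) * h by rewrite mulr_ge0// ltW.
  by rewrite hN /x => h1 h2; apply/andP; split; lra.
have cw i : (i < N)%N -> `|c i| <= w.
  move=> iN; rewrite /c; apply: hd; first exact: xK.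
  by rewrite xS addrAC subrr add0r ger0_norm// ltW.
have xlt i k : (i <= k)%N -> x i <= x k.
  by move=> ik; rewrite lerD2l ler_wpM2r ?(ltW h0)// ler_nat.
have ah t : h <= t -> (a * t)^-1 <= N%:R^-1.
  move=> ht; have t0 : 0 < t by apply: lt_le_trans ht.
  rewrite lef_pV2 ?posrE//; last exact: mulr_gt0.
  by rewrite /a mulrAC ler_pdivlMr// ler_wpM2l// ltW.
have tel : g (x j) - g (- K) = \sum_(i < N) c i * (i < j)%N%:R.
  rewrite (eq_bigr (fun i : 'I_N => if (i < j)%N then c i else 0)) => [|i _]; last first.
    by case: ifP => _; rewrite ?mulr1 ?mulr0.
  rewrite -big_mkcond -(big_ord_widen N c jN) -(big_mkord xpredT c).
  by rewrite telescope_sumr//= /x mul0r addr0.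
have -> : g y - (g (- K) + \sum_(i < N) c i * logistic (a * (y - x i))) =
  - (g (x j) - g y) + \sum_(i < N) c i * ((i < j)%N%:R - logistic (a * (y - x i))).
  under [X in _ = _ + X]eq_bigr do rewrite mulrBr.
  by rewrite sumrB -tel; ring.
have g1 : `|g (x j) - g y| <= w.
  apply: hd; first exact: xK.
  by rewrite distrC ger0_norm; lra.
(* Only the jumps [j] and [j + 1] next to [y] may err by 1; all others err by at most [1 / N]. The
   total is at most [3 w], and the oscillation of [g] within a cell brings it to [4 w = e]. *)
have term i : (i < N)%N -> `|c i * ((i < j)%N%:R - logistic (a * (y - x i)))| <=
   w * (N%:R^-1 + (i == j)%:R + (i == j.+1)%:R).
  move=> iN; rewrite normrM ler_pM//; first exact: cw.
  have l0 := logistic_gt0 (a * (y - x i)); have l1 := logistic_lt1 (a * (y - x i)).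
  have Ni : 0 <= N%:R^-1 :> R by rewrite invr_ge0 ltW.
  have [ij|ji] := ltnP i j.
    rewrite /= ger0_norm ?subr_ge0 ?(ltW l1)//.
    have hx : h <= y - x i by have := xlt _ _ ij; rewrite xS; lra.
    apply: (@le_trans _ _ N%:R^-1); last by rewrite -addrA lerDl addr_ge0.
    apply: le_trans (ah _ hx); apply: logistic_right.
    by rewrite mulr_gt0// (lt_le_trans h0).
  rewrite sub0r normrN (ger0_norm (ltW l0)).
  have p1 : 0 <= (i == j.+1)%:R :> R by [].
  have [ij'|nij] := boolP (i == j); first by rewrite mulr1n; lra.
  have [ij'|nij'] := boolP (i == j.+1); first by rewrite mulr0n mulr1n; lra.
  rewrite /= !addr0.
  have ij2 : (j.+2 <= i)%N by rewrite ltn_neqAle eq_sym nij' ltn_neqAle eq_sym nij ji.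
  have hx : h <= x i - y by have := xlt _ _ ij2; rewrite !xS; lra.
  apply: le_trans (ah _ hx).
  have -> : a * (x i - y) = - (a * (y - x i)) by ring.
  apply: logistic_left; rewrite pmulr_rlt0//; lra.
have sum1 k : \sum_(i < N) ((i : nat) == k)%:R <= 1 :> R.
  have [kN|kN] := ltnP k N.
    rewrite (bigD1 (Ordinal kN))//= eqxx big1 ?addr0// => i /negbTE.
    by rewrite -val_eqE /= => ->.
  by rewrite big1 ?ler01// => i _; case: eqP => // ik; have := ltn_ord i; rewrite ik ltnNge kN.
have sumb : `|\sum_(i < N) c i * ((i < j)%N%:R - logistic (a * (y - x i)))| <= w * 3.
  apply: (le_trans (ler_norm_sum _ _ _)).
  apply: (@le_trans _ _ (\sum_(i < N) w * (N%:R^-1 + ((i : nat) == j)%:R + ((i : nat) == j.+1)%:R))).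
    by apply: ler_sum => i _; apply: term.
  rewrite -mulr_sumr ler_wpM2l ?(ltW w0)// !big_split/=.
  rewrite sumr_const card_ord -[_ *+ N]mulr_natr mulVf ?gt_eqF//.
  by have := sum1 j; have := sum1 j.+1; lra.
rewrite (le_trans (ler_normD _ _))// normrN.
have -> : e = w + w * 3 by rewrite /w; field.
exact: lerD.
Qed.

Lemma cvgr_sum (I : Type) (r : seq I) (u : I -> nat -> R) (l : I -> R) :
  (forall i, u i @ \oo --> l i) ->
  (fun n => \sum_(i <- r) u i n) @ \oo --> \sum_(i <- r) l i.
Proof.
move=> hu; elim: r => [|i r IH].
  by rewrite big_nil; under eq_fun do rewrite big_nil; exact: cvg_cst.
by rewrite big_cons; under eq_fun do rewrite big_cons; apply: cvgD.
Qed.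

Lemma portmanteau (E : nat -> (R -> R) -> R) (E0 : (R -> R) -> R) (V : R) :
  (forall n, law (E n) V) -> law E0 V ->
  (forall a c, (fun n => E n (fun x => logistic (a * (x - c)))) @ \oo -->
     E0 (fun x => logistic (a * (x - c)))) ->
  forall g, bcont g -> (fun n => E n g) @ \oo --> E0 g.
Proof.
move=> hE hE0 hlog g bg; have [cg [M gM]] := bg.
have M0 : 0 <= M by apply: le_trans (gM 0).
(* [law] does not list this; it follows from [law_dist] with zero functions, [e = 0] and [c = 1]. *)
have V0 : 0 <= V.
  have := law_dist hE0 (bcont_cst 0) (bcont_cst 0) (lexx 0) ler01.
  rewrite !subrr normr0 mul1r add0r; apply => x.
  by rewrite ?subrr ?normr0 ?add0r ?mul1r sqr_ge0.
apply/cvgrPdist_le => e e0.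
have e4 : 0 < e / 5 by rewrite divr_gt0.
pose B := 2 * M * V + 1.
have B0 : 0 < B by rewrite ltr_wpDl// !mulr_ge0.
(* Outside [[- K, K]] the error is at most [2 M], hence [2 M / K^2] times the square. This choice
   gives [2 M V <= (e / 5) K <= (e / 5) K^2]. *)
pose K := 1 + B / (e / 5).
have K0 : 0 < K by rewrite addr_gt0// divr_gt0.
have [n [a [c [x [fM fg]]]]] := logistic_approx cg gM K0 e4.
pose f y := g (- K) + \sum_(i < n) c i * logistic (a * (y - x i)).
have {}fM : forall y, `|f y| <= M := fM.
have {}fg : forall y, - K <= y <= K -> `|g y - f y| <= e / 5 := fg.
have bt i : bcont (fun y => c i * logistic (a * (y - x i))) by apply/bcontZ/bcont_logistic.
have bf : bcont f by apply: bcontD; [exact: bcont_cst|exact: bcont_sum].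
have Ef F : law F V -> F f = g (- K) + \sum_(i < n) c i * F (fun y => logistic (a * (y - x i))).
  move=> hF; rewrite (lawD hF) ?(law_cst hF); [|exact: bcont_cst|exact: bcont_sum].
  rewrite (law_sum _ hF) => [|i]; last exact: bt.
  by congr (_ + _); apply: eq_bigr => i _; rewrite (lawZ hF)//; exact: bcont_logistic.
have dist F : law F V -> `|F g - F f| <= 2 * (e / 5).
  move=> hF; have K2 : 0 < K ^+ 2 by rewrite exprn_gt0.
  have c0 : 0 <= 2 * M / K ^+ 2 by rewrite divr_ge0 ?mulr_ge0// ltW.
  apply: (@le_trans _ _ (e / 5 + 2 * M / K ^+ 2 * V)).
    apply: (law_dist hF) => //; first exact: ltW.
    move=> y; have [yK|yK] := leP `|y| K.
      apply: (@le_trans _ _ (e / 5)); first by apply: fg; rewrite -ler_norml.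
      by rewrite lerDl mulr_ge0// sqr_ge0.
    apply: (@le_trans _ _ (2 * M)).
      by rewrite (le_trans (ler_normB _ _))//; have := gM y; have := fM y; lra.
    have : 2 * M <= 2 * M / K ^+ 2 * y ^+ 2.
      rewrite mulrAC ler_pdivlMr// ler_wpM2l ?mulr_ge0//.
      by rewrite -[y ^+ 2]real_normK ?num_real// lerXn2r ?nnegrE// ltW.
    by move=> h; apply: (le_trans h); rewrite lerDr ltW.
  suff : 2 * M / K ^+ 2 * V <= e / 5 by lra.
  rewrite mulrAC ler_pdivrMr//.
  have h1 : 2 * M * V <= B by rewrite /B; lra.
  have h2 : B <= e / 5 * K by rewrite /K mulrDr mulrCA divff ?gt_eqF// mulr1 mulr1; lra.
  have K1 : 1 <= K by rewrite /K lerDl ltW// divr_gt0.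
  apply: (le_trans h1); apply: (le_trans h2).
  by rewrite ler_wpM2l ?(ltW e4)// expr2 ler_peMr// ltW.
have cf : (fun k => E k f) @ \oo --> E0 f.
  rewrite (Ef E0 hE0) (_ : (fun k => E k f) =
    (fun k => g (- K) + \sum_(i < n) c i * E k (fun y => logistic (a * (y - x i))))); last first.
    by apply/funext => k; rewrite (Ef (E k) (hE k)).
  apply: cvgD; first exact: cvg_cst.
  apply: cvgr_sum => i; apply: cvgM; [exact: cvg_cst|exact: hlog].
near=> k.
have hk : `|E0 f - E k f| <= e / 5 by near: k; move/cvgrPdist_le : cf; exact.
have := dist _ (hE k); have := dist _ hE0 => h1 h2.
have -> : E0 g - E k g = (E0 g - E0 f) + (E0 f - E k f) - (E k g - E k f) by ring.
rewrite (le_trans (ler_normB _ _))//.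
have := ler_normD (E0 g - E0 f) (E0 f - E k f); lra.
Unshelve. all: by end_near.
Qed.

End Portmanteau.

(** * Lindeberg replacement *)

Section ExpectationFunctional.
Variables (R : realType) (W : Type) (E : (W -> R) -> R).

(** No proviso on the functions: on words of a fixed length every function has finitely many values,
    so annealed expectations obey these rules without exception. *)
Record is_expectation : Prop := IsExpectation {
  exD : forall f g, E (fun w => f w + g w) = E f + E g;
  exZ : forall c f, E (fun w => c * f w) = c * E f;
  ex_ge0 : forall f, (forall w, 0 <= f w) -> 0 <= E f;
  ex_cst : forall c, E (fun=> c) = c }.

Hypothesis hE : is_expectation.

Lemma exB f g : E (fun w => f w - g w) = E f - E g.
Proof.
rewrite -[in RHS]mulN1r -(exZ hE) -(exD hE).
by congr E; apply/funext => w; rewrite mulN1r.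
Qed.

Lemma ex_le f g : (forall w, f w <= g w) -> E f <= E g.
Proof. by move=> h; rewrite -subr_ge0 -exB; apply: (ex_ge0 hE) => w; rewrite subr_ge0. Qed.

Lemma ex_norm f g : (forall w, `|f w| <= g w) -> `|E f| <= E g.
Proof.
move=> h; rewrite ler_norml; apply/andP; split.
  rewrite -mulN1r -(exZ hE); apply: ex_le => w.
  by have := h w; rewrite ler_norml mulN1r => /andP[].
by apply: ex_le => w; have := h w; rewrite ler_norml => /andP[].
Qed.

Lemma ex_sum (I : Type) (r : seq I) (P : pred I) (f : I -> W -> R) :
  E (fun w => \sum_(i <- r | P i) f i w) = \sum_(i <- r | P i) E (f i).
Proof.
elim: r => [|i r IH].
  by under eq_fun do rewrite big_nil; rewrite big_nil (ex_cst hE).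
under eq_fun do rewrite big_cons.
rewrite big_cons; case: ifP => // _.
by rewrite (exD hE) IH.
Qed.

End ExpectationFunctional.

Section Lindeberg.
Variables (R : realType) (f f1 f2 : R -> R) (L : R).
Hypotheses (hf : smooth3 f f1 f2 L) (L0 : 0 < L).

(** The Gaussians replacing the later blocks are integrated out here; [t] is their joint standard
    deviation. [U1] and [U2] take the part of the space derivatives of this smoothing. *)
Let U0 t x := gexp (fun z : R => f (x + t * z)).
Let U1 t x := gexp (fun z : R => f1 (x + t * z)).
Let U2 t x := gexp (fun z : R => f2 (x + t * z)).
Let m2 := gexp (fun z : R => z ^+ 2).

Let caff (t x : R) : continuous (fun z : R => x + t * z).
Proof.
move=> z; apply: cvgD; first exact: cvg_cst.
by apply: cvgM; [exact: cvg_cst|exact: cvg_id].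
Qed.

Let meas_aff (g : R -> R) t x : continuous g -> measurable_fun setT (fun z : R => g (x + t * z)).
Proof.
move=> cg; apply: continuous_measurable_fun => z.
by apply: continuous_comp; [exact: caff|exact: cg].
Qed.

Let cf : continuous f. Proof. exact: is_derive_continuous (smooth3_d1 hf). Qed.
Let cf1 : continuous f1. Proof. exact: is_derive_continuous (smooth3_d2 hf). Qed.
Let cf2 : continuous f2. Proof. exact: smooth3_c2 hf. Qed.

Let i0 t x : gint (fun z : R => f (x + t * z)).
Proof. by apply: (@gint_bdd _ _ L); [exact: meas_aff|move=> z; exact: smooth3_b0 hf _]. Qed.
Let i1 t x : gint (fun z : R => f1 (x + t * z)).
Proof. by apply: (@gint_bdd _ _ L); [exact: meas_aff|move=> z; exact: smooth3_b1 hf _]. Qed.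
Let i2 t x : gint (fun z : R => f2 (x + t * z)).
Proof. by apply: (@gint_bdd _ _ L); [exact: meas_aff|move=> z; exact: smooth3_b2 hf _]. Qed.

Let U1b t x : `|U1 t x| <= L.
Proof. by apply: gexp_bound; [exact: meas_aff|move=> z; exact: smooth3_b1 hf _]. Qed.
Let U2b t x : `|U2 t x| <= L.
Proof. by apply: gexp_bound; [exact: meas_aff|move=> z; exact: smooth3_b2 hf _]. Qed.

Lemma gexp_sqr_ge0 : 0 <= m2.
Proof. by apply: gexp_ge0 => z; exact: sqr_ge0. Qed.

Lemma heat_space t x y :
  `|U0 t (x + y) - (U0 t x + y * U1 t x + 2^-1 * y ^+ 2 * U2 t x)| <= L * `|y| ^+ 3.
Proof.
have h1 : gint (fun z => y * f1 (x + t * z)) by exact: gintZ.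
have h2 : gint (fun z => 2^-1 * y ^+ 2 * f2 (x + t * z)) by exact: gintZ.
have h3 : gint (fun z => f (x + t * z) + y * f1 (x + t * z)) by exact: gintD.
have -> : U0 t x + y * U1 t x + 2^-1 * y ^+ 2 * U2 t x =
    gexp (fun z => f (x + t * z) + y * f1 (x + t * z) + 2^-1 * y ^+ 2 * f2 (x + t * z)).
  by rewrite gexpD// gexpD// !gexpZ.
rewrite -[leRHS]gexp_cst; apply: gexp_dist_le => //.
- exact: gintD.
- exact: gint_cst.
move=> z; have := taylor_f_2 hf (x + t * z) y.
by rewrite (addrAC x) !opprD !addrA.
Qed.

(* The first order term in [t' - t] is computed by Gaussian integration by parts. *)
Lemma heat_time t t' x :
  `|U0 t' x - (U0 t x + (t' - t) * t * U2 t x)| <= L * m2 * (t' - t) ^+ 2.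
Proof.
have ibp : t * U2 t x = gexp (fun z => z * f1 (x + t * z)).
  by rewrite (gexp_ibp_affine x t (smooth3_d2 hf) cf2 (smooth3_b1 hf) (smooth3_b2 hf)).
have iz : gint (fun z => z * f1 (x + t * z)).
  apply: (@gint_le _ _ (fun z => L * `|z|)); last by apply: gintZ; exact: gint_norm_id.
    by apply: measurable_funM => //; exact: meas_aff.
  move=> z; rewrite !normrM normr_id mulrC ler_wpM2r//.
  by rewrite (le_trans (smooth3_b1 hf _))// ler_norm.
have -> : L * m2 * (t' - t) ^+ 2 = gexp (fun z => (L * (t' - t) ^+ 2) * z ^+ 2).
  by rewrite gexpZ; [rewrite /m2; ring|exact: gint_sqr].
rewrite -mulrA ibp -gexpZ// -gexpD//; last exact: gintZ.
apply: gexp_dist_le => //.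
- by apply: gintD => //; exact: gintZ.
- by apply: gintZ; exact: gint_sqr.
move=> z; have := taylor_f_1 hf (x + t * z) ((t' - t) * z).
have -> : x + t * z + (t' - t) * z = x + t' * z by ring.
have -> : L * `|(t' - t) * z| ^+ 2 = L * (t' - t) ^+ 2 * z ^+ 2.
  by rewrite real_normK ?num_real// exprMn mulrA.
by rewrite opprD addrA [(t' - t) * (z * _)]mulrA.
Qed.

Lemma gexp_lipschitz t t' :
  `|gexp (fun z => f (t' * z)) - gexp (fun z => f (t * z))| <=
  L * `|t' - t| * gexp (fun z : R => `|z|).
Proof.
rewrite -gexpZ; last exact: gint_norm_id.
have E0 s : (fun z => f (s * z)) = (fun z => f (0 + s * z)).
  by apply/funext => z; rewrite add0r.
rewrite !E0; apply: gexp_dist_le => //.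
  by apply: gintZ; exact: gint_norm_id.
move=> z; have := lipschitz0 hf (0 + t * z) ((t' - t) * z).
have -> : 0 + t * z + (t' - t) * z = 0 + t' * z by ring.
by rewrite normrM mulrA.
Qed.

(** The remainder of [heat_time] is a squared increment of the standard deviation. Increments of the
    square root are at most 1, so squares are at most the increments, which telescope. *)
Lemma sqrt_increments k (v : R) : 0 <= v ->
  \sum_(j < k) (Num.sqrt v * Num.sqrt (j.+1)%:R - Num.sqrt v * Num.sqrt j%:R) ^+ 2
    <= v * Num.sqrt k%:R.
Proof.
move=> v0; have inc j : (Num.sqrt (j.+1)%:R - Num.sqrt j%:R) ^+ 2 <=
    Num.sqrt (j.+1)%:R - Num.sqrt j%:R :> R.
  have h0 : 0 <= Num.sqrt j%:R :> R by exact: sqrtr_ge0.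
  have h1 : Num.sqrt j%:R <= Num.sqrt (j.+1)%:R :> R by rewrite ler_sqrt// ler_nat.
  have e0 : (Num.sqrt j%:R) ^+ 2 = j%:R :> R by rewrite sqr_sqrtr.
  have e1 : (Num.sqrt (j.+1)%:R) ^+ 2 = j%:R + 1 :> R by rewrite sqr_sqrtr// natr1.
  move: h0 h1 e0 e1; set a := Num.sqrt _; set b := Num.sqrt _ => h0 h1 e0 e1.
  have : b - a <= 1 by nra.
  nra.
elim: k => [|k IH]; first by rewrite big_ord0 sqrtr0 mulr0.
rewrite big_ord_recr/=; have := inc k.
rewrite -mulrBr exprMn sqr_sqrtr// => h.
have : v * (Num.sqrt (k.+1)%:R - Num.sqrt k%:R) ^+ 2 <=
   v * (Num.sqrt (k.+1)%:R - Num.sqrt k%:R) by rewrite ler_wpM2l.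
lra.
Qed.

Variables (W : Type) (E : (W -> R) -> R).
Hypothesis hE : is_expectation E.

(* The blocks from [j] on, exchanged for centred Gaussians of variance [v], add up to
   one of standard deviation [sqrt v * sqrt (k - j)]. *)
Lemma lindeberg k (Y : nat -> W -> R) (v y b : R) : 0 <= v ->
  let S j w := \sum_(i < j) Y i w in
  (forall j w, (j < k)%N -> `|Y j w| <= y) ->
  (forall j, (j < k)%N -> E (fun w => Y j w ^+ 2) = v) ->
  (forall j (u : R -> R), (j < k)%N -> (forall x, `|u x| <= 1) ->
     `|E (fun w => u (S j w) * Y j w)| <= b /\
     `|E (fun w => u (S j w) * (Y j w ^+ 2 - v))| <= b) ->
  `|E (fun w => f (S k w)) - gexp (fun z => f (Num.sqrt v * Num.sqrt k%:R * z))|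
     <= L * (2 * b * k%:R + k%:R * (y * v) + (m2 + 1) * (v * Num.sqrt k%:R)).
Proof.
move=> v0 S Yy Yv Yb.
pose tau j : R := Num.sqrt v * Num.sqrt j%:R.
pose Af j := E (fun w => U0 (tau (k - j)%N) (S j w)).
pose D j := (tau j.+1 - tau j) ^+ 2.
have D0 j : 0 <= D j by exact: sqr_ge0.
have tau2 j : tau j ^+ 2 = v * j%:R by rewrite exprMn !sqr_sqrtr.
have A0 : Af 0%N = gexp (fun z => f (Num.sqrt v * Num.sqrt k%:R * z)).
  rewrite /Af subn0; under eq_fun do rewrite /S big_ord0.
  rewrite (ex_cst hE) /U0; congr gexp; apply/funext => z; by rewrite add0r.
have Ak : Af k = E (fun w => f (S k w)).
  rewrite /Af subnn; congr E; apply/funext => w; rewrite /U0 /tau sqrtr0 mulr0.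
  by under eq_fun do rewrite mul0r addr0; rewrite gexp_cst.
have step j : (j < k)%N ->
    `|Af j.+1 - Af j| <= L * (2 * b + y * v + (m2 + 1) * D (k - j.+1)%N).
  move=> jk; have kj : (k - j)%N = (k - j.+1).+1 by rewrite subnSK.
  set i := (k - j.+1)%N in kj *.
  (* Division by [L] turns the derivatives into test functions bounded by 1. *)
  have [] := Yb j (fun x => L^-1 * U1 (tau i) x) jk.
    by move=> x; rewrite normrM gtr0_norm ?invr_gt0// ler_pdivrMl// mulr1.
  move=> b1 _.
  have [] := Yb j (fun x => L^-1 * U2 (tau i) x) jk.
    by move=> x; rewrite normrM gtr0_norm ?invr_gt0// ler_pdivrMl// mulr1.
  move=> _ b2.
  (* Consecutive variances differ by [v], so the time term of [heat_time] carries [v / 2], the mean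
     of the spatial second order coefficient, up to the defect [D i / 2]. *)
  have dE : (tau i.+1 - tau i) * tau i = 2^-1 * (v - D i).
    have h1 := tau2 i; have h2 := tau2 i.+1; rewrite -natr1 mulrDr mulr1 -h1 in h2.
    rewrite /D; have -> : v = tau i.+1 ^+ 2 - tau i ^+ 2 by rewrite h2; ring.
    by field.
  pose main w := U1 (tau i) (S j w) * Y j w + 2^-1 * (U2 (tau i) (S j w) * (Y j w ^+ 2 - v)).
  have hm : `|E main| <= L * (2 * b).
    have -> : main = fun w => L * ((L^-1 * U1 (tau i) (S j w)) * Y j w) +
        (2^-1 * L) * ((L^-1 * U2 (tau i) (S j w)) * (Y j w ^+ 2 - v)).
      by apply/funext => w; rewrite /main; field; rewrite gt_eqF.
    rewrite (exD hE) !(exZ hE) (le_trans (ler_normD _ _))// !normrM.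
    rewrite (gtr0_norm L0) (@gtr0_norm _ (2^-1)) ?invr_gt0//.
    have q1 := ler_wpM2l (ltW L0) b1; have q2 := ler_wpM2l (ltW L0) b2.
    have q0 : 0 <= L * b by apply: le_trans q1; rewrite mulr_ge0// ltW.
    by rewrite -mulrA; lra.
  have hr : `|E (fun w => (U0 (tau i) (S j.+1 w) - U0 (tau i.+1) (S j w)) - main w)| <=
       L * (y * v + (m2 + 1) * D i).
    have -> : L * (y * v + (m2 + 1) * D i) = E (fun w => L * y * Y j w ^+ 2 + L * (m2 + 1) * D i).
      by rewrite (exD hE) (exZ hE) (ex_cst hE) Yv//; ring.
    apply: (ex_norm hE) => w.
    have -> : S j.+1 w = S j w + Y j w by rewrite /S big_ord_recr.
    have h1 := heat_space (tau i) (S j w) (Y j w).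
    have h2 := heat_time (tau i) (tau i.+1) (S j w).
    have h3 : `|Y j w| ^+ 3 <= y * Y j w ^+ 2.
      by rewrite exprS -normrX (ger0_norm (sqr_ge0 _)) ler_wpM2r ?sqr_ge0// Yy.
    have h4 : L * `|Y j w| ^+ 3 <= L * y * Y j w ^+ 2 by rewrite -mulrA ler_wpM2l// ltW.
    have h5 : `|D i * U2 (tau i) (S j w)| <= D i * L by rewrite normrM (ger0_norm (D0 i)) ler_wpM2l.
    have -> : U0 (tau i) (S j w + Y j w) - U0 (tau i.+1) (S j w) - main w =
      (U0 (tau i) (S j w + Y j w) - (U0 (tau i) (S j w) + Y j w * U1 (tau i) (S j w) +
         2^-1 * Y j w ^+ 2 * U2 (tau i) (S j w))) -
      (U0 (tau i.+1) (S j w) - (U0 (tau i) (S j w) + (tau i.+1 - tau i) * tau i * U2 (tau i) (S j w)))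
      + 2^-1 * (D i * U2 (tau i) (S j w)).
      by rewrite dE /main; field.
    rewrite (le_trans (ler_normD _ _))//.
    have h6 := ler_normB (U0 (tau i) (S j w + Y j w) - (U0 (tau i) (S j w) + Y j w * U1 (tau i) (S j w) +
         2^-1 * Y j w ^+ 2 * U2 (tau i) (S j w)))
      (U0 (tau i.+1) (S j w) - (U0 (tau i) (S j w) + (tau i.+1 - tau i) * tau i * U2 (tau i) (S j w))).
    have h7 : `|2^-1 * (D i * U2 (tau i) (S j w))| <= D i * L.
      rewrite normrM ger0_norm ?invr_ge0//; apply: le_trans h5.
      by rewrite ler_piMl// invf_le1// ler1n.
    rewrite -/(D i) in h2; move: h1 h2 h4 h6 h7; nra.
  have -> : Af j.+1 - Af j = E main + E (fun w => (U0 (tau i) (S j.+1 w) - U0 (tau i.+1) (S j w)) - main w).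
    by rewrite !(exB hE) /Af kj -/i; ring.
  rewrite (le_trans (ler_normD _ _))//.
  have -> : L * (2 * b + y * v + (m2 + 1) * D i) = L * (2 * b) + L * (y * v + (m2 + 1) * D i) by ring.
  exact: lerD.
rewrite -A0 -Ak -(telescope_sumr Af (leq0n k)) big_mkord.
rewrite (le_trans (ler_norm_sum _ _ _))//.
apply: (@le_trans _ _ (\sum_(j < k) L * (2 * b + y * v + (m2 + 1) * D (k - j.+1)%N))).
  by apply: ler_sum => j _; exact: step.
rewrite -mulr_sumr ler_wpM2l ?(ltW L0)// big_split/= sumr_const card_ord -[_ *+ k]mulr_natr.
rewrite -mulr_sumr.
have -> : \sum_(j < k) D (k - j.+1)%N = \sum_(j < k) D j by rewrite [RHS](reindex_inj rev_ord_inj).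
have := sqrt_increments k v0 => h.
have m0 : 0 <= m2 + 1 by rewrite addr_ge0// gexp_sqr_ge0.
have : (m2 + 1) * \sum_(j < k) D j <= (m2 + 1) * (v * Num.sqrt k%:R) by rewrite ler_wpM2l.
lra.
Qed.

End Lindeberg.

(** * Stationary mixing arrays *)

Section SumsByBlocks.
Variable V : nmodType.

Lemma big_nat_shift (s k : nat) (g : nat -> V) :
  \sum_(s <= i < s + k) g i = \sum_(i < k) g (s + i)%N.
Proof.
rewrite -{1}[s]add0n big_addn addKn big_mkord.
by apply: eq_bigr => i _; rewrite addnC.
Qed.

Lemma sum_blocks (D k : nat) (g : nat -> V) :
  \sum_(i < k * D) g i = \sum_(j < k) \sum_(t < D) g (j * D + t)%N.
Proof.
elim: k => [|k IH]; first by rewrite mul0n !big_ord0.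
rewrite big_ord_recr/= -IH mulSn addnC -(big_mkord xpredT g).
rewrite (@big_cat_nat _ _ _ (k * D))//=; last exact: leq_addr.
by rewrite big_mkord big_nat_shift.
Qed.

Lemma sum_big_blocks (D p k n : nat) (g : nat -> V) : (p <= D)%N -> (k * D <= n)%N ->
  (0 < D)%N ->
  \sum_(i < n | (i %% D < p)%N && (i < k * D)%N) g i =
  \sum_(j < k) \sum_(t < p) g (j * D + t)%N.
Proof.
move=> pD kn D0.
rewrite (eq_bigl (fun i : 'I_n => (i < k * D)%N && (i %% D < p)%N)); last first.
  by move=> i; rewrite andbC.
rewrite big_mkcondr -(big_ord_widen n (fun i => if (i %% D < p)%N then g i else 0) kn).
rewrite [LHS](sum_blocks D k (fun i => if (i %% D < p)%N then g i else 0)); apply: eq_bigr => j _.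
rewrite (big_ord_widen D (fun t => g (j * D + t)%N) pD) [RHS]big_mkcond.
by apply: eq_bigr => t _; rewrite modnMDl modn_small.
Qed.

End SumsByBlocks.

Section Stationary.
Variables (R : realType) (W : nat -> Type) (E : forall n, (W n -> R) -> R).
Variables (X : forall n, nat -> W n -> R) (c beta : nat -> R).
Arguments X {n}.
Hypothesis hE : forall n, is_expectation (@E n).
Hypothesis X1 : forall n i w, `|@X n i w| <= 1.
Hypothesis EX0 : forall n i, (i < n)%N -> E (@X n i) = 0.
Hypothesis EXX : forall n i j, (i <= j)%N -> (j < n)%N ->
  E (fun w => @X n i w * X j w) = c (j - i)%N.
(** Boundedness of [F] and [G] is required only on sequences with entries in [[-1, 1]], which admits
    sums and squares of coordinates; the default value 0 of [nth] is compatible with it. *)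
Hypothesis hmix : forall n i q l (F G : seq R -> R), (i + q + l <= n)%N ->
  (forall x, (forall t, `|nth 0 x t| <= 1) -> `|F x| <= 1) ->
  (forall x, (forall t, `|nth 0 x t| <= 1) -> `|G x| <= 1) ->
  `|E (fun w : W n => F [seq X t w | t <- iota 0 i] * G [seq X t w | t <- iota (i + q) l])
    - E (fun w : W n => F [seq X t w | t <- iota 0 i]) *
      E (fun w : W n => G [seq X t w | t <- iota (i + q) l])| <= beta q.
Hypothesis beta0 : forall q, 0 <= beta q.
Hypothesis betad : forall q, beta q.+1 <= beta q.
Hypothesis betas : cvgn (series beta).

(** Mixing for the coordinates 0 and [k + 1], which have exactly [k] indices between them and mean
    zero. *)
Lemma autocov_le k : `|c k.+1| <= beta k.
Proof.
have := @hmix k.+2 1%N k 1%N (fun x => nth 0 x 0) (fun x => nth 0 x 0).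
rewrite /= add1n addn1 !EX0// mulr0 subr0 EXX// subn0; apply => //.
Qed.

Lemma autocov0_le : `|c 0%N| <= 1.
Proof.
have <- : E (fun w => @X 1 0 w * X 0 w) = c 0%N by rewrite EXX.
rewrite -[leRHS](ex_cst (hE 1)); apply: (ex_norm (hE 1)) => w.
by rewrite normrM mulr_ile1.
Qed.

Lemma autocov_summable : cvgn (series (fun k => `|c k.+1|)).
Proof.
by apply: (series_le_cvg _ _ _ betas) => // k; exact: autocov_le.
Qed.

Definition cov_total := limn (series (fun k => `|c k.+1|)).

Lemma autocov_partial p : \sum_(k < p) `|c k.+1| <= cov_total.
Proof.
have nd : nondecreasing_seq (series (fun k => `|c k.+1|)).
  by apply: (@nondecreasing_series _ _ xpredT 0).
have := nondecreasing_cvgn_le nd autocov_summable p.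
by rewrite {1}seriesEord.
Qed.

Definition var_rate := 1 + 2 * cov_total.

Lemma cov_total_ge0 : 0 <= cov_total.
Proof. by have := autocov_partial 0; rewrite big_ord0. Qed.

Lemma var_rate_ge1 : 1 <= var_rate.
Proof. by rewrite lerDl mulr_ge0// cov_total_ge0. Qed.

Definition cc i j := if (i <= j)%N then c (j - i) else c (i - j).

Lemma ccC i j : cc i j = cc j i.
Proof. by rewrite /cc; case: ltngtP => // ->. Qed.

Lemma cc_shift s i j : cc (s + i) (s + j) = cc i j.
Proof. by rewrite /cc leq_add2l !subnDl. Qed.

Lemma E_cc n i j : (i < n)%N -> (j < n)%N -> E (fun w => @X n i w * X j w) = cc i j.
Proof.
move=> hi hj; rewrite /cc; case: leqP => ij; first exact: EXX.
by rewrite -(EXX (ltnW ij) hi); congr E; apply/funext => w; rewrite mulrC.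
Qed.

Lemma sum_below i : \sum_(j < i) cc j i = \sum_(k < i) c k.+1.
Proof.
rewrite (reindex_inj rev_ord_inj)/=; apply: eq_bigr => j _.
rewrite /cc leq_subr subKn//.
Qed.

Lemma sum_cc_row n i : (i < n)%N -> \sum_(j < n) `|cc i j| <= var_rate.
Proof.
move=> hi; rewrite -(big_mkord xpredT (fun j => `|cc i j|)).
rewrite (@big_cat_nat _ _ _ i)//=; last exact: ltnW.
rewrite big_mkord.
have -> : \sum_(j < i) `|cc i j| = \sum_(k < i) `|c k.+1|.
  rewrite (reindex_inj rev_ord_inj)/=; apply: eq_bigr => j _.
  by rewrite ccC /cc leq_subr subKn.
have {1}-> : n = (i + (n - i.+1).+1)%N by rewrite addnS -addSn subnKC.
rewrite big_nat_shift big_ord_recl/= addn0.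
have -> : cc i i = c 0%N by rewrite /cc leqnn subnn.
have -> : \sum_(k < n - i.+1) `|cc i (i + bump 0 k)| = \sum_(k < n - i.+1) `|c k.+1|.
  by apply: eq_bigr => k _; rewrite /cc leq_addr addKn.
have := autocov_partial i; have := autocov_partial (n - i.+1); have := autocov0_le.
rewrite /var_rate; lra.
Qed.

(** Each row of the covariance matrix has absolute sum at most [var_rate]. The index set is
    arbitrary because the indices left over by the blocks form no interval. *)
Lemma var_sum_le n (D : pred nat) :
  E (fun w => (\sum_(i < n | D i) @X n i w) ^+ 2) <= (\sum_(i < n | D i) 1) * var_rate.
Proof.
have -> : (fun w => (\sum_(i < n | D i) @X n i w) ^+ 2) =
   fun w => \sum_(i < n | D i) \sum_(j < n | D j) @X n i w * X j w.
  by apply/funext => w; rewrite expr2 big_distrlr.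
rewrite (ex_sum (hE n)) mulr_suml; apply: ler_sum => i _.
rewrite (ex_sum (hE n)) mul1r; apply: le_trans (sum_cc_row (ltn_ord i)).
rewrite big_mkcond/=; apply: ler_sum => j _; case: ifP => // _.
by rewrite E_cc// ler_norm.
Qed.

Definition var_block p := \sum_(i < p) \sum_(j < p) cc i j.

Lemma E_block n s p : (s + p <= n)%N ->
  E (fun w => (\sum_(t < p) @X n (s + t) w) ^+ 2) = var_block p.
Proof.
move=> sp.
have -> : (fun w => (\sum_(t < p) @X n (s + t) w) ^+ 2) =
   fun w => \sum_(i < p) \sum_(j < p) @X n (s + i) w * X (s + j) w.
  by apply/funext => w; rewrite expr2 big_distrlr.
rewrite (ex_sum (hE n)); apply: eq_bigr => i _; rewrite (ex_sum (hE n)); apply: eq_bigr => j _.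
by rewrite E_cc ?cc_shift//; apply: leq_trans sp; rewrite ltn_add2l.
Qed.

Lemma var_block_bounds p : 0 <= var_block p <= p%:R * var_rate.
Proof.
rewrite -(@E_block p 0 p)//; apply/andP; split.
  by apply: (ex_ge0 (hE p)) => w; exact: sqr_ge0.
by have := var_sum_le p xpredT; rewrite sumr_const card_ord.
Qed.

Definition var_partial j := c 0%N + 2 * series (fun k => c k.+1) j.

(** One more index adds a diagonal entry and twice a partial row, which is [var_partial p]. Divided
    by [p], the block variance is thus a Cesaro mean. *)
Lemma var_blockE p : var_block p = series var_partial p.
Proof.
rewrite seriesEord /=; elim: p => [|p IH]; first by rewrite /var_block /= !big_ord0.
rewrite [RHS]big_ord_recr/= -IH /var_block big_ord_recr/=.
under eq_bigr do rewrite big_ord_recr/=.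
rewrite big_split/= big_ord_recr/= sum_below.
under [\sum_(i < p) cc p i]eq_bigr do rewrite ccC.
rewrite sum_below /cc leqnn subnn /var_partial seriesEord/=; ring.
Qed.

Definition Sigma2 := c 0%N + 2 * limn (series (fun k => c k.+1)).

Lemma var_partial_cvg : var_partial @ \oo --> Sigma2.
Proof.
have h : cvgn (series (fun k => c k.+1)) by apply: normed_cvg; exact: autocov_summable.
exact: (cvgD (cvg_cst (c 0%N)) (cvgM (cvg_cst (2 : R)) h)).
Qed.

Lemma var_block_rate : (fun p => var_block p / p%:R) @ \oo --> Sigma2.
Proof.
rewrite -(cvg_shiftn 1); have := cesaro var_partial_cvg; apply: cvg_trans.
rewrite (_ : [sequence _]_n = arithmetic_mean var_partial)//.
by apply/funext => p; rewrite /= addn1 var_blockE mulrC.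
Qed.

Lemma var_sum_rate :
  (fun n => E (fun w => (\sum_(i < n) @X n i w) ^+ 2) / n%:R) @ \oo --> Sigma2.
Proof.
have := var_block_rate; apply: cvg_trans; apply: near_eq_cvg; near=> n.
by rewrite -(@E_block n 0 n).
Unshelve. all: by end_near.
Qed.

Lemma Sigma2_ge0 : 0 <= Sigma2.
Proof.
have h := var_block_rate; rewrite -(cvg_lim _ h)//.
apply: limr_ge; first by apply: cvgP h.
by near=> p; have /andP[v0 _] := var_block_bounds p; rewrite divr_ge0.
Unshelve. all: by end_near.
Qed.

(** By monotonicity half of [q * beta q] is at most the sum of [beta] over the second half of the
    indices below [q], which is part of a small tail. *)
Lemma beta_lin e : 0 < e -> exists Q, forall q, (Q <= q)%N -> q%:R * beta q <= e.
Proof.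
move=> e0; pose B := limn (series beta).
have nds : nondecreasing_seq (series beta) by apply: (@nondecreasing_series _ _ xpredT 0).
have sB q : series beta q <= B by exact: nondecreasing_cvgn_le.
have e4 : 0 < e / 4 by rewrite divr_gt0.
have /cvgrPdist_le/(_ _ e4)[Q _ hQ] := betas.
exists (2 * Q)%N => q hq.
pose h := q./2.
have hQh : (Q <= h)%N by rewrite /h; lia.
have bm i j : (i <= j)%N -> beta j <= beta i.
  by move=> /subnKC <-; elim: (j - i)%N => [|t IH]; rewrite ?addn0// addnS (le_trans (betad _)).
have h1 : (q - h)%:R * beta q <= series beta q - series beta h.
  have hq' : (h <= q)%N by rewrite /h; lia.
  have -> : series beta q - series beta h = \sum_(h <= i < q) beta i.
    by rewrite /series /= (@big_cat_nat _ _ _ h 0 q)//= addrAC subrr add0r.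
  have -> : (q - h)%:R * beta q = \sum_(h <= i < q) beta q.
    by rewrite sumr_const_nat mulr_natl.
  rewrite [leLHS]big_nat_cond [leRHS]big_nat_cond; apply: ler_sum => i /andP[/andP[_ iq] _].
  by apply: bm; exact: ltnW.
have h2 : series beta q - series beta h <= e / 4.
  have := hQ h hQh; rewrite /= -/B => /ler_normlP[_ h3].
  by have := sB q; lra.
have h3 : (q%:R : R) <= 2 * (q - h)%:R.
  by rewrite -natrM ler_nat /h; lia.
have : q%:R * beta q <= 2 * ((q - h)%:R * beta q) by rewrite mulrA ler_wpM2r.
lra.
Qed.

(** * Big blocks separated by gaps *)

Section Blocks.
Variables (n p q k : nat).
Hypotheses (p0 : (0 < p)%N) (kn : (k * (p + q) <= n)%N).
Let D := (p + q)%N.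
Let r : R := Num.sqrt n%:R.
Hypothesis pr : p%:R <= r.

Let r0 : 0 < r. Proof. by apply: lt_le_trans pr; rewrite ltr0n. Qed.

Let Y j (w : W n) : R := (\sum_(t < p) X (j * D + t) w) / r.
Let S j (w : W n) : R := \sum_(i < j) Y i w.

Let block_le j : (j < k)%N -> (j * D + p <= n)%N.
Proof.
move=> jk; apply: leq_trans kn; apply: (@leq_trans (j.+1 * D)).
  by rewrite mulSn addnC leq_add2r leq_addr.
by rewrite leq_mul2r jk orbT.
Qed.

Let sum_le (x : nat -> R) : (forall t, `|x t| <= 1) -> `|(\sum_(t < p) x t) / r| <= p%:R / r.
Proof.
move=> x1; rewrite normrM (gtr0_norm (_ : 0 < r^-1)) ?invr_gt0// ler_wpM2r// ?invr_ge0 ?(ltW r0)//.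
rewrite (le_trans (ler_norm_sum _ _ _))//.
apply: (@le_trans _ _ (\sum_(t < p) 1)); first by apply: ler_sum.
by rewrite sumr_const card_ord.
Qed.

Let pr1 : p%:R / r <= 1. Proof. by rewrite ler_pdivrMr// mul1r. Qed.

(** The earlier blocks end [q] indices before block [j] starts, and [p <= sqrt n] bounds a
    normalized block and its square by 1, so mixing applies to both. *)
Lemma blocks_decoupled j (u : R -> R) : (j < k)%N -> (forall x, `|u x| <= 1) ->
  `|E (fun w => u (S j w) * Y j w)| <= beta q /\
  `|E (fun w => u (S j w) * (Y j w ^+ 2 - var_block p / n%:R))| <= beta q.
Proof.
move=> jk u1.
have jn := block_le jk.
have EY : E (Y j) = 0.
  rewrite (_ : Y j = fun w => r^-1 * \sum_(t < p) X (j * D + t) w); last first.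
    by apply/funext => w; rewrite mulrC.
  rewrite (exZ (hE n)) (ex_sum (hE n)) big1 ?mulr0// => t _.
  by rewrite EX0//; apply: leq_trans jn; rewrite ltn_add2l.
have EY2 : E (fun w => Y j w ^+ 2) = var_block p / n%:R.
  rewrite -(E_block jn) mulrC -(exZ (hE n)); congr E; apply/funext => w.
  by rewrite exprMn exprVn sqr_sqrtr// mulrC.
(* The first block has no gap before it, and [j * D - q] would be truncated; but then [u] is taken
   at 0 and both expectations vanish exactly. *)
case: (posnP j) => [j0|j0].
  have S0 w : S j w = 0 by rewrite /S j0 big_ord0.
  have -> : (fun w => u (S j w) * Y j w) = fun w => u 0 * Y j w by apply/funext => w; rewrite S0.
  have -> : (fun w => u (S j w) * (Y j w ^+ 2 - var_block p / n%:R)) =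
     fun w => u 0 * (Y j w ^+ 2 - var_block p / n%:R) by apply/funext => w; rewrite S0.
  rewrite !(exZ (hE n)) EY (exB (hE n)) EY2 (ex_cst (hE n)) subrr mulr0 normr0.
  by rewrite beta0.
have qjD : (q <= j * D)%N by case: (j) j0 => // j' _; rewrite mulSn; lia.
pose i := (j * D - q)%N.
have iq : (i + q = j * D)%N by rewrite subnK.
pose F (x : seq R) := u (\sum_(b < j) (\sum_(t < p) nth 0 x (b * D + t)) / r).
pose G (x : seq R) := (\sum_(t < p) nth 0 x t) / r.
have FE w : F [seq X t w | t <- iota 0 i] = u (S j w).
  rewrite /F /S; congr u; apply: eq_bigr => b _; congr (_ / _); apply: eq_bigr => t _.
  have bt : (b * D + t < i)%N.
    have bj : (b.+1 * D <= j * D)%N by rewrite leq_mul2r (ltn_ord b) orbT.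
    have := ltn_ord t; move: bj; rewrite mulSn /i /D; lia.
  by rewrite (nth_map 0%N) ?size_iota// nth_iota.
have GE w : G [seq X t w | t <- iota (i + q) p] = Y j w.
  rewrite /G /Y; congr (_ / _); apply: eq_bigr => t _.
  by rewrite (nth_map 0%N) ?size_iota// nth_iota// iq.
have G1 x : (forall t, `|nth 0 x t| <= 1) -> `|G x| <= 1.
  by move=> x1; apply: le_trans pr1; exact: sum_le.
have F1 x : (forall t, `|nth 0 x t| <= 1) -> `|F x| <= 1 by move=> _; exact: u1.
have iqp : (i + q + p <= n)%N by rewrite iq.
split.
  have := hmix iqp F1 G1.
  have -> : (fun w : W n => F [seq X t w | t <- iota 0 i] * G [seq X t w | t <- iota (i + q) p]) =
     fun w => u (S j w) * Y j w by apply/funext => w; rewrite FE GE.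
  have -> : (fun w : W n => G [seq X t w | t <- iota (i + q) p]) = Y j by apply/funext => w; rewrite GE.
  by rewrite EY mulr0 subr0.
have G2 x : (forall t, `|nth 0 x t| <= 1) -> `|(fun x => G x ^+ 2) x| <= 1.
  by move=> /G1 h; rewrite normrX expr_le1.
have := hmix iqp F1 G2.
have -> : (fun w : W n => F [seq X t w | t <- iota 0 i] * G [seq X t w | t <- iota (i + q) p] ^+ 2) =
   fun w => u (S j w) * Y j w ^+ 2 by apply/funext => w; rewrite FE GE.
have -> : (fun w : W n => G [seq X t w | t <- iota (i + q) p] ^+ 2) =
   (fun w => Y j w ^+ 2) by apply/funext => w; rewrite GE.
have -> : (fun w : W n => F [seq X t w | t <- iota 0 i]) = fun w => u (S j w).
  by apply/funext => w; rewrite FE.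
rewrite EY2.
have -> : (fun w => u (S j w) * (Y j w ^+ 2 - var_block p / n%:R)) =
  fun w => u (S j w) * Y j w ^+ 2 - (var_block p / n%:R) * u (S j w).
  by apply/funext => w; ring.
by rewrite (exB (hE n)) (exZ (hE n)) [X in _ - X]mulrC.
Qed.

(** What remains is a sum over the gaps and the final incomplete stretch, [n - k p] indices in all,
    to which [var_sum_le] applies. *)
Lemma rest_small : E (fun w => ((\sum_(i < n) X i w) / r - S k w) ^+ 2) <=
  (1 - k%:R * p%:R / n%:R) * var_rate.
Proof.
pose B := [pred i : nat | (i %% D < p)%N && (i < k * D)%N].
have D0 : (0 < D)%N by rewrite addn_gt0 p0.
have pD : (p <= D)%N by exact: leq_addr.
have n0 : (0 : R) < n%:R by rewrite -[n%:R]sqr_sqrtr// exprn_gt0.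
have -> : (fun w : W n => ((\sum_(i < n) X i w) / r - S k w) ^+ 2) =
   fun w => n%:R^-1 * (\sum_(i < n | ~~ B i) X i w) ^+ 2.
  apply/funext => w.
  rewrite (bigID (fun i : 'I_n => B i))/= (sum_big_blocks (fun i => X i w) pD kn D0).
  rewrite /S /Y -mulr_suml -mulrBl addrAC subrr add0r exprMn exprVn sqr_sqrtr// mulrC.
  by [].
rewrite (exZ (hE n)) mulrC ler_pdivrMr//.
apply: (le_trans (var_sum_le n (fun i => ~~ B i))).
rewrite mulrAC; apply: ler_wpM2r; first by apply: le_trans var_rate_ge1.
have h1 : \sum_(i < n) (1 : R) = n%:R by rewrite sumr_const card_ord.
have h2 := sum_big_blocks (fun=> (1 : R)) pD kn D0.
have h3 : \sum_(j < k) \sum_(t < p) (1 : R) = k%:R * p%:R.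
  under eq_bigr do rewrite sumr_const card_ord.
  by rewrite sumr_const card_ord -[_ *+ k]mulr_natl.
rewrite h3 in h2.
rewrite (bigID (fun i : 'I_n => B i))/= h2 in h1.
have -> : (1 - k%:R * p%:R / n%:R) * n%:R = n%:R - k%:R * p%:R :> R by field; rewrite gt_eqF.
by rewrite -h1 addrAC subrr add0r.
Qed.

End Blocks.

(** * The limit theorem for smooth test functions *)

Section SmoothLimit.
Variables (f f1 f2 : R -> R) (L : R).
Hypotheses (hf : smooth3 f f1 f2 L) (L0 : 0 < L).
Let m1 := gexp (fun z : R => `|z|).
Let m2 := gexp (fun z : R => z ^+ 2).

(** Lets second moments control first moments with no square roots; a second moment of order [B^-2]
    yields a first moment of order [B^-1]. *)
Lemma norm_le_sqr (x B : R) : 0 < B -> `|x| <= B^-1 + B * x ^+ 2.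
Proof.
move=> B0; have h := sqr_ge0 (B * `|x| - 1).
have -> : B^-1 + B * x ^+ 2 = `|x| + B^-1 * ((B * `|x| - 1) ^+ 2 + B * `|x|).
  by rewrite -[x ^+ 2]real_normK ?num_real//; field; rewrite gt_eqF.
by rewrite lerDl mulr_ge0 ?invr_ge0 ?(ltW B0)// addr_ge0// mulr_ge0// ltW.
Qed.

Lemma sqr_sub_le (x y : R) : 0 <= x -> 0 <= y -> (x - y) ^+ 2 <= `|x ^+ 2 - y ^+ 2|.
Proof.
move=> x0 y0; have -> : x ^+ 2 - y ^+ 2 = (x - y) * (x + y) by ring.
rewrite normrM (ger0_norm (_ : 0 <= x + y)) ?addr_ge0// -[leLHS]ger0_norm ?sqr_ge0//.
rewrite expr2 normrM ler_wpM2l// ler_norml; apply/andP; split; lra.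
Qed.

(* Blocks of length [b^2 q] separated by gaps of length [q], with [sqrt n] of order
   [b^4 q]: the order [b^6 q] many blocks cost [b^6 q * beta q], which is small since
   [beta] is summable and nonincreasing. *)
Lemma clt_estimate (b n q : nat) : (0 < b)%N -> (0 < q)%N ->
  (b ^ 4 * q)%:R <= Num.sqrt n%:R :> R -> Num.sqrt n%:R <= (2 * b ^ 4 * q)%:R :> R ->
  `|E (fun w => f ((\sum_(i < n) @X n i w) / Num.sqrt n%:R)) -
    gexp (fun z => f (Num.sqrt Sigma2 * z))| <=
  L * ((1 + 3 * var_rate) / b%:R + 8 * b%:R ^+ 6 * (q%:R * beta q) +
       (m2 + 2) * (var_rate / b%:R) +
       m1 * (b%:R^-1 + b%:R * `|var_block (b ^ 2 * q) / (b ^ 2 * q)%:R - Sigma2| +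
         3 * var_rate / b%:R)).
Proof.
move=> b0 q0 hr1 hr2.
pose a := (b ^ 2)%N; pose p := (a * q)%N; pose k := (n %/ (p + q))%N.
rewrite -/a -/p.
have a0 : (0 < a)%N by rewrite expn_gt0 b0.
have p0 : (0 < p)%N by rewrite muln_gt0 a0.
have kn : (k * (p + q) <= n)%N by exact: leq_trunc_div.
have nk : (n < k.+1 * (p + q))%N by apply: ltn_ceil; rewrite addn_gt0 p0.
set rr := Num.sqrt n%:R in hr1 hr2 *.
pose N : R := n%:R; pose K : R := k%:R; pose Q : R := q%:R; pose A : R := a%:R; pose B : R := b%:R.
have AB : A = B ^+ 2 by rewrite /A /a natrX.
have B1 : 1 <= B by rewrite ler1n.
have Q1 : 1 <= Q by rewrite ler1n.
have A1 : 1 <= A by rewrite ler1n.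
have K0 : 0 <= K by rewrite ler0n.
have pE : p%:R = A * Q :> R by rewrite /p natrM.
have H1 : K * (A * Q + Q) <= N by rewrite -pE /K /Q -natrD -natrM ler_nat.
have H2 : N < (K + 1) * (A * Q + Q) by rewrite -pE /K /Q -natrD natr1 -natrM ltr_nat.
have H3 : A * (A * Q) <= rr.
  by apply: le_trans hr1; rewrite AB /B /Q -!natrX -!natrM ler_nat; apply: eq_leq; ring.
have H4 : rr <= 2 * (A * (A * Q)).
  by apply: (le_trans hr2); rewrite AB /B /Q -!natrX -!natrM ler_nat; apply: eq_leq; ring.
have rr2 : rr ^+ 2 = N by rewrite sqr_sqrtr// ler0n.
have A0 : 0 < A by lra.
have B0 : 0 < B by lra.
have Q0 : 0 < Q by lra.
have AQ1 : 1 <= A * Q by rewrite -[1]mulr1 ler_pM.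
have AQ0 : 0 < A * Q by lra.
have rr1 : 1 <= rr by apply: le_trans H3; rewrite -[1]mulr1 ler_pM.
have rr0 : 0 < rr by lra.
have N0 : 0 < N by rewrite -rr2 exprn_gt0.
have rrN : rr <= N by rewrite -rr2 expr2 ler_peMr// ltW.
have C1 := var_rate_ge1; set C0 := var_rate in C1 *.
have C00 : 0 <= C0 by lra.
have AQrr : A * Q / rr <= A^-1 by rewrite ler_pdivrMr// ler_pdivlMl.
have pr : p%:R <= rr.
  by rewrite pE; apply: le_trans H3; rewrite ler_peMl// ltW.
have KAQ : K * (A * Q) <= N by apply: le_trans H1; rewrite ler_wpM2l// lerDl ltW.
(* The blocks cover at most [N = rr^2] indices and [rr <= 2 A^2 Q], so their number is at most
   [4 A^3 Q], where [A = B^2]. *)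
have G2 : K <= 4 * (B ^+ 6 * Q).
  rewrite -(ler_pM2r AQ0); apply: (le_trans KAQ); rewrite -rr2.
  have -> : 4 * (B ^+ 6 * Q) * (A * Q) = (2 * (A * (A * Q))) ^+ 2 by rewrite AB; ring.
  by rewrite lerXn2r ?nnegrE// ?(ltW rr0)// (le_trans _ H4)// ltW.
(* The uncovered indices are the gaps, [K Q], and an incomplete period of length at most [A Q + Q];
   each of these three terms is at most [N / A]. *)
have G3 : 1 - K * p%:R / N <= 3 * A^-1.
  rewrite -(ler_pM2r N0) mulrBl mul1r divfK ?gt_eqF// pE.
  have h1 : K * Q <= A^-1 * N by rewrite ler_pdivlMl// mulrCA.
  have h2 : A * Q <= A^-1 * N by rewrite ler_pdivlMl// (le_trans H3).
  have h3 : Q <= A * Q by rewrite ler_peMl// ltW.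
  by lra.
have AiBi : A^-1 <= B^-1 by rewrite lef_pV2 ?posrE// AB expr2 ler_peMr// ltW.
have BA : B * A^-1 = B^-1 by rewrite AB; field; rewrite gt_eqF.
have /andP[V0 V1] := var_block_bounds p; rewrite -/C0 pE in V1.
set V := var_block p in V0 V1 *.
pose v := V / N; pose y := p%:R / rr.
have v0 : 0 <= v by rewrite divr_ge0// ltW.
have kv : K * v <= C0.
  rewrite /v mulrA ler_pdivrMr//; apply: (@le_trans _ _ (K * (A * Q * C0))); first by rewrite ler_wpM2l.
  by rewrite mulrA mulrC ler_wpM2l.
have y0 : 0 <= y by rewrite divr_ge0// ltW.
have yA : y <= A^-1 by rewrite /y pE.
pose S j (w : W n) := \sum_(i < j) (\sum_(t < p) X (i * (p + q) + t) w) / rr.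
have rest := rest_small p0 kn pr.
(* Cost of dropping the gaps and the final stretch. *)
have T1 : `|E (fun w => f ((\sum_(i < n) @X n i w) / rr)) - E (fun w => f (S k w))| <=
    L * ((1 + 3 * C0) / B).
  rewrite -(exB (hE n)).
  have -> : L * ((1 + 3 * C0) / B) = E (fun _ : W n => L * B^-1) + L * B * (3 * A^-1 * C0).
    by rewrite (ex_cst (hE n)) AB; field; rewrite gt_eqF.
  apply: (@le_trans _ _ (E (fun w => L * B^-1 + L * B * ((\sum_(i < n) X i w) / rr - S k w) ^+ 2))).
    apply: (ex_norm (hE n)) => w.
    have := lipschitz0 hf (S k w) ((\sum_(i < n) X i w) / rr - S k w).
    rewrite subrKC => /le_trans; apply.
    by rewrite -mulrA -mulrDr ler_wpM2l ?(ltW L0)// norm_le_sqr.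
  rewrite (exD (hE n)) !(ex_cst (hE n)) (exZ (hE n)) lerD2l; apply: ler_wpM2l; first by rewrite mulr_ge0// ltW.
  by apply: (le_trans rest); rewrite ler_wpM2r.
(* Cost of the Gaussian replacement. The 8 is the factor 2 of the decoupling errors times the 4 in
   [G2]. *)
have T2 : `|E (fun w => f (S k w)) - gexp (fun z => f (Num.sqrt v * Num.sqrt K * z))| <=
    L * (8 * B ^+ 6 * (Q * beta q) + (m2 + 2) * (C0 / B)).
  have Yb j w : (j < k)%N -> `|(\sum_(t < p) @X n (j * (p + q) + t) w) / rr| <= y.
    move=> _; rewrite normrM (gtr0_norm (_ : 0 < rr^-1)) ?invr_gt0// ler_wpM2r ?invr_ge0 ?(ltW rr0)//.
    rewrite (le_trans (ler_norm_sum _ _ _))//.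
    apply: (@le_trans _ _ (\sum_(t < p) 1)); first by apply: ler_sum.
    by rewrite sumr_const card_ord.
  have Yv j : (j < k)%N -> E (fun w => ((\sum_(t < p) @X n (j * (p + q) + t) w) / rr) ^+ 2) = v.
    move=> jk; have jn : (j * (p + q) + p <= n)%N.
      apply: leq_trans kn; apply: (@leq_trans (j.+1 * (p + q))).
        by rewrite mulSn addnC leq_add2r leq_addr.
      by rewrite leq_mul2r jk orbT.
    rewrite /v /V -(E_block jn) mulrC -(exZ (hE n)); congr E; apply/funext => w.
    by rewrite exprMn exprVn rr2 mulrC.
  have := lindeberg hf L0 (hE n) v0 Yb Yv (fun j u jk u1 => blocks_decoupled p0 kn pr jk u1).
  rewrite -/K => /le_trans; apply; rewrite ler_wpM2l ?(ltW L0)//.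
  have b1 : 2 * beta q * K <= 8 * B ^+ 6 * (Q * beta q).
    have := ler_wpM2r (beta0 q) G2; lra.
  have b2 : K * (y * v) <= C0 / B.
    rewrite mulrCA mulrC ler_pM//; first by rewrite mulr_ge0.
    exact: le_trans yA AiBi.
  have b3 : v * Num.sqrt K <= C0 / B.
    apply: (@le_trans _ _ (v * rr)).
      rewrite ler_wpM2l// ler_sqrt; last exact: ltW.
      apply: le_trans KAQ; rewrite ler_peMr//.
    apply: (@le_trans _ _ (C0 * A^-1)); last by rewrite ler_wpM2l.
    have -> : v * rr = V / rr by rewrite /v -rr2; field; rewrite gt_eqF.
    apply: (@le_trans _ _ (A * Q * C0 / rr)); first by rewrite ler_wpM2r// invr_ge0 ltW.
    by rewrite mulrAC mulrC ler_wpM2l.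
  have m20 : 0 <= m2 + 1 by rewrite addr_ge0// gexp_sqr_ge0.
  have := ler_wpM2l m20 b3; rewrite -/m2; lra.
(* Cost of the variance [K v] not being [Sigma2]: block variances are not yet at their limiting
   rate, and the blocks do not cover all indices. *)
have T3 : `|gexp (fun z => f (Num.sqrt v * Num.sqrt K * z)) - gexp (fun z => f (Num.sqrt Sigma2 * z))| <=
   L * (m1 * (B^-1 + B * `|V / p%:R - Sigma2| + 3 * C0 / B)).
  apply: (le_trans (gexp_lipschitz hf _ _)); rewrite -mulrA ler_wpM2l ?(ltW L0)// mulrC.
  apply: ler_wpM2l; first by apply: gexp_ge0.
  apply: (le_trans (norm_le_sqr _ B0)); rewrite -addrA lerD2l.
  have hx : 0 <= Num.sqrt v * Num.sqrt K by rewrite mulr_ge0// sqrtr_ge0.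
  have := sqr_sub_le hx (sqrtr_ge0 Sigma2).
  rewrite exprMn !sqr_sqrtr//; last exact: Sigma2_ge0.
  have dif : `|v * K - Sigma2| <= `|V / p%:R - Sigma2| + 3 * A^-1 * C0.
    have -> : v * K - Sigma2 = (V / p%:R - Sigma2) - (1 - K * p%:R / N) * (V / p%:R).
      by rewrite /v pE; field; rewrite !gt_eqF.
    rewrite (le_trans (ler_normB _ _))// lerD2l normrM.
    rewrite ger0_norm; last by rewrite subr_ge0 ler_pdivrMr// mul1r pE.
    rewrite ger0_norm; last by rewrite pE divr_ge0// ltW.
    rewrite ler_pM//; first by rewrite subr_ge0 ler_pdivrMr// mul1r pE.
      by rewrite pE divr_ge0// ltW.
    by rewrite pE ler_pdivrMr// mulrC.
  move=> h; have h5 := ler_wpM2l (ltW B0) (le_trans h dif).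
  apply: (le_trans h5).
  have -> : 3 * C0 / B = B * (3 * A^-1 * C0) by rewrite AB; field; rewrite gt_eqF.
  by rewrite mulrDr.
have -> : E (fun w => f ((\sum_(i < n) @X n i w) / rr)) - gexp (fun z => f (Num.sqrt Sigma2 * z)) =
  (E (fun w => f ((\sum_(i < n) @X n i w) / rr)) - E (fun w => f (S k w))) +
  (E (fun w => f (S k w)) - gexp (fun z => f (Num.sqrt v * Num.sqrt K * z))) +
  (gexp (fun z => f (Num.sqrt v * Num.sqrt K * z)) - gexp (fun z => f (Num.sqrt Sigma2 * z))) by ring.
rewrite (le_trans (ler_normD _ _))//.
rewrite (le_trans (lerD (le_trans (ler_normD _ _) (lerD T1 T2)) T3))//.
by rewrite -!mulrDr !addrA.
Qed.

Lemma clt_smooth :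
  (fun n => E (fun w => f ((\sum_(i < n) @X n i w) / Num.sqrt n%:R))) @ \oo -->
    gexp (fun z => f (Num.sqrt Sigma2 * z)).
Proof.
apply/cvgrPdist_le => e e0.
have C1 := var_rate_ge1; have m20 : 0 <= m2 by exact: gexp_sqr_ge0.
have m10 : 0 <= m1 by apply: gexp_ge0.
pose Cst := L * ((1 + 3 * var_rate) + (m2 + 2) * var_rate + m1 * (1 + 3 * var_rate)).
have Cst0 : 0 <= Cst.
  have h1 : 0 <= (m2 + 2) * var_rate by rewrite mulr_ge0//; lra.
  have h2 : 0 <= m1 * (1 + 3 * var_rate) by rewrite mulr_ge0//; lra.
  by rewrite /Cst mulr_ge0 ?(ltW L0)//; lra.
(* [b] is fixed before [n] grows and disposes of all terms of order [1 / b]. The two remaining terms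
   carry positive powers of [b], but vanish as [q] grows. *)
pose b := (Num.trunc (2 * Cst / e)).+1.
have b0 : (0 < b)%N by [].
have bR : (0 : R) < b%:R by rewrite ltr0n.
have Cb : Cst / b%:R <= e / 2.
  rewrite ler_pdivrMr// mulrAC ler_pdivlMr// [Cst * 2]mulrC [e * _]mulrC -ler_pdivrMr//.
  by apply/ltW; exact: truncnS_gt.
have e4 : 0 < e / 4 by rewrite divr_gt0.
have k1 : 0 < L * (8 * b%:R ^+ 6) by rewrite !mulr_gt0// exprn_gt0.
(* [m1 + 1] in place of [m1] keeps the divisor positive. *)
have k2 : 0 < L * (m1 + 1) * b%:R by rewrite !mulr_gt0// ltr_wpDl.
have e10 : 0 < e / 4 / (L * (8 * b%:R ^+ 6)) by rewrite divr_gt0.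
have e20 : 0 < e / 4 / (L * (m1 + 1) * b%:R) by rewrite divr_gt0.
have [Q1 hQ1] := beta_lin e10.
have /cvgrPdist_le/(_ _ e20)[Q2 _ hQ2] := var_block_rate.
pose Q := (maxn Q1 Q2).+1.
(* This makes the integer part [q] of [sqrt n / b^4] at least [Q], hence positive, and then
   [sqrt n < b^4 (q + 1) <= 2 b^4 q]. *)
exists ((b ^ 4 * Q.+1) ^ 2)%N => // n /= hn.
set rr := Num.sqrt n%:R.
have hr : (b ^ 4 * Q.+1)%:R <= rr.
  rewrite -[leLHS]ger0_norm// -sqrtr_sqr ler_sqrt// -natrX ler_nat//.
have B4 : (0 : R) < (b ^ 4)%:R by rewrite ltr0n expn_gt0.
pose q := Num.trunc (rr / (b ^ 4)%:R).
have x0 : 0 <= rr / (b ^ 4)%:R by rewrite divr_ge0 ?sqrtr_ge0// ltW.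
have /andP[t1 t2] := truncn_itv x0; rewrite -/q in t1 t2.
have Qq : (Q <= q)%N.
  rewrite -ltnS -(ltr_nat R); apply: le_lt_trans t2.
  rewrite ler_pdivlMr//; apply: le_trans hr.
  by rewrite -natrM ler_nat mulnC leq_mul2l leqnSn orbT.
have q0 : (0 < q)%N by apply: leq_trans Qq.
have h1 : (b ^ 4 * q)%:R <= rr by rewrite natrM mulrC -ler_pdivlMr.
have h2 : rr <= (2 * b ^ 4 * q)%:R.
  rewrite ltr_pdivrMr// in t2; apply: (le_trans (ltW t2)).
  rewrite -natrM ler_nat; apply: (@leq_trans ((2 * q) * b ^ 4)).
    by rewrite leq_mul2r mul2n -addnn -[q.+1]addn1 leq_add2l q0 orbT.
  by apply: eq_leq; ring.
rewrite distrC; apply: (le_trans (clt_estimate b0 q0 h1 h2)).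
have hb : q%:R * beta q <= e / 4 / (L * (8 * b%:R ^+ 6)).
  by apply: hQ1; apply: leq_trans Qq; rewrite leqW// leq_maxl.
have hv : `|var_block (b ^ 2 * q) / (b ^ 2 * q)%:R - Sigma2| <= e / 4 / (L * (m1 + 1) * b%:R).
  rewrite distrC; apply: hQ2 => /=; apply: (@leq_trans q).
    by apply: leq_trans Qq; rewrite leqW// leq_maxr.
  by rewrite leq_pmull// expn_gt0.
set vv := `|_ - Sigma2| in hv *.
have g1 : L * (8 * b%:R ^+ 6 * (q%:R * beta q)) <= e / 4.
  by rewrite mulrA mulrC -ler_pdivlMr.
have g2 : L * (m1 * (b%:R * vv)) <= e / 4.
  have v0 : 0 <= vv by exact: normr_ge0.
  have h3 : L * (m1 + 1) * b%:R * vv <= e / 4 by rewrite mulrC -ler_pdivlMr.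
  have h4 : 0 <= L * (b%:R * vv) by apply: mulr_ge0; [exact: ltW|apply: mulr_ge0 => //; exact: ltW].
  have -> : L * (m1 * (b%:R * vv)) = L * (m1 + 1) * b%:R * vv - L * (b%:R * vv) by ring.
  lra.
have -> : L * ((1 + 3 * var_rate) / b%:R + 8 * b%:R ^+ 6 * (q%:R * beta q) +
       (m2 + 2) * (var_rate / b%:R) + m1 * (b%:R^-1 + b%:R * vv + 3 * var_rate / b%:R)) =
   Cst / b%:R + L * (8 * b%:R ^+ 6 * (q%:R * beta q)) + L * (m1 * (b%:R * vv)).
  by rewrite /Cst; field; rewrite gt_eqF.
lra.
Qed.

End SmoothLimit.

Lemma var_sum_norm_le n : E (fun w => ((\sum_(i < n) @X n i w) / Num.sqrt n%:R) ^+ 2) <= var_rate.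
Proof.
have C1 := var_rate_ge1.
have -> : (fun w => ((\sum_(i < n) @X n i w) / Num.sqrt n%:R) ^+ 2) =
    fun w => n%:R^-1 * (\sum_(i < n) @X n i w) ^+ 2.
  by apply/funext => w; rewrite exprMn exprVn sqr_sqrtr// mulrC.
(* At [n = 0] the convention that 0 has inverse 0 makes the left side vanish. *)
rewrite (exZ (hE n)); case: n => [|n]; first by rewrite invr0 mul0r; apply: le_trans C1.
rewrite mulrC ler_pdivrMr// mulrC.
by have := var_sum_le n.+1 xpredT; rewrite sumr_const card_ord.
Qed.

Lemma law_normalized_sum n V : var_rate <= V ->
  law (fun g => E (fun w => g ((\sum_(i < n) @X n i w) / Num.sqrt n%:R))) V.
Proof.
move=> hV; split.
- by move=> f g _ _; exact: (exD (hE n)).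
- by move=> k f _; exact: (exZ (hE n)).
- by move=> k; exact: (ex_cst (hE n)).
move=> f g e k _ _ e0 k0 fg; rewrite -(exB (hE n)).
apply: (le_trans (ex_norm (hE n) (fun w => fg _))).
rewrite (exD (hE n)) (ex_cst (hE n)) (exZ (hE n)) lerD2l ler_wpM2l//.
exact: le_trans (var_sum_norm_le n) hV.
Qed.

Lemma gint_bcont g (t : R) : bcont g -> gint (fun z => g (t * z)).
Proof.
move=> [cg [M gM]]; apply: (gint_bdd _ (fun x => gM (t * x))).
apply: continuous_measurable_fun => x.
apply: (@continuous_comp _ _ _ (fun z : R => t * z) g); last exact: cg.
by apply: cvgM; [exact: cvg_cst|exact: cvg_id].
Qed.

Lemma law_gexp (t V : R) : t ^+ 2 * gexp (fun z : R => z ^+ 2) <= V ->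
  law (fun g => gexp (fun z => g (t * z))) V.
Proof.
move=> hV; split.
- by move=> f g bf bg; rewrite gexpD//; exact: gint_bcont.
- by move=> k f bf; rewrite gexpZ//; exact: gint_bcont.
- by move=> k; exact: gexp_cst.
move=> f g e k bf bg e0 k0 fg.
have hq : gint (fun z : R => k * (t ^+ 2 * z ^+ 2)) by do 2 apply: gintZ; exact: gint_sqr.
have hh : gint (fun z : R => e + k * (t ^+ 2 * z ^+ 2)) by apply: gintD => //; exact: gint_cst.
apply: (le_trans (gexp_dist_le (gint_bcont t bf) (gint_bcont t bg) hh _)).
  by move=> x; rewrite -exprMn; exact: fg.
rewrite gexpD//; last exact: gint_cst.
rewrite gexp_cst gexpZ; last by apply: gintZ; exact: gint_sqr.
by rewrite gexpZ; [rewrite lerD2l ler_wpM2l|exact: gint_sqr].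
Qed.

Lemma clt g : bcont g ->
  (fun n => E (fun w => g ((\sum_(i < n) @X n i w) / Num.sqrt n%:R))) @ \oo -->
    gexp (fun z => g (Num.sqrt Sigma2 * z)).
Proof.
have S0 := Sigma2_ge0; have m20 := gexp_sqr_ge0 R.
(* One bound must cover the second moments of the normalized sums and of the Gaussian, hence their
   sum. *)
apply: (@portmanteau R (fun n g => E (fun w => g ((\sum_(i < n) @X n i w) / Num.sqrt n%:R)))
  (fun g => gexp (fun z => g (Num.sqrt Sigma2 * z)))
  (var_rate + Sigma2 * gexp (fun z : R => z ^+ 2))).
- by move=> n; apply: law_normalized_sum; rewrite lerDl mulr_ge0.
- by apply: law_gexp; rewrite sqr_sqrtr// lerDr; have := var_rate_ge1; apply: le_trans.
move=> a x; have [f1 [f2 [L h]]] := smooth3_logistic a x.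
apply: (clt_smooth h); apply: lt_le_trans (smooth3_b0 h x).
by rewrite normr_gt0 gt_eqF// logistic_gt0.
Qed.

Lemma degenerate_l2 : Sigma2 = 0 ->
  (fun n => E (fun w => ((\sum_(i < n) @X n i w) / Num.sqrt n%:R) ^+ 2)) @ \oo --> (0 : R).
Proof.
move=> S0; have := var_sum_rate; rewrite S0; apply: cvg_trans.
apply: near_eq_cvg; near=> n; rewrite mulrC -(exZ (hE n)); congr E.
by apply/funext => w; rewrite exprMn exprVn sqr_sqrtr// mulrC.
Unshelve. all: by end_near. Qed.

(** Chebyshev's inequality, with the event written as an indicator function. *)
Lemma degenerate_prob eps : Sigma2 = 0 -> 0 < eps ->
  (fun n => E (fun w => (eps < `|(\sum_(i < n) @X n i w) / Num.sqrt n%:R|)%R%:R)) @ \oo --> (0 : R).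
Proof.
move=> /degenerate_l2 h e0; have e2 : 0 < eps ^+ 2 by rewrite exprn_gt0.
have : (fun n => (eps ^+ 2)^-1 * E (fun w => ((\sum_(i < n) @X n i w) / Num.sqrt n%:R) ^+ 2)) @ \oo
    --> (0 : R) by exact: cvgr0_mull.
apply: (squeeze_cvgr _ (cvg_cst 0)); near=> n; apply/andP; split.
  by apply: (ex_ge0 (hE n)) => w.
rewrite -(exZ (hE n)); apply: (ex_le (hE n)) => w.
set x := _ / _; case: ltP => hx /=; last by rewrite mulr_ge0 ?sqr_ge0// invr_ge0 ltW.
by rewrite mulrC ler_pdivlMr// mul1r -(real_normK (num_real x)) lerXn2r// ?nnegrE ltW.
Unshelve. all: by end_near. Qed.

End Stationary.

(** * Monotone summable rates *)

Section GapRate.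
Variable R : realType.

(* The block argument needs a nonincreasing rate. *)
Fixpoint running_min (M : R) (g : nat -> R) k : R :=
  if k is k'.+1 then Num.min (running_min M g k') (g k') else M.

(** A gap [q] leaves room for every [t] with [2 (t + 1) + m <= q], and the best of these bounds is
    the running minimum up to [(q - m) / 2]. *)
Lemma gap_rate (M : R) (g : nat -> R) (m : nat) : 0 <= M -> (forall t, 0 <= g t) ->
  cvgn (series g) -> exists beta : nat -> R,
  [/\ forall q, 0 <= beta q, forall q, beta q.+1 <= beta q, cvgn (series beta) &
   forall q x, x <= M -> (forall t, (t.+1.*2 + m <= q)%N -> x <= g t) -> x <= beta q].
Proof.
move=> M0 g0 gs; pose rm := running_min M g.
have rm0 k : 0 <= rm k by elim: k => [|k IH] //=; rewrite le_min IH g0.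
have rmd j k : (j <= k)%N -> rm k <= rm j.
  by apply: (homo_leq (r := fun x y => y <= x)) => // [y x z /[swap]|i]; [exact: le_trans|rewrite /= ge_min lexx].
pose beta q := rm (q - m)./2; exists beta; split.
- by move=> q; exact: rm0.
- by move=> q; apply: rmd; apply: half_leq; apply: leq_sub2r.
- have nd : nondecreasing_seq (series beta).
    by apply: (@nondecreasing_series _ _ xpredT 0) => n _ _; exact: rm0.
  (* The first [m] gaps cost [M] each. From then on each running minimum occurs twice; the first is
     [M] and every later one is at most the preceding term of [g]. *)
  apply: nondecreasing_is_cvgn => //; exists (M *+ m + (M + limn (series g)) *+ 2).
  move=> _ [n _ <-]; apply: (@le_trans _ _ (series beta (m + n.+1 * 2)%N)).
    by apply: nd; rewrite (leq_trans _ (leq_addl _ _))// muln2 -addnn (leq_trans (leqnSn _))// leq_addr.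
  rewrite seriesEord /= big_split_ord /= lerD//.
    rewrite -[in leRHS](card_ord m) -sumr_const; apply: ler_sum => j _.
    exact: (rmd 0%N _ (leq0n _)).
  rewrite (sum_blocks 2 n.+1 (fun j => beta (m + j)%N)).
  have gp k : \sum_(j < k) g j <= limn (series g).
    have := nondecreasing_cvgn_le (nondecreasing_series (fun i _ _ => g0 i)) gs k.
    by rewrite {1}/series /= big_mkord.
  apply: (@le_trans _ _ ((\sum_(j < n.+1) rm j) *+ 2)).
    rewrite -sumrMnl; apply: ler_sum => j _.
    rewrite big_ord_recr big_ord_recr big_ord0/= add0r addn0 addn1 mulr2n /beta !addKn.
    by rewrite muln2 doubleK -[(j.*2).+1]/(true + j.*2)%N half_bit_double.
  rewrite lerMn2r big_ord_recl/= lerD2l; apply: le_trans (gp n).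
  by apply: ler_sum => j _ /=; rewrite ge_min lexx orbT.
move=> q x xM hx.
have : forall t, (t <= (q - m)./2)%N -> x <= rm t.
  elim=> [|t IH] ht //=; rewrite le_min IH ?(ltnW ht)//= hx//.
  case: (leqP m q) => mq; last by move: ht; rewrite (eqP (ltnW mq)).
  by rewrite addnC -leq_subRL// -[leqRHS]odd_double_half (leq_trans _ (leq_addl _ _))// leq_double.
exact.
Qed.

Lemma minr1_le_powR (x e : R) : 0 < e -> e <= 1 -> Num.min 1 x <= x `^ e.
Proof.
move=> e0 e1; rewrite ge_min; apply/orP; case: (lerP x 0) => x0.
  by right; rewrite (le_trans x0)// powR_ge0.
case: (lerP 1 x) => x1.
  by left; rewrite -(powRr0 x) ler_powR// ltW.
by right; rewrite ger1_powR// x0 ltW.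
Qed.

End GapRate.

(** * Counts of a pattern *)

Section PatternCounts.
Variables (R : realType) (dO : measure_display) (O : measurableType dO).
Variables (P : probability O R) (A : finType) (d : nat).
Variables (T : A -> O -> 'M[R[i]]_d -> 'M[R[i]]_d) (theta thetainv : O -> O).
Variables (s : O -> 'M[R[i]]_d) (r : nat -> R).
Hypothesis hT : random_instrument P T.
Hypotheses (mth : measurable_fun setT theta) (mthi : measurable_fun setT thetainv).
Hypotheses (thK : cancel theta thetainv) (pth : measure_preserving P theta).
Hypotheses (hs : random_state s) (ds : dyn_stationary P T theta s).
Hypothesis hr : forall vt : O -> 'M[R[i]]_d, random_state vt ->
     forall n : nat, (0 < n)%N ->
       (\int[P]_w (tracenorm (Phin T theta n w (vt w) - s (iter n theta w)))%:E
          <= (r n)%:E)%E.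
Variables (m : nat) (b : m.-tuple A).
Hypothesis m0 : (0 < m)%N.

Local Notation Ex := (annE P T theta s).

Lemma annE_expectation N : is_expectation (Ex N).
Proof.
split.
- by move=> F G; exact: annE_fD.
- by move=> c F; exact: annE_fZ.
- by move=> F F0; apply: annE_ge0.
- by move=> c; exact: annE_cst.
Qed.

Lemma dN_take i k (w : seq A) : (i + m <= k)%N -> dN R b i.+1 (take k w) = dN R b i.+1 w.
Proof.
by move=> ik; rewrite /dN /= !take_drop take_takel// addnC.
Qed.

Lemma dN_drop i p (w : seq A) : dN R b i.+1 (drop p w) = dN R b (p + i).+1 w.
Proof. by rewrite /dN /= drop_drop addnC. Qed.

Let mu := Ex m (dN R b 1).
(** Indices start at 0 here and positions in words at 1; [n] counts need [n + m - 1] letters. *)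
Let X (n i : nat) (w : seq A) : R := dN R b i.+1 w - mu.

Let dN01 k w : 0 <= dN R b k w <= 1.
Proof. by rewrite /dN; case: eqP; rewrite ?lexx ler01. Qed.

Let mu01 : 0 <= mu <= 1.
Proof.
have hE := annE_expectation m; apply/andP; split.
  by apply: (ex_ge0 hE) => w; have /andP[] := dN01 1 w.
by rewrite -(ex_cst hE 1); apply: (ex_le hE) => w; have /andP[] := dN01 1 w.
Qed.

Lemma centered_count_le1 n i w : `|X n i w| <= 1.
Proof.
by rewrite /X ler_norml; move: mu01 (dN01 i.+1 w) => /andP[? ?] /andP[? ?]; apply/andP; split; lra.
Qed.

Lemma centered_counts_le1 n (u : seq nat) w t : `|nth 0 [seq X n j w | j <- u] t| <= 1.
Proof.
case: (ltnP t (size u)) => tu; first by rewrite (nth_map 0%N)// centered_count_le1.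
by rewrite nth_default ?size_map// normr0 ler01.
Qed.

Lemma annE_shift i N (F : seq A -> R) : (i <= N)%N ->
  Ex N (fun w => F (drop i w)) = Ex (N - i) F.
Proof. by move=> iN; rewrite -{1}(subnKC iN); exact: annE_drop. Qed.

Lemma annE_truncate k N (F : seq A -> R) : (k <= N)%N ->
  Ex N (fun w => F (take k w)) = Ex k F.
Proof. by move=> kN; rewrite -{1}(subnKC kN); exact: annE_take. Qed.

Lemma annE_count n i : (i < n)%N -> Ex (n + m.-1) (X n i) = 0.
Proof.
move=> hi; have hN : (i + m <= n + m.-1)%N.
  by rewrite -{1}(prednK m0) -addSnnS leq_add2r.
have -> : X n i = fun w => X n 0 (drop i w).
  by apply/funext => w; rewrite /X dN_drop addn0.
rewrite (@annE_shift i _ (X n 0)) ?(leq_trans (leq_addr m i))//.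
have -> : X n 0 = fun w => X n 0 (take m w).
  by apply/funext => w; rewrite /X dN_take.
rewrite (@annE_truncate m _ (X n 0)); last by rewrite leq_subRL// (leq_trans (leq_addr m i)).
have hE := annE_expectation m.
by rewrite /X (exB hE) (ex_cst hE) subrr.
Qed.

Lemma annE_count2 n i j : (i <= j)%N -> (j < n)%N ->
  Ex (n + m.-1) (fun w => X n i w * X n j w) =
  Ex ((j - i) + m) (fun w => (dN R b 1 w - mu) * (dN R b (j - i).+1 w - mu)).
Proof.
move=> ij hj; have hN : (j + m <= n + m.-1)%N.
  by rewrite -{1}(prednK m0) -addSnnS leq_add2r.
have iN : (i <= n + m.-1)%N by rewrite (leq_trans ij)// (leq_trans (leq_addr m j)).
have -> : (fun w => X n i w * X n j w) =
   fun w => (fun w => X n 0 w * X n (j - i) w) (drop i w).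
  by apply/funext => w; rewrite /X !dN_drop addn0 subnKC.
rewrite (@annE_shift i _ (fun w => X n 0 w * X n (j - i) w))//.
have hk : (j - i + m <= n + m.-1 - i)%N by rewrite leq_subRL// addnA subnKC.
rewrite -(annE_truncate _ hk); congr (Ex _); apply/funext => w.
by rewrite /X !dN_take// leq_addl.
Qed.

(** A count reads [m] letters, so the first [i] counts live on the first [i + m] letters. That
    shortens the gap from [q] to [q - m] letters, still enough for two stretches of [t + 1]. *)
Lemma pattern_mixing n i q l t (F G : seq R -> R) : (i + q + l <= n)%N ->
  (t.+1.*2 + m <= q)%N ->
  (forall x, (forall t, `|nth 0 x t| <= 1) -> `|F x| <= 1) ->
  (forall x, (forall t, `|nth 0 x t| <= 1) -> `|G x| <= 1) ->
  `|Ex (n + m.-1) (fun w => F [seq X n t w | t <- iota 0 i] * G [seq X n t w | t <- iota (i + q) l])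
    - Ex (n + m.-1) (fun w => F [seq X n t w | t <- iota 0 i]) *
      Ex (n + m.-1) (fun w => G [seq X n t w | t <- iota (i + q) l])| <=
  4 * fine (alpha_mix P T theta thetainv t.+1) + 7 * (tracenorm_factor R d + 1) * r t.+1.
Proof.
move=> hn tq F1 G1; set k := (i + m)%N; set p := (k + t.+1 + t.+1)%N.
have pq : (p <= i + q)%N by rewrite /p /k -!addnA leq_add2l addnn addnC.
have pN : (p <= n + m.-1)%N.
  by rewrite (leq_trans pq)// (leq_trans (leq_addr l _))// (leq_trans hn)// leq_addr.
have kp : (k <= n + m.-1)%N by rewrite (leq_trans _ pN)// /p -addnA leq_addr.
pose F' u := F [seq X n t u | t <- iota 0 i].
pose G' u := G [seq X n t u | t <- iota (i + q - p) l].
have eF u : F [seq X n t u | t <- iota 0 i] = F' (take k u).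
  congr F; apply/eq_in_map => j; rewrite mem_iota add0n => /andP[_ ji].
  by rewrite /X dN_take// leq_add2r ltnW.
have eG u : G [seq X n t u | t <- iota (i + q) l] = G' (drop p u).
  congr G; rewrite -{1}(subnKC pq) iotaDl -map_comp.
  by apply: eq_map => j; rewrite /= /X dN_drop.
have F'1 u : `|F' u| <= 1 by apply: F1 => j; exact: centered_counts_le1.
have G'1 u : `|G' u| <= 1 by apply: G1 => j; exact: centered_counts_le1.
have k0 : (0 < k)%N by rewrite addn_gt0 m0 orbT.
have -> : (fun w => F [seq X n t w | t <- iota 0 i]) = fun w => F' (take k w).
  by apply/funext => w; rewrite eF.
have -> : (fun w => G [seq X n t w | t <- iota (i + q) l]) = fun w => G' (drop p w).
  by apply/funext => w; rewrite eG.
have -> : (fun w => F [seq X n t w | t <- iota 0 i] * G [seq X n t w | t <- iota (i + q) l]) =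
   fun w => F' (take k w) * G' (drop p w).
  by apply/funext => w; rewrite eF eG.
rewrite (@annE_shift p _ G')// (@annE_truncate k _ F')// -{1}(subnKC pN).
by apply: annE_mixing.
Qed.

End PatternCounts.

Lemma cov_le2 (R : realType) (W : Type) (E : (W -> R) -> R) (f g : W -> R) :
  is_expectation E -> (forall w, `|f w| <= 1) -> (forall w, `|g w| <= 1) ->
  `|E (fun w => f w * g w) - E f * E g| <= 2.
Proof.
move=> hE f1 g1.
have b1 h : (forall w, `|h w| <= 1) -> `|E h| <= 1.
  by move=> h1; rewrite -[leRHS](ex_cst hE 1); exact: ex_norm.
rewrite (le_trans (ler_normB _ _))// (_ : 2 = 1 + 1)// lerD//.
  by apply: b1 => w; rewrite normrM mulr_ile1.
by rewrite normrM mulr_ile1// b1.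
Qed.

(** If one of the powers is at least 1, the trivial bound 2 decides; otherwise [a] and [r] lie below
    their powers. *)
Lemma mixing_rate_powR (R : realType) (x a r C e : R) : 0 <= C -> 0 < e -> e <= 1 ->
  x <= 2 -> x <= 4 * a + C * r -> x <= (4 + C) * (a `^ e + r `^ e).
Proof.
move=> C0 e0 e1 x2 xar.
have pa := powR_ge0 a e; have pr := powR_ge0 r e.
have Ca := mulr_ge0 C0 pa; have Cr := mulr_ge0 C0 pr.
have := minr1_le_powR a e0 e1; have := minr1_le_powR r e0 e1.
rewrite !ge_min => /orP[r1|rr] /orP[a1|aa]; nra.
Qed.

Theorem theorem2
  (R : realType) (dO : measure_display) (O : measurableType dO)
  (P : probability O R) (A : finType) (d : nat)
  (T : A -> O -> 'M[R[i]]_d -> 'M[R[i]]_d)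
  (theta thetainv : O -> O)
  (delta : R) (s : O -> 'M[R[i]]_d) (r : nat -> R)
  (m : nat) (b : m.-tuple A) :
  random_instrument P T ->
  (* (H1) *)
  measurable_fun setT theta -> measurable_fun setT thetainv ->
  cancel theta thetainv -> cancel thetainv theta ->
  ergodic P theta -> measure_preserving P theta ->
  (* (H2) *)
  0 < delta ->
  cvgn (series (fun n => powR (fine (alpha_mix P T theta thetainv n.+1))
                              (delta / (2 + delta)))) ->
  (* (H3) *)
  random_state s -> dyn_stationary P T theta s ->
  (forall n, (0 < n)%N -> 0 <= r n) ->
  cvgn (series (fun n => powR (r n.+1) (delta / (2 + delta)))) ->
  (forall vt : O -> 'M[R[i]]_d, random_state vt ->
     forall n : nat, (0 < n)%N ->
       (\int[P]_w (tracenorm (Phin T theta n w (vt w) - s (iter n theta w)))%:E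
          <= (r n)%:E)%E) ->
  (0 < m)%N ->
  let mu := annE P T theta s m (dN R b 1) in
  let c := fun k : nat =>
    annE P T theta s (k + m) (fun w => (dN R b 1 w - mu) * (dN R b k.+1 w - mu)) in
  let Sigma2 := c 0%N + 2 * limn (series (fun k => c k.+1)) in
  let Sn := fun (n : nat) (w : seq A) =>
    \sum_(1 <= k < n.+1) (dN R b k w - mu) in
  [/\ cvgn (series (fun k => `|c k.+1|)),
      0 <= Sigma2,
      (forall g : R -> R, continuous g -> (exists M, forall x, `|g x| <= M) ->
         (fun n : nat =>
            annE P T theta s (n + m.-1) (fun w => g (Sn n w / Num.sqrt n%:R)))
         @ \oo --> gauss_expect Sigma2 g)
    & (Sigma2 = 0 ->
         (fun n : nat =>
            annE P T theta s (n + m.-1) (fun w => (Sn n w / Num.sqrt n%:R) ^+ 2))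
           @ \oo --> 0
         /\ (forall eps : R, 0 < eps ->
               (fun n : nat =>
                  annE P T theta s (n + m.-1)
                    (fun w => (eps < `|Sn n w / Num.sqrt n%:R|)%R%:R))
                 @ \oo --> 0))].

Proof.
move=> hT mth mthi thK thiK erg pth delta0 hA hs ds r0 hR hr m0 mu c S2 Sn.
pose e := delta / (2 + delta).
have e0 : 0 < e by rewrite divr_gt0// addr_gt0.
have e1 : e <= 1 by rewrite ler_pdivrMr ?addr_gt0// mul1r lerDr.
pose C := 7 * `|tracenorm_factor R d + 1|.
have C0 : 0 <= C by rewrite mulr_ge0.
pose a n := fine (alpha_mix P T theta thetainv n.+1).
pose g n := (4 + C) * (a n `^ e + r n.+1 `^ e).
have g0 n : 0 <= g n by rewrite mulr_ge0 ?addr_ge0 ?powR_ge0.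
have gs : cvgn (series g).
  by apply: is_cvg_seriesZ; apply: is_cvg_seriesD.
(* The cap 2 is the trivial bound on a covariance of two functions bounded by 1; it serves gaps too
   short for any mixing. *)
have [beta [beta0 betad betas hbeta]] := gap_rate m (ler0n R 2) g0 gs.
pose E n := annE P T theta s (n + m.-1).
pose X (n i : nat) (w : seq A) : R := dN R b i.+1 w - mu.
have hE n : is_expectation (E n) by exact: annE_expectation.
have X1 n i w : `|X n i w| <= 1 by exact: centered_count_le1.
have Xl n (u : seq nat) w t : `|nth 0 [seq X n j w | j <- u] t| <= 1.
  exact: centered_counts_le1.
have EX0 n i : (i < n)%N -> E n (X n i) = 0 by exact: annE_count.
have EXX n i j : (i <= j)%N -> (j < n)%N -> E n (fun w => X n i w * X n j w) = c (j - i)%N.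
  exact: annE_count2.
have hmix n i q l (F G : seq R -> R) : (i + q + l <= n)%N ->
  (forall x, (forall t, `|nth 0 x t| <= 1) -> `|F x| <= 1) ->
  (forall x, (forall t, `|nth 0 x t| <= 1) -> `|G x| <= 1) ->
  `|E n (fun w => F [seq X n t w | t <- iota 0 i] * G [seq X n t w | t <- iota (i + q) l])
    - E n (fun w => F [seq X n t w | t <- iota 0 i]) *
      E n (fun w => G [seq X n t w | t <- iota (i + q) l])| <= beta q.
  move=> hn F1 G1.
  have c2 := cov_le2 (hE n) (fun w => F1 _ (Xl n (iota 0 i) w)) (fun w => G1 _ (Xl n (iota (i + q) l) w)).
  apply: hbeta => // t tq; apply: mixing_rate_powR => //.
  have := pattern_mixing hT mth mthi thK pth hs ds hr b m0 hn tq F1 G1.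
  move=> /le_trans; apply; rewrite lerD2l /C.
  by rewrite ler_wpM2r ?r0// ler_wpM2l// ler_norm.
have SnE n w : Sn n w = \sum_(i < n) X n i w.
  by rewrite /Sn big_add1 big_mkord.
split.
- exact: (autocov_summable EX0 EXX hmix beta0 betas).
- exact: (Sigma2_ge0 hE X1 EX0 EXX hmix beta0 betas).
- move=> h ch [M hM]; rewrite gauss_expect_gexp//; last 2 first.
  + exact: (Sigma2_ge0 hE X1 EX0 EXX hmix beta0 betas).
  + by exists M.
  have := clt hE X1 EX0 EXX hmix beta0 betad betas (conj ch (ex_intro _ M hM)).
  by under eq_fun do under eq_fun do rewrite -SnE.
move=> S0; split.
  have := degenerate_l2 hE EX0 EXX hmix beta0 betas S0.
  by under eq_fun do under eq_fun do rewrite -SnE.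
move=> eps eps0; have := degenerate_prob hE EX0 EXX hmix beta0 betas S0 eps0.
by under eq_fun do under eq_fun do rewrite -SnE.
Qed.
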